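(* Let $(M^7,\eta,\Phi,\Upsilon)$ be a contact Calabi--Yau $7$-manifold with transverse Kähler form $\omega=d\eta$ and transverse holomorphic $(3,0)$-form $\Upsilon$, and let $A\in\mathbb{R}$. Suppose $(\omega_t,\Upsilon_t)$ is a smooth family of compatible transverse $\mathrm{SU}(3)$-structures on $M$ with $\omega_0=\omega$, $\Upsilon_0=\Upsilon$, satisfying $$\frac{\partial}{\partial t}\omega_t=-\mathcal{L}_{\nabla_t(\log|\Upsilon_t|_{\omega_t})}\omega_t+\beta_t,\qquad \frac{\partial}{\partial t}\Upsilon_t=\mathcal{L}_{\nabla_t(\log|\Upsilon_t|_{\omega_t})}\Upsilon_t+\gamma_t,$$ where $\beta_t\in\Omega^2_B(M)$ and $\gamma_t\in\Omega^3_B(M)$ (complex-valued in the case of $\gamma_t$). Suppose further that there exists a family of basic functions $\{f_t\}$ such that $\omega_t=\omega+dd^cf_t$, and let $\eta_t:=\eta+d^cf_t$. Then the family of $\mathrm{G}_2$-structures $$\varphi_t=\mathrm{Re}\left(\frac{1}{|\Upsilon_t|_{\omega_t}}\Upsilon_t\right)+|\Upsilon_t|_{\omega_t}\,\eta_t\wedge\omega_t$$ is a solution of the modified Laplacian coflow with constant $A$ if, and only if, for all $t$, \begin{align*} \beta_t\wedge\omega_t&=-|\Upsilon_t|^2_{\omega_t}\,\omega_t^2+A|\Upsilon_t|_{\omega_t}\,\omega_t^2-\frac{A}{|\Upsilon_t|_{\omega_t}}\,d(\log|\Upsilon_t|_{\omega_t})\wedge\mathrm{Re}\,\Upsilon_t\\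 &\quad-\left(\mathcal{L}_{\nabla_t(\log|\Upsilon_t|_{\omega_t})}d^cf_t\right)\wedge\mathrm{Im}\,\Upsilon_t-\Big(\nabla_t(\log|\Upsilon_t|_{\omega_t})\lrcorner\,\omega\Big)\wedge\mathrm{Im}\,\Upsilon_t+\left(\frac{\partial}{\partial t}d^cf_t\right)\wedge\mathrm{Im}\,\Upsilon_t,\\ \mathrm{Im}(\gamma_t)&=-2|\Upsilon_t|^2_{\omega_t}\,d(\log|\Upsilon_t|_{\omega_t})\wedge\omega_t+A|\Upsilon_t|_{\omega_t}\,d(\log|\Upsilon_t|_{\omega_t})\wedge\omega_t . \end{align*}
   Context: A Sasakian structure $(\xi,\eta,\Phi,g)$ on $M^7$: $\xi$ (Reeb field) is a vector field, $\eta$ (contact form) a $1$-form, $\Phi$ a $(1,1)$-tensor with $\eta(\xi)=1$, $\Phi^2=-\mathrm{Id}+\eta\otimes\xi$, $\eta\wedge(d\eta)^3\neq0$, $g$ a metric with $g(\Phi X,\Phi Y)=g(X,Y)-\eta(X)\eta(Y)$, $g=d\eta\circ(1\otimes\Phi)+\eta\otimes\eta$, such that the cone $(\mathbb{R}_{>0}\times M,dr^2+r^2g)$ is Kähler. A form $\alpha$ is basic if $\xi\lrcorner\alpha=0$ and $\mathcal{L}_\xi\alpha=0$; $\Omega^k_B(M)$ denotes basic $k$-forms. $\Phi$ induces an (integrable) transverse complex structure $J$ on $TM/\mathbb{R}\xi\cong\mathcal{D}=\ker\eta$, giving types $(p,q)$ and operators $\partial,\bar\partial$ on basic forms, and $d^c=\frac{\sqrt{-1}}{2}(\bar\partial-\partial)$.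 A contact Calabi--Yau $7$-manifold $(M^7,\eta,\Phi,\Upsilon)$ is a $7$-dimensional Sasakian manifold with vanishing first basic Chern class $c_1^B(M)=0$ and a nowhere-vanishing closed transverse (basic) form $\Upsilon$ of type $(3,0)$ on $\mathcal{D}$; with $\omega=d\eta$, the basic function $|\Upsilon|_\omega>0$ is defined by $\frac{\omega^3}{3!}=\frac{i}{8}\frac{1}{|\Upsilon|^2_\omega}\Upsilon\wedge\overline{\Upsilon}$. The same formula with $\omega_t,\Upsilon_t$ defines $|\Upsilon_t|_{\omega_t}$. A compatible transverse $\mathrm{SU}(3)$-structure $(\omega_t,\Upsilon_t)$ consists of a basic transverse Kähler form $\omega_t$ (closed, of type $(1,1)$ and positive with respect to the transverse complex structure) and a nowhere-vanishing closed basic form $\Upsilon_t$ of type $(3,0)$. The Reeb field $\xi$, the basic forms, and the transverse complex structure $J$ are fixed in $t$. A $\mathrm{G}_2$-structure $\varphi\in\Omega^3(M^7)$ determines a metric $g_\varphi$ and volume form by $(X\lrcorner\varphi)\wedge(Y\lrcorner\varphi)\wedge\varphi=6g_\varphi(X,Y)\mathrm{vol}_\varphi$, a Hodge star $\ast_\varphi$, the dual $4$-form $\psi=\ast_\varphi\varphi$, and the scalar torsion $\tau_0=\frac17\ast_\varphi(\varphi\wedge d\varphi)$. A family $\varphi_t$ solves the modified Laplacian coflow with constant $A$ if $\psi_t=\ast_t\varphi_t$ satisfies $$\frac{\partial}{\partial t}\psi_t=\Delta_t\psi_t+d\Big(\big(A-\tfrac72(\tau_0)_t\big)\varphi_t\Big),$$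 where $\Delta_t=dd^{\ast_t}+d^{\ast_t}d$ is the Hodge Laplacian of $g_t=g_{\varphi_t}$. $\nabla_t f$ is the gradient of $f$ with respect to $g_t$. *)

(* Defs.v *)
From HB Require Import structures.
From mathcomp Require Import all_boot all_order all_algebra.
From mathcomp Require Import complex.
From mathcomp Require Import all_classical all_reals all_analysis.

Set Implicit Arguments.
Unset Strict Implicit.
Unset Printing Implicit Defensive.

Import Order.TTheory GRing.Theory Num.Theory.
Import numFieldNormedType.Exports.

Local Open Scope classical_set_scope.
Local Open Scope ring_scope.
Local Open Scope complex_scope.

(* Tangent vectors are row vectors; a linear map A acts by v |-> v *m A, and   *)
(* a bilinear form G by (v, w) |-> v *m G *m w^T.                              *)

Section ExteriorAlgebra.

(* alpha S is the coefficient of dx^{s_1} /\ ... /\ dx^{s_k}, where            *)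
(* s_1 < ... < s_k are the elements of S; forms of all degrees share one type. *)
Definition ext_form (K : Type) (n : nat) := {ffun {set 'I_n} -> K}.

Definition map_form (K K' : Type) n (h : K -> K') (a : ext_form K n) : ext_form K' n :=
  [ffun S : {set 'I_n} => h (a S)].

Variables (K : comNzRingType) (n : nat).
Implicit Types (a b : ext_form K n) (v : 'rV[K]_n) (S : {set 'I_n}).

(* The sign of the shuffle merging A and B, for disjoint A and B. *)
Definition shuffle_sign (A B : {set 'I_n}) : K :=
  (-1) ^+ #|[pred p : 'I_n * 'I_n | [&& p.1 \in A, p.2 \in B & (p.2 < p.1)%N]]|.

Definition has_degree (k : nat) a := forall S, #|S| != k -> a S = 0.

Definition form0 (c : K) : ext_form K n :=
  [ffun S : {set 'I_n} => if S == finset.set0 then c else 0].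

Definition dx (i : 'I_n) : ext_form K n :=
  [ffun S : {set 'I_n} => if S == finset.set1 i then 1 else 0].

Definition form_top (c : K) : ext_form K n :=
  [ffun S : {set 'I_n} => if S == finset.setT then c else 0].

Definition wedge a b : ext_form K n :=
  [ffun S : {set 'I_n} => \sum_(A in powerset S)
     shuffle_sign A (finset.setD S A) * a A * b (finset.setD S A)].

Definition int_prod v a : ext_form K n :=
  [ffun S : {set 'I_n} => \sum_(i | i \notin S)
     v 0 i * shuffle_sign (finset.set1 i) S * a (finset.setU (finset.set1 i) S)].

(* a(v_1, ..., v_k) for vs = [:: v_1; ...; v_k] and a of degree k. *)
Definition eval_form a (vs : seq 'rV[K]_n) : K :=
  foldl (fun b v => int_prod v b) a vs finset.set0.

End ExteriorAlgebra.

Arguments has_degree {K n}.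
Arguments shuffle_sign K {n}.
Arguments form0 {K n}.
Arguments dx {K n}.
Arguments form_top {K n}.

Definition pull_form (K : comNzRingType) m n (A : 'M[K]_(m, n)) (a : ext_form K n) :
    ext_form K m :=
  [ffun S : {set 'I_m} => eval_form a [seq row s A | s <- enum S]].

Section ComplexForms.
Variables (R : realType) (n : nat).

Definition Re_form (a : ext_form R[i] n) : ext_form R n := map_form (@complex.Re R) a.
Definition Im_form (a : ext_form R[i] n) : ext_form R n := map_form (@complex.Im R) a.
Definition conj_form (a : ext_form R[i] n) : ext_form R[i] n :=
  map_form (@conjc R) a.
Definition cplx_form (a : ext_form R n) : ext_form R[i] n :=
  map_form (fun x : R => x%:C) a.

End ComplexForms.

Section LocalCalculus.
Variables (R : realType) (n : nat).
Local Notation V := 'rV[R]_n.+1.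

Fixpoint iterD (W : normedModType R) (vs : seq W) (f : W -> R) {struct vs} :
    W -> R :=
  if vs is v :: vs' then fun x => 'D_v (@iterD W vs' f) x else f.

Definition smooth_on (W : normedModType R) (U : set W) (f : W -> R) :=
  forall vs x, U x -> differentiable (iterD vs f) x.

(* Smoothness on the (not necessarily open) set J x U, in the sense of local   *)
(* smooth extensions; for open J this is ordinary joint smoothness.            *)
Definition smooth_family_on (J : set R) (U : set V) (F : R -> V -> R) :=
  forall t x, J t -> U x ->
    exists (W : set (R^o * V)%type) (G : (R^o * V)%type -> R),
      [/\ open W, W (t, x), smooth_on W G &
          forall s y, J s -> U y -> W (s, y) -> G (s, y) = F s y].

Definition basis_vec (i : 'I_n.+1) : V := delta_mx 0 i.

Definition ext_d (F : V -> ext_form R n.+1) (x : V) : ext_form R n.+1 :=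
  \sum_(i < n.+1)
     wedge (dx i) [ffun S : {set 'I_n.+1} => 'D_(basis_vec i) (fun y => F y S : R^o) x].

Definition cext_d (F : V -> ext_form R[i] n.+1) (x : V) : ext_form R[i] n.+1 :=
  cplx_form (ext_d (fun y => Re_form (F y)) x) +
  'i *: cplx_form (ext_d (fun y => Im_form (F y)) x).

Definition fun_d (f : V -> R) : V -> ext_form R n.+1 :=
  ext_d (fun y => form0 (f y)).

(* Cartan's formula. *)
Definition lie_d (X : V -> V) (F : V -> ext_form R n.+1) (x : V) : ext_form R n.+1 :=
  ext_d (fun y => int_prod (X y) (F y)) x + int_prod (X x) (ext_d F x).

Definition clie_d (X : V -> V) (F : V -> ext_form R[i] n.+1) (x : V) :
    ext_form R[i] n.+1 :=
  cplx_form (lie_d X (fun y => Re_form (F y)) x) +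
  'i *: cplx_form (lie_d X (fun y => Im_form (F y)) x).

Definition vf_bracket (X Y : V -> V) (x : V) : V :=
  'D_(X x) Y x - 'D_(Y x) X x.

Definition bil (G : 'M[R]_n.+1) (v w : V) : R := (v *m G *m w^T) 0 0.

Definition posdef (G : 'M[R]_n.+1) :=
  G^T = G /\ forall v : V, v != 0 -> 0 < bil G v v.

Definition christoffel (G : V -> 'M[R]_n.+1) (x : V) (i j : 'I_n.+1) : V :=
  let pd k a b := 'D_(basis_vec k) (fun y => G y a b : R^o) x in
  \row_k (2^-1 * \sum_l invmx (G x) k l * (pd i j l + pd j i l - pd l i j)).

Definition levi_civita (G : V -> 'M[R]_n.+1) (X Y : V -> V) (x : V) : V :=
  'D_(X x) Y x +
  \sum_i \sum_j (X x 0 i * Y x 0 j) *: christoffel G x i j.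

Definition smooth_vf (U : set V) (X : V -> V) :=
  forall j, smooth_on U (fun y => X y 0 j).

Definition nijenhuis (I : V -> 'M[R]_n.+1) (X Y : V -> V) (x : V) : V :=
  let IX y := X y *m I y in
  let IY y := Y y *m I y in
  vf_bracket IX IY x - vf_bracket IX Y x *m I x - vf_bracket X IY x *m I x
  - vf_bracket X Y x.

(* The 2-form (v, w) |-> G(I v, w) of an almost Hermitian structure. *)
Definition fundamental_form (I G : V -> 'M[R]_n.+1) (x : V) : ext_form R n.+1 :=
  2^-1 *: \sum_i \sum_j
     bil (G x) (basis_vec i *m I x) (basis_vec j) *: wedge (dx i) (dx j).

Definition kahler_on (U : set V) (I G : V -> 'M[R]_n.+1) :=
  [/\ forall x, U x -> posdef (G x) /\ I x *m I x = - 1%:M,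
      forall x v w, U x -> bil (G x) (v *m I x) (w *m I x) = bil (G x) v w,
      forall X Y x, smooth_vf U X -> smooth_vf U Y -> U x ->
        nijenhuis I X Y x = 0
    & forall x, U x -> ext_d (fundamental_form I G) x = 0].

End LocalCalculus.

Record smooth_manifold (R : realType) (n : nat) := SmoothManifold {
  point_of : topologicalType;
  chart : Type;
  dom : chart -> set point_of;
  img : chart -> set 'rV[R]_n.+1;
  coord : chart -> point_of -> 'rV[R]_n.+1;
  param : chart -> 'rV[R]_n.+1 -> point_of;
  manifold_hausdorff : hausdorff_space point_of;
  manifold_second_countable : @second_countable point_of;
  manifold_cover : forall p, exists c, dom c p;
  open_dom : forall c, open (dom c);
  open_img : forall c, open (img c);
  coordP : forall c p, dom c p -> img c (coord c p) /\ param c (coord c p) = p;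
  paramP : forall c x, img c x -> dom c (param c x) /\ coord c (param c x) = x;
  coord_continuous : forall c p, dom c p -> {for p, continuous (coord c)};
  param_continuous : forall c x, img c x -> {for x, continuous (param c)};
  transition_smooth : forall c c' j,
    smooth_on (img c `&` param c @^-1` dom c')
              (fun x => coord c' (param c x) 0 j)
}.

Section Manifolds.
Variables (R : realType) (n : nat) (M : smooth_manifold R n).
Local Notation V := 'rV[R]_n.+1.

(* Tensors on M are given by their components in all charts, subject to the    *)
(* transformation law; only the values of (a c) on img c are meaningful.       *)
Definition chartwise (T : Type) := chart M -> V -> T.
Definition form_field := chartwise (ext_form R n.+1).
Definition cform_field := chartwise (ext_form R[i] n.+1).

Definition transition (c c' : chart M) (x : V) : V := coord c' (param c x).

Definition overlap (c c' : chart M) : set V :=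
  img c `&` param c @^-1` dom c'.

Definition jac (c c' : chart M) (x : V) : 'M[R]_n.+1 :=
  jacobian (transition c c') x.

Definition is_vector_field (X : chartwise V) :=
  (forall c, smooth_vf (img c) (X c)) /\
  forall c c' x, overlap c c' x ->
    X c' (transition c c' x) = X c x *m jac c c' x.

Definition is_endo_field (F : chartwise 'M[R]_n.+1) :=
  (forall c i j, smooth_on (img c) (fun y => F c y i j)) /\
  forall c c' x, overlap c c' x ->
    F c x *m jac c c' x = jac c c' x *m F c' (transition c c' x).

Definition is_metric (G : chartwise 'M[R]_n.+1) :=
  [/\ forall c i j, smooth_on (img c) (fun y => G c y i j),
      forall c c' x, overlap c c' x ->
        G c x = jac c c' x *m G c' (transition c c' x) *m (jac c c' x)^T
    & forall c x, img c x -> posdef (G c x)].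

Definition is_form (k : nat) (a : form_field) :=
  [/\ forall c x, img c x -> has_degree k (a c x),
      forall c S, smooth_on (img c) (fun y => a c y S)
    & forall c c' x, overlap c c' x ->
        a c x = pull_form (jac c c' x) (a c' (transition c c' x))].

Definition fun_field (f : point_of M -> R) : chartwise R :=
  fun c x => f (param c x).

Definition smooth_family (J : set R) (a : R -> form_field) :=
  forall c S, smooth_family_on J (img c) (fun t x => a t c x S).

Definition smooth_cfamily (J : set R) (a : R -> cform_field) :=
  smooth_family J (fun t c x => Re_form (a t c x)) /\
  smooth_family J (fun t c x => Im_form (a t c x)).

Definition quotient_dt (a : R -> form_field) (t : R) c x S (s : R) : R :=
  (a s c x S - a t c x S) / (s - t).

(* Time derivatives are taken within J, hence are one-sided at an end point    *)
(* of J.                                                                       *)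
Definition time_d (J : set R) (a : R -> form_field) (t : R) : form_field :=
  fun c x => [ffun S : {set 'I_n.+1} => lim (quotient_dt a t c x S @ within J t^')].

Definition has_dt (J : set R) (a : R -> form_field) (t : R) (b : form_field) :=
  forall c x, img c x -> forall S,
    quotient_dt a t c x S @ within J t^' --> b c x S.

Definition has_cdt (J : set R) (a : R -> cform_field) (t : R)
    (b : cform_field) :=
  has_dt J (fun s c x => Re_form (a s c x)) t (fun c x => Re_form (b c x)) /\
  has_dt J (fun s c x => Im_form (a s c x)) t (fun c x => Im_form (b c x)).

Section Transverse.
Variables (xi : chartwise V) (eta : form_field) (Phi g : chartwise 'M[R]_n.+1).

Definition basic_form (k : nat) (a : form_field) :=
  is_form k a /\
  forall c x, img c x ->
    int_prod (xi c x) (a c x) = 0 /\ lie_d (xi c) (a c) x = 0.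

Definition basic_cform (k : nat) (a : cform_field) :=
  basic_form k (fun c x => Re_form (a c x)) /\ basic_form k (fun c x => Im_form (a c x)).

Definition basic_fun (f : point_of M -> R) :=
  basic_form 0 (fun c x => form0 (fun_field f c x)).

Definition cPhi c x : 'M[R[i]]_n.+1 := map_mx (fun y : R => y%:C) (Phi c x).

Definition in_D c x (v : V) := eval_form (eta c x) [:: v] = 0.

Definition in_D10 c x (v : 'rV[R[i]]_n.+1) :=
  eval_form (cplx_form (eta c x)) [:: v] = 0 /\ v *m cPhi c x = 'i *: v.
Definition in_D01 c x (v : 'rV[R[i]]_n.+1) :=
  eval_form (cplx_form (eta c x)) [:: v] = 0 /\ v *m cPhi c x = - 'i *: v.

Definition has_type (p q : nat) (a : cform_field) :=
  forall c x, img c x ->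
    has_degree (p + q) (a c x) /\
    forall us vs : seq 'rV[R[i]]_n.+1,
      (forall u, u \in us -> in_D10 c x u) ->
      (forall v, v \in vs -> in_D01 c x v) ->
      (size us + size vs = p + q)%N -> size us <> p ->
      eval_form (a c x) (us ++ vs) = 0.

Definition part10 c x (a : ext_form R[i] n.+1) : ext_form R[i] n.+1 :=
  2^-1 *: (a - 'i *: pull_form (cPhi c x) a).
Definition part01 c x (a : ext_form R[i] n.+1) : ext_form R[i] n.+1 :=
  2^-1 *: (a + 'i *: pull_form (cPhi c x) a).

(* d^c f = (i/2) (dbar f - d' f), a real form, for a basic function f. *)
Definition dc_op (f : point_of M -> R) : form_field := fun c x =>
  let df := cplx_form (fun_d (fun_field f c) x) in
  Re_form (('i / 2) *: (part01 c x df - part10 c x df)).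

Definition transverse_kahler (w : form_field) :=
  [/\ basic_form 2 w,
      forall c x, img c x -> ext_d (w c) x = 0,
      has_type 1 1 (fun c x => cplx_form (w c x))
    & forall c x v, img c x -> in_D c x v -> v != 0 ->
        0 < eval_form (w c x) [:: v; v *m Phi c x]].

Definition transverse_volume (U : cform_field) :=
  [/\ basic_cform 3 U,
      forall c x, img c x -> cext_d (U c) x = 0,
      has_type 3 0 U
    & forall c x, img c x -> U c x != 0].

(* d eta(X, Y) = (X eta(Y) - Y eta(X) - eta([X, Y])) / 2, the normalization    *)
(* for which g = d eta o (1 (x) Phi) + eta (x) eta has a Kahler cone.          *)
Definition deta_pair c x (v w : V) : R :=
  2^-1 * eval_form (ext_d (eta c) x) [:: v; w].

Definition eta_at c x (v : V) : R := eval_form (eta c x) [:: v].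

(* The cone ]0, +oo[ x M has the charts ]0, +oo[ x img c, with points (r, y),  *)
(* the metric dr^2 + r^2 g and the almost complex structure                    *)
(* I(d/dr) = xi / r,  I(v) = Phi v - r eta(v) d/dr  for v tangent to M.        *)
Definition cone_r (z : 'rV[R]_n.+2) : R := z 0 0.
Definition cone_y (z : 'rV[R]_n.+2) : V := rsubmx (z : 'rV[R]_(1 + n.+1)).

Definition cone_img (c : chart M) : set 'rV[R]_n.+2 :=
  [set z | 0 < cone_r z /\ img c (cone_y z)].

Definition cone_metric c (z : 'rV[R]_n.+2) : 'M[R]_n.+2 :=
  block_mx (1%:M : 'M[R]_1) 0 0 (cone_r z ^+ 2 *: g c (cone_y z)).

Definition cone_I c (z : 'rV[R]_n.+2) : 'M[R]_n.+2 :=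
  let r := cone_r z in
  let y := cone_y z in
  block_mx (0 : 'M[R]_1) (r^-1 *: xi c y)
           (\col_i (- r * eta_at c y (basis_vec R i))) (Phi c y).

(* The connection induced by the Levi-Civita connection of g on the transverse *)
(* bundle TM / <xi> = D; D-valued, and depending on Y only through its         *)
(* horizontal part.                                                            *)
Definition horizontal c (X : V -> V) (x : V) : V :=
  X x - eta_at c x (X x) *: xi c x.

Definition transverse_nabla c (X Y : V -> V) (x : V) : V :=
  horizontal c (levi_civita (g c) (horizontal c X) (horizontal c Y)) x +
  eta_at c x (X x) *: horizontal c (vf_bracket (xi c) (horizontal c Y)) x.

Definition transverse_curvature c (X Y Z : V -> V) (x : V) : V :=
  transverse_nabla c X (transverse_nabla c Y Z) x
  - transverse_nabla c Y (transverse_nabla c X Z) x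
  - transverse_nabla c (vf_bracket X Y) Z x.

(* The Chern form (i / 2 pi) tr_C R^T of (D, Phi), with real trace 0 and       *)
(* tr_C F = (tr_R F - i tr_R (Phi F)) / 2.                                     *)
Definition chern_form : form_field := fun c x =>
  let rho i j := (4 * pi)^-1 * \sum_k
    (transverse_curvature c (cst (basis_vec R i)) (cst (basis_vec R j)) (cst (basis_vec R k)) x
       *m Phi c x) 0 k in
  2^-1 *: \sum_i \sum_j rho i j *: wedge (dx i) (dx j).

Definition c1_basic_zero :=
  exists a : form_field, basic_form 1 a /\
    forall c x, img c x -> chern_form c x = ext_d (a c) x.

End Transverse.

End Manifolds.

Section DimensionSeven.
Variable R : realType.
Local Notation V := 'rV[R]_7.
Local Notation form7 := (ext_form R 7).
Local Notation cform7 := (ext_form R[i] 7).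

Definition wedge3 (K : comNzRingType) n (w : ext_form K n) := wedge w (wedge w w).

(* |U|_w at a point, for values w and U of the two forms at that point. *)
Definition ups_norm (w : form7) (U : cform7) : R :=
  xget 0 [set s : R | 0 < s /\
    (3`!%:R)^-1 *: cplx_form (wedge3 w) =
    ('i / 8 * (s ^- 2)%:C) *: wedge U (conj_form U)].

(* (X _| phi) /\ (Y _| phi) /\ phi = 6 G(X, Y) vol, where                      *)
(* vol = m dx^1 /\ ... /\ dx^7 is a volume form of G (m < 0 if the chart does  *)
(* not have the orientation defined by phi).                                   *)
Definition g2_data (phi : form7) (G : 'M[R]_7) (m : R) :=
  [/\ posdef G, m ^+ 2 = \det G &
      forall X Y : V,
        wedge (int_prod X phi) (wedge (int_prod Y phi) phi) =
        form_top (6 * bil G X Y * m)].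

Definition g2_positive (phi : form7) :=
  has_degree 3 phi /\ exists G m, g2_data phi G m.

Definition g2_pair (phi : form7) : 'M[R]_7 * R :=
  xget (0, 0) [set Gm : 'M[R]_7 * R | g2_data phi Gm.1 Gm.2].
Definition g2_metric (phi : form7) : 'M[R]_7 := (g2_pair phi).1.
Definition g2_vol (phi : form7) : R := (g2_pair phi).2.

(* The solution of a /\ *b = <a, b> vol; <dx^A, b> is the value of b on the    *)
(* vectors dual to dx^{a_1}, ..., dx^{a_k}, the rows of G^-1.                  *)
Definition hodge (phi b : form7) : form7 :=
  [ffun S : {set 'I_7} => let A := finset.setC S in
     shuffle_sign R A S * g2_vol phi *
     eval_form b [seq row a (invmx (g2_metric phi)) | a <- enum A]].

Definition hodge_field (phi b : V -> form7) (x : V) : form7 :=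
  hodge (phi x) (b x).

Definition codiff (phi : V -> form7) (k : nat) (b : V -> form7) (x : V) : form7 :=
  (-1) ^+ (7 * k.+1 + 1) *:
    hodge_field phi (ext_d (hodge_field phi b)) x.

(* On forms of degree k. *)
Definition laplacian (phi : V -> form7) (k : nat) (b : V -> form7) (x : V) :
    form7 :=
  ext_d (codiff phi k b) x + codiff phi k.+1 (ext_d b) x.

Definition tau0 (phi : V -> form7) (x : V) : R :=
  7^-1 * hodge (phi x) (wedge (phi x) (ext_d phi x)) finset.set0.

Definition gradient (phi : V -> form7) (f : V -> R) (x : V) : V :=
  (\row_i fun_d f x (finset.set1 i)) *m invmx (g2_metric (phi x)).

Variable M : smooth_manifold R 6.

Definition sasakian (xi : chartwise M V) (eta : form_field M)
    (Phi g : chartwise M 'M[R]_7) :=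
  [/\ [/\ is_vector_field xi, is_form 1 eta, is_endo_field Phi & is_metric g],
      forall c x, img c x -> eta_at eta c x (xi c x) = 1,
      forall c x v, img c x ->
        v *m Phi c x *m Phi c x = - v + eta_at eta c x v *: xi c x,
      forall c x, img c x -> wedge (eta c x) (wedge3 (ext_d (eta c) x)) != 0
    & [/\ forall c x v w, img c x ->
            bil (g c x) (v *m Phi c x) (w *m Phi c x) =
            bil (g c x) v w - eta_at eta c x v * eta_at eta c x w,
          forall c x v w, img c x ->
            bil (g c x) v w =
            deta_pair eta c x v (w *m Phi c x) +
            eta_at eta c x v * eta_at eta c x w
        & forall c, kahler_on (cone_img c) (cone_I xi eta Phi c)
                              (cone_metric g c)]].

Definition contact_calabi_yau (xi : chartwise M V) (eta : form_field M)
    (Phi g : chartwise M 'M[R]_7) (Ups : cform_field M) :=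
  [/\ sasakian xi eta Phi g,
      c1_basic_zero xi eta Phi g
    & transverse_volume xi eta Phi Ups].

Definition su3_norm (w : form_field M) (U : cform_field M) : chartwise M R :=
  fun c x => ups_norm (w c x) (U c x).

Definition log_norm (w : form_field M) (U : cform_field M) : chartwise M R :=
  fun c x => ln (su3_norm w U c x).

Definition g2_form (eta w : form_field M) (U : cform_field M) : form_field M :=
  fun c x =>
    let h := su3_norm w U c x in
    Re_form ((h^-1)%:C *: U c x) + h *: wedge (eta c x) (w c x).

Definition grad_log_norm (phi w : form_field M) (U : cform_field M) :
    chartwise M V :=
  fun c => gradient (phi c) (log_norm w U c).

Definition modified_coflow (A : R) (J : set R) (phi : R -> form_field M) :=
  (forall t, J t ->
     is_form 3 (phi t) /\ forall c x, img c x -> g2_positive (phi t c x)) /\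
  let psi t c := hodge_field (phi t c) (phi t c) in
  forall t, J t ->
    has_dt J psi t (fun c x =>
      laplacian (phi t c) 4 (psi t c) x +
      ext_d (fun y => (A - 7 / 2 * tau0 (phi t c) y) *: phi t c y) x).

End DimensionSeven.

(* Main.v *)
Require Import Defs.
From HB Require Import structures.
From mathcomp Require Import all_boot all_order all_algebra.
From mathcomp Require Import complex.
From mathcomp Require Import all_classical all_reals all_analysis.
From mathcomp Require Import ring lra zify perm.

Set Implicit Arguments.
Unset Strict Implicit.
Unset Printing Implicit Defensive.

Import Order.TTheory GRing.Theory Num.Theory.
Import numFieldNormedType.Exports.

Local Open Scope classical_set_scope.
Local Open Scope ring_scope.
Local Open Scope complex_scope.

(** Fix a time t and write h for the norm of Ups_t, th = d log h, X for the
    gradient of log h, e for eta_t, w for the transverse Kaehler form and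
    re + i im for Ups_t.

    In a suitable frame at a given point (exists_adapted_frame) the data
    (e, w, re, im) are the standard ones of R x C^3 up to powers of h.  The
    identities of SU(3)- and G2-geometry thereby become finite computations with
    explicit forms: the metric of phi is euclidean in that frame,
    psi = w^2 / 2 - e /\ im and *psi = phi (frame_star_phi, frame_star_psi),
    tau0 = 6 h / 7 (frame_tau0), w^3 = 3 / (2 h^2) re /\ im (frame_w3), and
    *(d phi) = e /\ (X _| im) - (X _| w) /\ w + 2 h^2 e /\ w (frame_star_dphi).
    Since d e = w and w, re, im are closed, psi is closed, and the right-hand
    side of the coflow is d alpha with
    alpha = *(d phi) + (A - 3 h) phi.

    The two conditions of the theorem are then compared in each chart
    (chart_coflow_iff).  The point is that each of them forces th = 0.
    The derivative of im wedges with w to 0, because w_t /\ im_s = 0 for all s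
    and t by type.  Moreover (X _| w) /\ im = th /\ re and
    (X _| im) /\ w = - th /\ re, and th /\ re is closed.
    - Wedge the evolution of im with w: (L_X im) /\ w = d((X _| im) /\ w) = 0, so
      the equation for Im gamma leaves (A h - 2 h^2) th /\ w^2 = 0
      (lie_im_th_eq0).
    - Wedge the coflow with w and contract with xi: the left-hand side vanishes,
      and so does the contribution of d(X _| w), because its contraction with xi
      is a horizontal one-form annihilated by im.  What is left is again
      (A h - 2 h^2) th /\ w^2 = 0 (coflow_th_eq0).
    Wedging horizontal one-forms with w^2 is injective, so h is A / 2 near each
    point where th does not vanish; but then th vanishes there too (chart_th_eq0).

    With th = 0 the gradient is 0, and every term that involves it drops out.
    The coflow becomes
    beta /\ w - (d e / dt) /\ im - e /\ Im gamma = (A h - h^2) w^2,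
    and contraction with xi splits it into Im gamma = 0 and the transverse
    equation for beta, which are the two equations of the theorem. *)

Local Notation "a \w b" := (wedge a b) (at level 38, right associativity).
Local Notation evec i := (delta_mx 0 i).

(** * The wedge product and contraction *)

Section ShuffleSigns.
Local Close Scope classical_set_scope.
Local Open Scope set_scope.
Local Open Scope ring_scope.
Variables (K : numFieldType) (n : nat).
Implicit Types (A B C S : {set 'I_n}) (i j : 'I_n).
Local Notation sgn := (@shuffle_sign K n).

(** In product form the sign is visibly multiplicative over disjoint unions in either
    argument, which is what the algebra of the wedge product rests on. *)
Lemma shuffle_sign_prod A B :
  sgn A B = \prod_(i in A) \prod_(j in B) (if (j < i)%N then -1 else 1).
Proof.
rewrite /shuffle_sign -prodr_const pair_big_dep /= big_mkcond /=.
rewrite [RHS]big_mkcond /=; apply: eq_bigr => -[i j] _ /=.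
by rewrite inE /=; case: (i \in A); case: (j \in B); case: (j < i)%N.
Qed.

Lemma prod_setU A B (F : 'I_n -> K) : [disjoint A & B] ->
  \prod_(i in A :|: B) F i = (\prod_(i in A) F i) * (\prod_(i in B) F i).
Proof.
by move=> dAB; rewrite -bigU //=; apply: eq_bigl => i; rewrite !inE.
Qed.

Lemma shuffle_signUl A B C : [disjoint A & B] ->
  sgn (A :|: B) C = sgn A C * sgn B C.
Proof. by move=> dAB; rewrite !shuffle_sign_prod prod_setU. Qed.

Lemma shuffle_signUr A B C : [disjoint B & C] ->
  sgn A (B :|: C) = sgn A B * sgn A C.
Proof.
move=> dBC; rewrite !shuffle_sign_prod -big_split /=.
by apply: eq_bigr => i _; rewrite prod_setU.
Qed.

Lemma shuffle_sign0l A : sgn finset.set0 A = 1.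
Proof. by rewrite shuffle_sign_prod big_set0. Qed.

Lemma shuffle_sign0r A : sgn A finset.set0 = 1.
Proof. by rewrite shuffle_sign_prod big1 // => i _; rewrite big_set0. Qed.

Lemma shuffle_sign_sqr A B : sgn A B * sgn A B = 1.
Proof. by rewrite /shuffle_sign -exprD addnn -muln2 mulnC exprM sqrrN !expr1n. Qed.

(** Moving i past A costs one sign for each element of A. *)
Lemma shuffle_sign1C i A : i \notin A ->
  sgn A (finset.set1 i) * sgn (finset.set1 i) A = (-1) ^+ #|A|.
Proof.
move=> iA; rewrite !shuffle_sign_prod big_set1 -prodr_const -big_split /=.
apply: eq_bigr => j jA; rewrite big_set1.
have : j != i by apply: contraNneq iA => <-.
by rewrite neq_ltn; case/orP => ltij; rewrite ltij ltnNge (ltnW ltij) /= ?mulr1 ?mul1r.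
Qed.

Lemma big_powersetU1 (W : nmodType) i S (F : {set 'I_n} -> W) : i \notin S ->
  \sum_(A in powerset (i |: S)) F A =
  \sum_(A in powerset S) (F A + F (i |: A)).
Proof.
move=> iS; rewrite (bigID (fun A : {set 'I_n} => i \in A)) /= addrC.
rewrite big_split /=; congr (_ + _).
  apply: eq_bigl => A; rewrite !inE; apply/andP/idP => [[sA iA]|sA].
    apply/fintype.subsetP => j jA; have := fintype.subsetP sA j jA; rewrite !inE => /orP[/eqP ji|//].
    by rewrite -ji jA in iA.
  split; first exact: (fintype.subset_trans sA (finset.subsetUr _ _)).
  by apply: contra iS; apply: fintype.subsetP.
rewrite (reindex_onto (fun A => i |: A) (fun A => A :\ i)) /=; last first.
  by move=> A /andP[_ iA]; rewrite finset.setD1K.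
apply: eq_bigl => A; rewrite !inE eqxx /=.
apply/andP/idP => [[/andP[sA _] /eqP eA]|sA].
  apply/fintype.subsetP => j jA; have := fintype.subsetP sA j; rewrite !inE jA orbT => /(_ isT).
  by case/orP => // /eqP ji; move: jA; rewrite -eA ji !inE eqxx.
have iA : i \notin A by apply: contra iS; apply: fintype.subsetP.
by rewrite finset.setU1K // andbT; split=> //; apply: finset.setUS.
Qed.

End ShuffleSigns.

Section WedgeLinear.
Local Close Scope classical_set_scope.
Local Open Scope set_scope.
Local Open Scope ring_scope.
Variables (K : numFieldType) (n : nat).
Implicit Types (a b c : ext_form K n) (k : K) (S : {set 'I_n}) (v : 'rV[K]_n).

Lemma scale_formE k a S : (k *: a) S = k * a S.
Proof. by rewrite ffunE. Qed.

Lemma add_formE a b S : (a + b) S = a S + b S.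
Proof. by rewrite ffunE. Qed.

Lemma opp_formE a S : (- a) S = - a S.
Proof. by rewrite ffunE. Qed.

Lemma zero_formE S : (0 : ext_form K n) S = 0.
Proof. by rewrite ffunE. Qed.

Definition formE := (scale_formE, add_formE, opp_formE, zero_formE).

Lemma sum_form_E (I : Type) (r : seq I) (P : pred I) (F : I -> ext_form K n) S :
  (\sum_(i <- r | P i) F i) S = \sum_(i <- r | P i) F i S.
Proof. by rewrite sum_ffunE. Qed.

Lemma wedgeE a b S : (a \w b) S =
  \sum_(A in powerset S) shuffle_sign K A (S :\: A) * a A * b (S :\: A).
Proof. by rewrite ffunE. Qed.

Lemma int_prodE v a S : int_prod v a S =
  \sum_(i | i \notin S) v 0 i * shuffle_sign K (finset.set1 i) S * a (i |: S).
Proof. by rewrite ffunE. Qed.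

Lemma wedge_is_linear a : linear (wedge a).
Proof.
move=> k b c; apply/ffunP => S; rewrite add_formE scale_formE !wedgeE.
rewrite mulr_sumr -big_split /=.
apply: eq_bigr => A _; rewrite add_formE scale_formE; ring.
Qed.
HB.instance Definition _ a :=
  GRing.isLinear.Build K (ext_form K n) (ext_form K n) *:%R (wedge a)
    (wedge_is_linear a).

Definition wedger b a := wedge a b.
Lemma wedger_is_linear b : linear (wedger b).
Proof.
move=> k a c; apply/ffunP => S; rewrite add_formE scale_formE !wedgeE.
rewrite mulr_sumr -big_split /=.
apply: eq_bigr => A _; rewrite add_formE scale_formE; ring.
Qed.
HB.instance Definition _ b :=
  GRing.isLinear.Build K (ext_form K n) (ext_form K n) *:%R (wedger b)
    (wedger_is_linear b).

Lemma wedgeDl a b c : (a + b) \w c = a \w c + b \w c.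
Proof. exact: (linearD (wedger c)). Qed.
Lemma wedgeDr a b c : a \w (b + c) = a \w b + a \w c.
Proof. exact: linearD. Qed.
Lemma wedgeNl a c : (- a) \w c = - (a \w c).
Proof. exact: (linearN (wedger c)). Qed.
Lemma wedgeNr a b : a \w (- b) = - (a \w b).
Proof. exact: linearN. Qed.
Lemma wedgeBl a b c : (a - b) \w c = a \w c - b \w c.
Proof. exact: (linearB (wedger c)). Qed.
Lemma wedgeBr a b c : a \w (b - c) = a \w b - a \w c.
Proof. exact: linearB. Qed.
Lemma wedgeZl k a c : (k *: a) \w c = k *: (a \w c).
Proof. exact: (linearZ_LR (wedger c)). Qed.
Lemma wedgeZr k a b : a \w (k *: b) = k *: (a \w b).
Proof. exact: linearZ. Qed.
Lemma wedge0l c : (0 : ext_form K n) \w c = 0.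
Proof. exact: (linear0 (wedger c)). Qed.
Lemma wedge0r a : a \w 0 = 0.
Proof. exact: linear0. Qed.
Lemma wedge_suml (I : Type) (r : seq I) (P : pred I) (F : I -> ext_form K n) c :
  (\sum_(i <- r | P i) F i) \w c = \sum_(i <- r | P i) F i \w c.
Proof. exact: (linear_sum (wedger c)). Qed.
Lemma wedge_sumr (I : Type) (r : seq I) (P : pred I) (F : I -> ext_form K n) a :
  a \w (\sum_(i <- r | P i) F i) = \sum_(i <- r | P i) a \w F i.
Proof. exact: linear_sum. Qed.

Lemma int_prod_is_linear v : linear (int_prod v).
Proof.
move=> k b c; apply/ffunP => S; rewrite add_formE scale_formE !int_prodE.
rewrite mulr_sumr -big_split /=.
apply: eq_bigr => A _; rewrite add_formE scale_formE; ring.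
Qed.
HB.instance Definition _ v :=
  GRing.isLinear.Build K (ext_form K n) (ext_form K n) *:%R (int_prod v)
    (int_prod_is_linear v).

Definition int_prodr a v := int_prod v a.
Lemma int_prodr_is_linear a : linear (int_prodr a).
Proof.
move=> k v w; apply/ffunP => S; rewrite add_formE scale_formE !int_prodE.
rewrite mulr_sumr -big_split /=.
apply: eq_bigr => A _; rewrite !mxE; ring.
Qed.
HB.instance Definition _ a :=
  GRing.isLinear.Build K 'rV[K]_n (ext_form K n) *:%R (int_prodr a)
    (int_prodr_is_linear a).

Lemma int_prodDl v w a : int_prod (v + w) a = int_prod v a + int_prod w a.
Proof. exact: (linearD (int_prodr a)). Qed.
Lemma int_prodZl k v a : int_prod (k *: v) a = k *: int_prod v a.
Proof. exact: (linearZ_LR (int_prodr a)). Qed.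
Lemma int_prod0l a : int_prod 0 a = 0.
Proof. exact: (linear0 (int_prodr a)). Qed.

Lemma int_prod_basis v a :
  int_prod v a = \sum_i v 0 i *: int_prod (evec i) a.
Proof.
rewrite -[LHS]/(int_prodr a v) {1}[v]row_sum_delta linear_sum /=.
by apply: eq_bigr => i _; rewrite /int_prodr int_prodZl.
Qed.

Lemma int_prod_evecE i a S : int_prod (evec i) a S =
  if i \in S then 0 else shuffle_sign K (finset.set1 i) S * a (i |: S).
Proof.
rewrite ffunE; case: ifPn => iS.
  rewrite big1 // => j jS; rewrite mxE eqxx /=.
  have /negPf -> : j != i by apply: contraNneq jS => ->.
  by rewrite !mul0r.
rewrite (bigD1 i) //= mxE !eqxx mul1r big1 ?addr0 // => j /andP[_ /negPf ji].
by rewrite mxE ji andbF !mul0r.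
Qed.

(** A form is known once its degree 0 coefficient and all its contractions with
    basis vectors are known; identities of forms are therefore proved by
    induction on the size of the index set, contracting both sides. *)
Lemma form_coef_int_prod i a S : i \in S ->
  a S = shuffle_sign K (finset.set1 i) (S :\ i) * int_prod (evec i) a (S :\ i).
Proof.
move=> iS; rewrite int_prod_evecE setD11 finset.setD1K //.
by rewrite mulrA shuffle_sign_sqr mul1r.
Qed.

Lemma form_contract_ind (P : {set 'I_n} -> Prop) :
    P finset.set0 -> (forall i S, i \in S -> P (S :\ i) -> P S) ->
  forall S, P S.
Proof.
move=> P0 PS S; elim: {S}#|S| {-2}S (leqnn #|S|) => [|m IHm] S.
  by rewrite leqn0 cards_eq0 => /eqP ->.
move=> leSm; have [->//|[i iS]] := set_0Vmem S.
by apply: (PS i) => //; apply: IHm; move: leSm; rewrite (cardsD1 i S) iS.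
Qed.

End WedgeLinear.

Section WedgeAlgebra.
Local Close Scope classical_set_scope.
Local Open Scope set_scope.
Local Open Scope ring_scope.
Variables (K : numFieldType) (n : nat).
Implicit Types (a b c : ext_form K n) (k : K) (S : {set 'I_n}) (v : 'rV[K]_n).
Local Notation sgn := (@shuffle_sign K n).

(** The parity involution; it carries the signs of the Leibniz rules without
    any assumption on degrees. *)
Definition parity a : ext_form K n := [ffun S : {set 'I_n} => (-1) ^+ #|S| * a S].

Lemma parityE a S : parity a S = (-1) ^+ #|S| * a S.
Proof. by rewrite ffunE. Qed.

Lemma parity_is_linear : linear parity.
Proof.
move=> k b c; apply/ffunP => S; rewrite add_formE scale_formE !parityE.
by rewrite add_formE scale_formE; ring.
Qed.
HB.instance Definition _ :=
  GRing.isLinear.Build K (ext_form K n) (ext_form K n) *:%R parity parity_is_linear.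

Lemma parity_degree m a : has_degree m a -> parity a = (-1) ^+ m *: a.
Proof.
move=> da; apply/ffunP => S; rewrite ffunE scale_formE.
by have [->//|nS] := eqVneq #|S| m; rewrite da // !mulr0.
Qed.

Lemma parity_wedge a b : parity (a \w b) = parity a \w parity b.
Proof.
apply/ffunP => S; rewrite !ffunE mulr_sumr; apply: eq_bigr => A.
rewrite inE => sAS; rewrite !ffunE.
have -> : #|S| = (#|A| + #|S :\: A|)%N.
  by rewrite -(cardsID A S) (finset.setIidPr sAS).
rewrite exprD; ring.
Qed.

Lemma int_prod_parity v a : int_prod v (parity a) = - parity (int_prod v a).
Proof.
apply/ffunP => S; rewrite opp_formE !ffunE mulr_sumr -sumrN; apply: eq_bigr => i iS.
rewrite !ffunE cardsU1 iS exprS; ring.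
Qed.

(** The Leibniz rule. With form_contract_ind it yields associativity, graded
    commutativity and naturality of the wedge product by induction. *)
Lemma int_prod_wedge v a b :
  int_prod v (a \w b) = int_prod v a \w b + parity a \w int_prod v b.
Proof.
rewrite int_prod_basis [int_prod v a]int_prod_basis [int_prod v b]int_prod_basis.
rewrite wedge_suml wedge_sumr -big_split /=; apply: eq_bigr => i _.
rewrite wedgeZl wedgeZr -scalerDr; congr (_ *: _).
apply/ffunP => S; rewrite int_prod_evecE add_formE !wedgeE -big_split /=.
have [iS|iS] := ifPn.
  have defS : S = i |: (S :\ i) by rewrite finset.setD1K.
  have iS' : i \notin S :\ i by rewrite setD11.
  rewrite {1}defS big_powersetU1 // big1 // => A; rewrite inE => sAS.
  have iA : i \notin A by apply: contra iS' => /(fintype.subsetP sAS).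
  rewrite !int_prod_evecE !ffunE.
  have iSA : i \in S :\: A by rewrite !inE iA.
  have iSA' : (i \in S :\: (i |: A)) = false by rewrite !inE eqxx.
  have iiA : i \in i |: A by rewrite !inE eqxx.
  rewrite (negPf iA) iSA iSA' iiA !(mulr0, mul0r, addr0, add0r).
  have eSA : S :\: A = i |: (S :\: (i |: A)).
    apply/finset.setP => j; rewrite !inE.
    by case: eqP => [->|]; rewrite ?iA ?iS ?andbF.
  have d1 : [disjoint [set i]%SET & A] by rewrite disjoints1.
  have d2 : [disjoint [set i]%SET & S :\: (i |: A)] by rewrite disjoints1 iSA'.
  rewrite cardsU1 iA exprS -(shuffle_sign1C K iA) -eSA.
  set B := S :\: (i |: A) in eSA d2 *.
  rewrite [X in sgn A X]eSA (shuffle_signUr K _ d2) (shuffle_signUl K _ d1).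
  have sq := shuffle_sign_sqr K [set i]%SET B.
  transitivity (sgn A [set i]%SET * sgn A B * sgn [set i]%SET A * a (i |: A) *
     b (S :\: A) * (1 - sgn [set i]%SET B * sgn [set i]%SET B)); first ring.
  by rewrite sq subrr mulr0.
rewrite big_powersetU1 // mulr_sumr; apply: eq_bigr => A; rewrite inE => sAS.
have iA : i \notin A by apply: contra iS => /(fintype.subsetP sAS).
rewrite !int_prod_evecE !ffunE (negPf iA).
have -> : (i \in S :\: A) = false by rewrite !inE (negPf iS) andbF.
have eSA : (i |: S) :\: A = i |: (S :\: A).
  apply/finset.setP => j; rewrite !inE.
  by case: eqP => [->|]; rewrite ?iA ?(negPf iS).
have eSA' : (i |: S) :\: (i |: A) = S :\: A.
  apply/finset.setP => j; rewrite !inE.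
  by case: eqP => [->|] //=; rewrite ?(negPf iS) ?andbF.
rewrite eSA eSA'; have d1 : [disjoint [set i]%SET & A] by rewrite disjoints1.
have d2 : [disjoint [set i]%SET & S :\: A].
  by rewrite disjoints1 !inE (negPf iS) andbF.
rewrite (shuffle_signUl K _ d1) (shuffle_signUr K _ d2) -(shuffle_sign1C K iA).
have eS : S = A :|: (S :\: A).
  by rewrite -{1}(finset.setID S A) (finset.setIidPr sAS).
have d3 : [disjoint A & S :\: A].
  by rewrite finset.disjoints_subset; apply/fintype.subsetP => j jA; rewrite !inE jA.
rewrite [X in sgn [set i]%SET X * _]eS (shuffle_signUr K _ d3).
have sq := shuffle_sign_sqr K [set i]%SET (S :\: A).
set B := S :\: A in sq *.
set s1 := sgn [set i]%SET B in sq *; set s2 := sgn A [set i]%SET.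
set s3 := sgn [set i]%SET A; set s4 := sgn A B.
transitivity (s3 * s2 * s4 * a A * b (i |: B) * s1 + s3 * s4 * a (i |: A) * b B * (s1 * s1)).
  ring.
rewrite sq; ring.
Qed.

Lemma wedge_coef0 a b : (a \w b) finset.set0 = a finset.set0 * b finset.set0.
Proof.
rewrite ffunE powerset0 big_set1 finset.setD0 shuffle_sign0l; ring.
Qed.

Lemma form_eq_contract (a b : ext_form K n) : a finset.set0 = b finset.set0 ->
  (forall i, int_prod (evec i) a = int_prod (evec i) b) -> a = b.
Proof.
move=> ab0 abi; apply/ffunP => S; have [->//|[i iS]] := set_0Vmem S.
by rewrite !(form_coef_int_prod _ iS) abi.
Qed.

Lemma wedgeA a b c : (a \w b) \w c = a \w b \w c.
Proof.
apply/ffunP => S; move: S a b c.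
apply: form_contract_ind => [|i S iS IH] a b c.
  by rewrite !wedge_coef0 mulrA.
rewrite !(form_coef_int_prod _ iS); congr (_ * _).
rewrite !int_prod_wedge wedgeDl wedgeDr parity_wedge !add_formE !IH; ring.
Qed.

Lemma int_prod_anticomm v u a :
  int_prod v (int_prod u a) = - int_prod u (int_prod v a).
Proof.
rewrite int_prod_basis [int_prod v a]int_prod_basis linear_sum.
rewrite -sumrN; apply: eq_bigr => i _; rewrite linearZ /= -scalerN; congr (_ *: _).
rewrite (int_prod_basis u a) (int_prod_basis u (int_prod _ a)) linear_sum.
rewrite -sumrN; apply: eq_bigr => j _; rewrite linearZ /= -scalerN; congr (_ *: _).
apply/ffunP => S; rewrite opp_formE !int_prod_evecE !inE.
have [-> //=|ij] := eqVneq i j.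
  by case: (j \in S); rewrite ?mulr0 ?oppr0.
case iS : (i \in S); case jS : (j \in S);
  rewrite ?orbT ?orbF ?mulr0 ?oppr0 ?eqxx //=.
have d1 : [disjoint [set i]%SET & S] by rewrite disjoints1 iS.
have d2 : [disjoint [set j]%SET & S] by rewrite disjoints1 jS.
rewrite !(shuffle_signUr K _ d1) !(shuffle_signUr K _ d2).
have ji : i \notin [set j]%SET by rewrite inE.
have := shuffle_sign1C K ji; rewrite cards1 expr1.
rewrite finset.setUCA.
set x := sgn _ _; set y := sgn [set i]%SET [set j]%SET => xy.
have yy : y * y = 1 by exact: shuffle_sign_sqr.
have -> : x = - y by rewrite -[x]mulr1 -yy mulrA xy mulN1r.
ring.
Qed.

End WedgeAlgebra.

(** * Degrees and monomials *)

Section FormDegrees.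
Local Close Scope classical_set_scope.
Local Open Scope set_scope.
Local Open Scope ring_scope.
Variables (K : numFieldType) (n : nat).
Implicit Types (a b c : ext_form K n) (k : K) (S : {set 'I_n}) (v : 'rV[K]_n).

Lemma form0E k S : form0 k S = if S == finset.set0 then k else 0 :> K.
Proof. by rewrite ffunE. Qed.

Lemma dxE i S : dx i S = if S == [set i] then 1 else 0 :> K.
Proof. by rewrite ffunE. Qed.

Lemma wedge_form0l k a : form0 k \w a = k *: a.
Proof.
apply/ffunP => S; rewrite scale_formE wedgeE (bigD1 finset.set0) ?inE ?finset.sub0set //=.
rewrite form0E eqxx shuffle_sign0l mul1r finset.setD0 big1 ?addr0 //.
by move=> A /andP[_ /negPf A0]; rewrite form0E A0 mulr0 mul0r.
Qed.

Lemma wedge_form0r k a : a \w form0 k = k *: a.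
Proof.
apply/ffunP => S; rewrite scale_formE wedgeE (bigD1 S) ?inE ?fintype.subxx //=.
rewrite form0E finset.setDv eqxx shuffle_sign0r mul1r mulrC big1 ?addr0 //.
move=> A /andP[]; rewrite inE => sAS nAS; rewrite form0E finset.setD_eq0.
case: ifP; rewrite ?mulr0 // => sSA; case/negP: nAS.
by rewrite finset.eqEsubset sAS sSA.
Qed.

Lemma form0_is_zmod : zmod_morphism (@form0 K n).
Proof.
move=> k l; apply/ffunP => S; rewrite add_formE opp_formE !form0E.
by case: ifP => // _; rewrite subr0.
Qed.
HB.instance Definition _ :=
  GRing.isZmodMorphism.Build K (ext_form K n) (@form0 K n) form0_is_zmod.

Lemma scale_form0 k l : k *: form0 l = form0 (k * l) :> ext_form K n.
Proof.
by apply/ffunP => S; rewrite scale_formE !form0E; case: ifP; rewrite ?mulr0.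
Qed.

Lemma int_prod_form0 v k : int_prod v (form0 k) = 0.
Proof.
apply/ffunP => S; rewrite zero_formE int_prodE big1 // => i iS.
have /negPf : i |: S != finset.set0 by apply/finset.set0Pn; exists i; rewrite !inE eqxx.
by rewrite form0E => ->; rewrite mulr0.
Qed.

Lemma int_prod_dx v i : int_prod v (dx i) = form0 (v 0 i).
Proof.
apply/ffunP => S; rewrite form0E int_prodE.
have [->|S0] := eqVneq S finset.set0.
  rewrite (bigD1 i) ?inE //= dxE finset.setU0 eqxx shuffle_sign0r !mulr1.
  rewrite big1 ?addr0 // => j /andP[_ ji]; rewrite dxE finset.setU0.
  by rewrite (inj_eq set1_inj) (negPf ji) mulr0.
rewrite big1 // => j jS; rewrite dxE; case: eqP => [eji|_]; last by rewrite mulr0.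
case/negP: S0; rewrite -finset.subset0; apply/fintype.subsetP => l lS.
have : l \in [set i] by rewrite -eji !inE lS orbT.
have : j \in [set i] by rewrite -eji !inE eqxx.
by rewrite !inE => /eqP <- /eqP ejl; rewrite -ejl lS in jS.
Qed.

Lemma has_degree_form0 k : has_degree 0 (form0 k : ext_form K n).
Proof. by move=> S S0; rewrite form0E -cards_eq0 (negPf S0). Qed.

Lemma has_degree_dx i : has_degree 1 (dx i : ext_form K n).
Proof. by move=> S S1; rewrite dxE; case: eqP => // eS; rewrite eS cards1 in S1. Qed.

Lemma has_degree0 m : has_degree m (0 : ext_form K n).
Proof. by move=> S _; rewrite zero_formE. Qed.

Lemma has_degreeD m a b : has_degree m a -> has_degree m b -> has_degree m (a + b).
Proof. by move=> da db S mS; rewrite add_formE da // db // addr0. Qed.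

Lemma has_degreeZ m k a : has_degree m a -> has_degree m (k *: a).
Proof. by move=> da S mS; rewrite scale_formE da // mulr0. Qed.

Lemma has_degreeN m a : has_degree m a -> has_degree m (- a).
Proof. by move=> da S mS; rewrite opp_formE da // oppr0. Qed.

Lemma has_degree_sum m (I : Type) (r : seq I) (P : pred I) (F : I -> ext_form K n) :
  (forall i, P i -> has_degree m (F i)) -> has_degree m (\sum_(i <- r | P i) F i).
Proof.
by move=> dF; elim/big_rec: _ => [|i b Pi]; [exact: has_degree0|apply: has_degreeD (dF _ Pi)].
Qed.

Lemma has_degree_wedge m l a b :
  has_degree m a -> has_degree l b -> has_degree (m + l) (a \w b).
Proof.
move=> da db S mS; rewrite wedgeE big1 // => A; rewrite inE => sAS.
have [Am|nA] := eqVneq #|A| m; last by rewrite da // mulr0 mul0r.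
rewrite (db (S :\: A)) ?mulr0 //; apply: contraNneq mS => <-.
by rewrite -Am -(cardsID A S) (finset.setIidPr sAS).
Qed.

Lemma has_degree_int_prod m v a : has_degree m.+1 a -> has_degree m (int_prod v a).
Proof.
move=> da S mS; rewrite int_prodE big1 // => i iS.
by rewrite da ?mulr0 // cardsU1 iS.
Qed.

Lemma int_prod_degree0 v a : has_degree 0 a -> int_prod v a = 0.
Proof.
move=> da; apply/ffunP => S; rewrite int_prodE zero_formE big1 // => i iS.
by rewrite da ?mulr0 // cardsU1 iS.
Qed.

Lemma has_degree_top a : has_degree n a -> a = form_top (a finset.setT).
Proof.
move=> da; apply/ffunP => S; rewrite ffunE; case: eqP => [->//|/eqP nS].
apply: da; apply: contra nS => /eqP cS.
by rewrite finset.eqEcard finset.subsetT cardsT card_ord cS leqnn.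
Qed.

Lemma form_topE k S : form_top k S = if S == finset.setT then k else 0 :> K.
Proof. by rewrite ffunE. Qed.

Lemma has_degree_form_top k : has_degree n (form_top k : ext_form K n).
Proof.
by move=> S nS; rewrite form_topE; case: eqP => // eS; rewrite eS cardsT card_ord eqxx in nS.
Qed.

Lemma scale_form_top k l : k *: form_top l = form_top (k * l) :> ext_form K n.
Proof.
by apply/ffunP => S; rewrite scale_formE !form_topE; case: ifP; rewrite ?mulr0.
Qed.

Lemma int_prod_sqr v a : int_prod v (int_prod v a) = 0.
Proof.
set x := int_prod _ _; have x_opp : x = - x by exact: int_prod_anticomm.
have : 2 *: x = 0 by rewrite scaler_nat mulr2n {1}x_opp addNr.
by move/eqP; rewrite scaler_eq0 pnatr_eq0 /= => /eqP.
Qed.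

Lemma signr_double m : (-1) ^+ m.*2 = 1 :> K.
Proof. by rewrite -mul2n exprM sqrrN !expr1n. Qed.

Lemma wedgeC m l a b : has_degree m a -> has_degree l b ->
  a \w b = (-1) ^+ (m * l) *: (b \w a).
Proof.
move=> da db; apply/ffunP => S; move: S m l a b da db.
apply: form_contract_ind => [|i S iS IH] m l a b da db; rewrite scale_formE.
  rewrite !wedge_coef0; case: m da => [|m] da; first by rewrite mul1r mulrC.
  by rewrite da ?cards0 // !(mul0r, mulr0).
rewrite !(form_coef_int_prod _ iS) !int_prod_wedge (parity_degree da) (parity_degree db).
rewrite !wedgeZl !add_formE !scale_formE mulrCA; congr (_ * _).
have -> : (int_prod (evec i) a \w b) (S :\ i) =
    (-1) ^+ (m * l + l) * (b \w int_prod (evec i) a) (S :\ i).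
  case: m da => [|m] da; first by rewrite int_prod_degree0 // wedge0l wedge0r zero_formE mulr0.
  rewrite (IH _ _ _ _ (has_degree_int_prod (evec i) da) db) scale_formE mulSn.
  by rewrite addnAC addnn exprD signr_double mul1r.
have -> : (a \w int_prod (evec i) b) (S :\ i) =
    (-1) ^+ (m * l + m) * (int_prod (evec i) b \w a) (S :\ i).
  case: l db => [|l] db; first by rewrite int_prod_degree0 // wedge0l wedge0r zero_formE mulr0.
  rewrite (IH _ _ _ _ da (has_degree_int_prod (evec i) db)) scale_formE mulnS.
  by rewrite addnAC addnn exprD signr_double mul1r.
have mm : (-1) ^+ m * (-1) ^+ m = 1 :> K by rewrite -exprD addnn signr_double.
rewrite !exprD; move: mm; set x := (-1) ^+ m; set y := (-1) ^+ l; set z := (-1) ^+ (m * l) => mm.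
transitivity (z * y * (b \w int_prod (evec i) a) (S :\ i) +
  x * x * z * (int_prod (evec i) b \w a) (S :\ i)); first ring.
rewrite mm; ring.
Qed.

End FormDegrees.

Section Monomials.
Local Close Scope classical_set_scope.
Local Open Scope set_scope.
Local Open Scope ring_scope.
Variables (K : numFieldType) (n : nat).
Implicit Types (a b c : ext_form K n) (k : K) (S : {set 'I_n}) (v : 'rV[K]_n).

Definition monomial S : ext_form K n :=
  [ffun T : {set 'I_n} => if T == S then 1 else 0].

Lemma monomialE S T : monomial S T = if T == S then 1 else 0.
Proof. by rewrite ffunE. Qed.

Lemma form_monomial a : a = \sum_S a S *: monomial S.
Proof.
apply/ffunP => T; rewrite sum_form_E (bigD1 T) //= scale_formE monomialE eqxx mulr1.
rewrite big1 ?addr0 // => S ST; rewrite scale_formE monomialE eq_sym (negPf ST).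
by rewrite mulr0.
Qed.

Lemma wedge_monomial A B : monomial A \w monomial B =
  if [disjoint A & B] then shuffle_sign K A B *: monomial (A :|: B) else 0.
Proof.
apply/ffunP => S; rewrite wedgeE.
have [sAS|nAS] := boolP (A \subset S); last first.
  rewrite big1 => [|T]; last first.
    rewrite inE => sTS; rewrite monomialE; case: eqP => [eTA|_]; last by rewrite mulr0 mul0r.
    by rewrite -eTA sTS in nAS.
  case: ifP => _; rewrite ?zero_formE // scale_formE monomialE; case: eqP => [eS|_].
    by rewrite eS finset.subsetUl in nAS.
  by rewrite mulr0.
rewrite (bigD1 A) ?inE //= monomialE eqxx mulr1 big1 ?addr0 => [|T /andP[_ /negPf TA]]; last first.
  by rewrite monomialE TA mulr0 mul0r.
case: ifP => dAB; rewrite monomialE.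
  rewrite scale_formE monomialE; have -> : (S :\: A == B) = (S == A :|: B).
    apply/eqP/eqP => [<-|->].
      by rewrite -{1}(finset.setID S A) (finset.setIidPr sAS).
    by rewrite finset.setDUl finset.setDv finset.set0U; apply/finset.setDidPl; rewrite disjoint_sym.
  by case: eqP => [->|_]; rewrite ?mulr0 // finset.setDUl finset.setDv finset.set0U;
    rewrite (finset.setDidPl _) // disjoint_sym.
rewrite zero_formE; case: eqP => [eB|_]; last by rewrite mulr0.
by rewrite -eB finset.disjoints_subset finset.setCD finset.subsetUr in dAB.
Qed.

Lemma monomial0 : monomial finset.set0 = form0 1.
Proof. by apply/ffunP => S; rewrite !ffunE. Qed.

Lemma monomial1 i : monomial [set i] = dx i.
Proof. by apply/ffunP => S; rewrite !ffunE. Qed.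

Lemma monomialT : monomial finset.setT = form_top 1.
Proof. by apply/ffunP => S; rewrite !ffunE. Qed.

(** The exterior algebra is generated by the coordinate one-forms. *)
Lemma form_gen_ind (P : ext_form K n -> Prop) :
    (forall k a b, P a -> P b -> P (k *: a + b)) -> P (form0 1) ->
    (forall i a, P a -> P (dx i \w a)) -> forall a, P a.
Proof.
move=> Plin P1 Pdx; have P0 : P 0.
  by rewrite -(addNr (form0 1)) -scaleN1r; apply: Plin.
have Pm : forall S, P (monomial S).
  apply: form_contract_ind => [|i S iS PS]; first by rewrite monomial0.
  have := Pdx i _ PS; rewrite -monomial1 wedge_monomial disjoints1 setD11 /=.
  rewrite finset.setD1K // => /(Plin (shuffle_sign K [set i] (S :\ i)) _ 0) /(_ P0).
  by rewrite addr0 scalerA shuffle_sign_sqr scale1r.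
move=> a; rewrite (form_monomial a); elim/big_rec: _ => // S b _ Pb.
exact: Plin.
Qed.

End Monomials.

(** * Pull-back by linear maps *)

Section PullBack.
Local Close Scope classical_set_scope.
Local Open Scope set_scope.
Local Open Scope ring_scope.
Variable (K : numFieldType).

Lemma eval_form_is_linear n (vs : seq 'rV[K]_n) :
  scalar (fun a : ext_form K n => eval_form a vs).
Proof.
rewrite /eval_form => k a b; elim: vs a b => [|v vs IH] a b /=.
  by rewrite add_formE scale_formE.
by rewrite linearD linearZ /= IH.
Qed.

Lemma eval_formD n (vs : seq 'rV[K]_n) a b :
  eval_form (a + b) vs = eval_form a vs + eval_form b vs.
Proof. by have := eval_form_is_linear vs 1 a b; rewrite scale1r mul1r. Qed.

Lemma eval_form0 n (vs : seq 'rV[K]_n) : eval_form 0 vs = 0 :> K.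
Proof. by rewrite /eval_form; elim: vs => [|v vs IH] /=; rewrite ?zero_formE ?linear0. Qed.

Lemma eval_formZ n (vs : seq 'rV[K]_n) k a :
  eval_form (k *: a) vs = k * eval_form a vs.
Proof. by have := eval_form_is_linear vs k a 0; rewrite !addr0 eval_form0 addr0. Qed.

Lemma eval_formN n (vs : seq 'rV[K]_n) a :
  eval_form (- a) vs = - eval_form a vs.
Proof. by rewrite -scaleN1r eval_formZ mulN1r. Qed.

Lemma eval_form_cons n v (vs : seq 'rV[K]_n) a :
  eval_form a (v :: vs) = eval_form (int_prod v a) vs.
Proof. by []. Qed.

Lemma eval_form_nil n (a : ext_form K n) : eval_form a [::] = a finset.set0.
Proof. by []. Qed.

Lemma eval_form_move n (s1 s2 : seq 'rV[K]_n) v a :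
  eval_form a (s1 ++ v :: s2) = (-1) ^+ size s1 * eval_form a (v :: s1 ++ s2).
Proof.
elim: s1 a => [|u s1 IH] a /=; first by rewrite mul1r.
rewrite eval_form_cons IH !eval_form_cons exprS -mulrA mulN1r -mulrN.
by rewrite -eval_formN -int_prod_anticomm.
Qed.

(** The shuffle sign of i counts the elements that precede i in the enumeration
    along which pull_form evaluates. *)
Lemma enum_setU1_split n (i : 'I_n) (S : {set 'I_n}) : i \notin S ->
  exists s1 s2, [/\ enum (i |: S) = s1 ++ i :: s2, enum S = s1 ++ s2 &
    shuffle_sign K [set i] S = (-1) ^+ size s1].
Proof.
move=> iS; pose p1 := take i (enum 'I_n); pose p2 := drop i.+1 (enum 'I_n).
have eI : enum 'I_n = p1 ++ i :: p2.
  rewrite -{1}(cat_take_drop i (enum 'I_n)); congr (_ ++ _).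
  by rewrite (drop_nth i) ?size_enum_ord // nth_ord_enum.
have lt1 j : j \in p1 -> (j < i)%N.
  move/(map_f val); rewrite /p1 map_take val_enum_ord take_iota mem_iota add0n.
  by rewrite leq0n (minn_idPl (ltnW (ltn_ord i))).
have lt2 j : j \in p2 -> (i < j)%N.
  by move/(map_f val); rewrite /p2 map_drop val_enum_ord drop_iota mem_iota add0n => /andP[].
have enumE (B : {set 'I_n}) : enum B = [seq j <- enum 'I_n | j \in B].
  by rewrite /enum_mem -filter_predI; apply: eq_filter => j /=; rewrite andbT.
have f1 : [seq j <- p1 | j \in i |: S] = [seq j <- p1 | j \in S].
  by apply: eq_in_filter => j /lt1 ji; rewrite !inE; case: eqP ji => // ->; rewrite ltnn.
have f2 : [seq j <- p2 | j \in i |: S] = [seq j <- p2 | j \in S].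
  by apply: eq_in_filter => j /lt2 ji; rewrite !inE; case: eqP ji => // ->; rewrite ltnn.
exists [seq j <- p1 | j \in S], [seq j <- p2 | j \in S].
have eS : enum S = [seq j <- p1 | j \in S] ++ [seq j <- p2 | j \in S].
  by rewrite enumE eI filter_cat /= (negPf iS).
split=> //; first by rewrite enumE eI filter_cat /= !inE eqxx /= f1 f2.
rewrite shuffle_sign_prod big_set1 -big_enum /= eS big_cat /=.
rewrite [X in _ * X]big1_seq ?mulr1; last first.
  by move=> j; rewrite mem_filter => /andP[_ /andP[_ /lt2 ij]]; rewrite ltnNge (ltnW ij).
rewrite (eq_big_seq (fun=> -1)); first by rewrite big_const_seq count_predT iter_mulr mulr1.
by move=> j; rewrite mem_filter => /andP[_ /lt1 ->].
Qed.

Lemma pull_formE m n (A : 'M[K]_(m, n)) a S :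
  pull_form A a S = eval_form a [seq row s A | s <- enum S].
Proof. by rewrite ffunE. Qed.

Lemma pull_form_is_linear m n (A : 'M[K]_(m, n)) : linear (pull_form A).
Proof.
move=> k a b; apply/ffunP => S.
by rewrite add_formE scale_formE !pull_formE eval_formD eval_formZ.
Qed.
HB.instance Definition _ m n (A : 'M[K]_(m, n)) :=
  GRing.isLinear.Build K (ext_form K n) (ext_form K m) *:%R (pull_form A)
    (pull_form_is_linear A).

Lemma pull_form_coef0 m n (A : 'M[K]_(m, n)) a :
  pull_form A a finset.set0 = a finset.set0.
Proof. by rewrite pull_formE finset.enum_set0. Qed.

Lemma pull_form_coefU1 m n (A : 'M[K]_(m, n)) a (i : 'I_m) (S : {set 'I_m}) : i \notin S ->
  pull_form A a (i |: S) =
  shuffle_sign K [set i] S * pull_form A (int_prod (row i A) a) S.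
Proof.
case/enum_setU1_split => s1 [s2 [e1 e2 es]].
rewrite !pull_formE e1 e2 es !map_cat /= eval_form_move size_map.
by rewrite eval_form_cons.
Qed.

Lemma int_prod_pull_form_row m n (A : 'M[K]_(m, n)) a i :
  int_prod (evec i) (pull_form A a) = pull_form A (int_prod (row i A) a).
Proof.
apply/ffunP => S; rewrite int_prod_evecE; case: ifPn => iS; last first.
  by rewrite pull_form_coefU1 // mulrA shuffle_sign_sqr mul1r.
rewrite -(finset.setD1K iS) pull_form_coefU1 ?setD11 //.
by rewrite int_prod_sqr linear0 zero_formE mulr0.
Qed.

(** Together with the coefficient of degree 0 this determines pull_form, and
    the further properties of pull-back follow from it by form_contract_ind. *)
Lemma int_prod_pull_form m n (A : 'M[K]_(m, n)) a v :
  int_prod v (pull_form A a) = pull_form A (int_prod (v *m A) a).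
Proof.
rewrite int_prod_basis mulmx_sum_row -[int_prod _ a]/(int_prodr a _) !linear_sum.
by apply: eq_bigr => i _; rewrite int_prod_pull_form_row !linearZ.
Qed.

Lemma pull_form_parity m n (A : 'M[K]_(m, n)) a :
  pull_form A (parity a) = parity (pull_form A a).
Proof.
apply/ffunP => S; move: S a; apply: form_contract_ind => [|i S iS IH] a.
  by rewrite parityE !pull_form_coef0 parityE !cards0.
rewrite !(form_coef_int_prod _ iS) int_prod_parity !int_prod_pull_form int_prod_parity.
by rewrite linearN !opp_formE IH.
Qed.

Lemma pull_form_wedge m n (A : 'M[K]_(m, n)) a b :
  pull_form A (a \w b) = pull_form A a \w pull_form A b.
Proof.
apply/ffunP => S; move: S a b; apply: form_contract_ind => [|i S iS IH] a b.
  by rewrite pull_form_coef0 !wedge_coef0 !pull_form_coef0.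
rewrite !(form_coef_int_prod _ iS) !(int_prod_wedge, int_prod_pull_form).
by rewrite linearD !add_formE !IH pull_form_parity.
Qed.

Lemma pull_form_comp m n p (A : 'M[K]_(m, n)) (B : 'M[K]_(n, p)) a :
  pull_form A (pull_form B a) = pull_form (A *m B) a.
Proof.
apply/ffunP => S; move: S a; apply: form_contract_ind => [|i S iS IH] a.
  by rewrite !pull_form_coef0.
by rewrite !(form_coef_int_prod _ iS) !int_prod_pull_form IH mulmxA.
Qed.

Lemma pull_form1 n (a : ext_form K n) : pull_form 1%:M a = a.
Proof.
apply/ffunP => S; move: S a; apply: form_contract_ind => [|i S iS IH] a.
  by rewrite !pull_form_coef0.
by rewrite !(form_coef_int_prod _ iS) !int_prod_pull_form IH mulmx1.
Qed.

Lemma pull_form_inj n (A : 'M[K]_n) : A \in unitmx -> injective (pull_form A).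
Proof.
move=> uA; apply: (can_inj (g := pull_form (invmx A))) => a.
by rewrite pull_form_comp mulVmx // pull_form1.
Qed.

Lemma pull_form0 m n (A : 'M[K]_(m, n)) k : pull_form A (form0 k) = form0 k.
Proof.
apply: form_eq_contract => [|i]; first by rewrite pull_form_coef0 !form0E !eqxx.
by rewrite int_prod_pull_form !int_prod_form0 linear0.
Qed.

Lemma has_degree_pull_form m n (A : 'M[K]_(m, n)) k a :
  has_degree k a -> has_degree k (pull_form A a).
Proof.
move=> da S; move: S k a da; apply: form_contract_ind => [|i S iS IH] k a da.
  by rewrite cards0 pull_form_coef0 => k0; apply: da; rewrite cards0.
rewrite (cardsD1 i S) iS (form_coef_int_prod _ iS) int_prod_pull_form => kS.
case: k da kS => [|k] da kS; first by rewrite int_prod_degree0 // linear0 zero_formE mulr0.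
by rewrite (IH k) ?mulr0 //; apply: has_degree_int_prod.
Qed.

Lemma pull_form_dx m n (A : 'M[K]_(m, n)) i :
  pull_form A (dx i) = \sum_j A j i *: dx j.
Proof.
apply: form_eq_contract => [|j].
  rewrite pull_form_coef0 sum_form_E dxE big1 => [|j _].
    by case: eqP => // /esym/eqP; rewrite -cards_eq0 cards1.
  rewrite scale_formE dxE; case: eqP => [/esym/eqP|]; rewrite ?mulr0 //.
  by rewrite -cards_eq0 cards1.
rewrite int_prod_pull_form int_prod_dx pull_form0 linear_sum /=.
under eq_bigr => l _ do rewrite linearZ /= int_prod_dx scale_form0.
rewrite -raddf_sum -rowE !mxE /= (bigD1 j) //= mxE !eqxx mulr1 big1 ?addr0 //.
by move=> l /negPf lj; rewrite mxE lj andbF mulr0.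
Qed.

End PullBack.

(** * Determinants and the Euclidean star *)

Section PullBackOfTopForms.
Local Close Scope classical_set_scope.
Local Open Scope set_scope.
Local Open Scope ring_scope.
Variables (K : numFieldType) (n : nat).
Implicit Types (A B C : 'M[K]_n) (a b c : ext_form K n) (k : K) (v : 'rV[K]_n).

(** The determinant, until pull_form_top identifies it as such. *)
Definition top_factor A : K := pull_form A (form_top 1) finset.setT.

Lemma pull_form_top_factor A k : pull_form A (form_top k) = form_top (top_factor A * k).
Proof.
rewrite -[k in LHS]mulr1 -scale_form_top linearZ /=.
rewrite (has_degree_top (has_degree_pull_form A (has_degree_form_top (1 : K)))).
by rewrite scale_form_top mulrC.
Qed.

Lemma top_factorM A B : top_factor (A *m B) = top_factor A * top_factor B.
Proof.
rewrite [LHS]/top_factor -pull_form_comp pull_form_top_factor pull_form_top_factor.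
by rewrite form_topE eqxx mulr1.
Qed.

Lemma top_factor1 : top_factor 1%:M = 1.
Proof. by rewrite /top_factor pull_form1 form_topE eqxx. Qed.

Lemma int_prod_top_eq0 v k : v != 0 -> int_prod v (form_top k) = 0 -> k = 0.
Proof.
case/rV0Pn => i vi /ffunP/(_ (finset.setT :\ i)); rewrite zero_formE int_prodE.
rewrite (bigD1 i) ?setD11 //= finset.setD1K ?inE // form_topE eqxx big1 ?addr0.
  move/eqP; rewrite !mulf_eq0 (negPf vi) /= => /orP[|/eqP //].
  by rewrite /shuffle_sign signr_eq0.
by move=> j; rewrite !inE andbT negbK => /andP[ji] /negP.
Qed.

Lemma top_factor_singular v A : v != 0 -> v *m A = 0 -> top_factor A = 0.
Proof.
move=> v0 vA; have := pull_form_top_factor A 1; rewrite mulr1 => e.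
apply: (int_prod_top_eq0 v0); rewrite -e int_prod_pull_form vA.
by rewrite int_prod0l linear0.
Qed.

Lemma eq_pull_form_rows A B a (S : {set 'I_n}) :
  (forall i, i \in S -> row i A = row i B) -> pull_form A a S = pull_form B a S.
Proof.
move=> eAB; rewrite !pull_formE; congr eval_form; apply/eq_in_map => i.
by rewrite mem_enum => /eAB.
Qed.

Lemma top_factor_rowD A B C i : row i A = row i B + row i C ->
  (forall j, j != i -> row j A = row j B) ->
  (forall j, j != i -> row j A = row j C) ->
  top_factor A = top_factor B + top_factor C.
Proof.
move=> ei eB eC; rewrite /top_factor -(finset.setD1K (finset.in_setT i)).
rewrite !pull_form_coefU1 ?setD11 // -mulrDr; congr (_ * _).
rewrite ei int_prodDl linearD add_formE /=; congr (_ + _); apply: eq_pull_form_rows => j /finset.setD1P[ji _];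
  by [apply: eB | apply: eC].
Qed.

(** The polarization argument: the factor is additive in the rows i and j, and
    it vanishes when they agree. *)
Lemma top_factor_tperm (i j : 'I_n) : i != j -> top_factor (perm_mx (tperm i j)) = -1.
Proof.
move=> ij; pose B u v := \matrix_k (if k == i then u else if k == j then v else evec k : 'rV[K]_n).
have rowB u v (k : 'I_n) : row k (B u v) = if k == i then u else if k == j then v else evec k.
  by rewrite rowK.
have ji : (j == i) = false by rewrite eq_sym (negPf ij).
have D1 u1 u2 v : top_factor (B (u1 + u2) v) = top_factor (B u1 v) + top_factor (B u2 v).
  by apply: (@top_factor_rowD _ _ _ i); rewrite ?rowB ?eqxx // => k /negPf ki; rewrite !rowB ki.
have D2 u v1 v2 : top_factor (B u (v1 + v2)) = top_factor (B u v1) + top_factor (B u v2).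
  apply: (@top_factor_rowD _ _ _ j); rewrite ?rowB ?ji ?eqxx // => k /negPf kj;
    by rewrite !rowB kj.
have D0 u : top_factor (B u u) = 0.
  apply: (@top_factor_singular (evec i - evec j)).
    apply/rV0Pn; exists i; rewrite !mxE !eqxx (negPf ij) andbF subr0; exact: oner_neq0.
  by rewrite mulmxBl -!rowE !rowB eqxx ji eqxx subrr.
have eB : B (evec i) (evec j) = 1%:M.
  apply/row_matrixP => k; rewrite rowB row1; case: eqP => [->//|_].
  by case: eqP => [->|].
have eB' : B (evec j) (evec i) = perm_mx (tperm i j).
  apply/row_matrixP => k; rewrite rowB; apply/rowP => l; do 3 rewrite [RHS]mxE.
  case: tpermP => [->|->|/eqP/negPf -> /eqP/negPf ->]; rewrite ?eqxx ?ji ?mxE ?eqxx //=;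
  by rewrite eq_sym.
have := D0 (evec i + evec j).
rewrite D1 !D2 !D0 add0r addr0 eB eB' top_factor1 => /eqP.
by rewrite addrC addr_eq0 => /eqP.
Qed.

Lemma top_factor_perm (s : 'S_n) : top_factor (perm_mx s) = (-1) ^+ s.
Proof.
case: (prod_tpermP s) => ts -> {s}.
elim: ts => [|t ts IH] /=; first by rewrite big_nil perm_mx1 top_factor1 odd_perm1.
case/andP => dt dts; rewrite big_cons perm_mxM top_factorM IH // odd_mul_tperm.
by rewrite top_factor_tperm // dt signr_addb.
Qed.

(** These instances make the distributivity of big operators, stated for
    monoid laws, available for the noncommutative wedge product; addition
    needs a name that can carry one. *)
HB.instance Definition _ :=
  Monoid.isMulLaw.Build (ext_form K n) 0 (@wedge K n) (@wedge0l K n) (@wedge0r K n).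
Lemma wedge_left_distr : left_distributive (@wedge K n) (fun a b => a + b).
Proof. by move=> a b c; rewrite wedgeDl. Qed.
Lemma wedge_right_distr : right_distributive (@wedge K n) (fun a b => a + b).
Proof. by move=> a b c; rewrite wedgeDr. Qed.
Definition form_add a b := a + b.
HB.instance Definition _ :=
  Monoid.isComLaw.Build (ext_form K n) 0 form_add (@addrA _) (@addrC _) (@add0r _).
HB.instance Definition _ :=
  Monoid.isAddLaw.Build (ext_form K n) (@wedge K n) form_add
    wedge_left_distr wedge_right_distr.

Local Notation bigwedge F := (\big[@wedge K n/form0 1]_(i < n) F i).

Lemma bigwedge_dx : bigwedge (fun i => dx i) = form_top 1.
Proof.
have sorted_wedge (s : seq 'I_n) : path.sorted ltn (map val s) ->
    \big[@wedge K n/form0 1]_(i <- s) dx i = monomial K [set i in s].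
  elim: s => [|i s IH] /= ss.
    by rewrite big_nil -monomial0; congr monomial; apply/setP => j; rewrite !inE.
  have lt_is j : j \in s -> (i < j)%N.
    by move=> js; apply: (allP (order_path_min ltn_trans ss)); exact: map_f.
  rewrite big_cons IH ?(path_sorted ss) // -monomial1 wedge_monomial disjoints1.
  have -> : i \notin [set j in s] by rewrite inE; apply/negP => /lt_is; rewrite ltnn.
  rewrite (_ : shuffle_sign _ _ _ = 1) ?scale1r.
    by congr monomial; apply/setP => j; rewrite !inE.
  rewrite shuffle_sign_prod big_set1 big1 // => j; rewrite inE => /lt_is ij.
  by rewrite ltnNge (ltnW ij).
have := sorted_wedge (enum 'I_n); rewrite val_enum_ord iota_ltn_sorted => /(_ isT).
rewrite {1}enumT -[Finite.enum _]/(Finite.enum _) (_ : Finite.enum _ = index_enum _); last by rewrite [index_enum _]unlock.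
move=> ->; rewrite -monomialT; congr monomial.
by apply/setP => i; rewrite !inE mem_enum.
Qed.

Lemma pull_form_bigwedge A (F : 'I_n -> ext_form K n) :
  pull_form A (bigwedge F) = bigwedge (fun i => pull_form A (F i)).
Proof.
elim/big_rec2: _ => [|i a b _ <-]; first by rewrite pull_form0.
by rewrite pull_form_wedge.
Qed.

Lemma bigwedgeZ (k : 'I_n -> K) (F : 'I_n -> ext_form K n) :
  bigwedge (fun i => k i *: F i) = (\prod_i k i) *: bigwedge F.
Proof.
elim/big_rec3: _ => [|i a b c _ ->]; first by rewrite scale1r.
by rewrite wedgeZl wedgeZr scalerA.
Qed.

Lemma bigwedge_dx_comp (f : {ffun 'I_n -> 'I_n}) :
  bigwedge (fun i => dx (f i)) = form_top (top_factor (\matrix_(j, i) (j == f i)%:R)).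
Proof.
rewrite -[top_factor _]mulr1 -pull_form_top_factor -bigwedge_dx pull_form_bigwedge.
apply: eq_bigr => i _; rewrite pull_form_dx (bigD1 (f i)) //= mxE eqxx scale1r.
by rewrite big1 ?addr0 // => j /negPf jfi; rewrite mxE jfi scale0r.
Qed.

(** Leibniz' formula, read off from the wedge product of the n pulled back
    coordinate forms. *)
Lemma pull_form_top A k : pull_form A (form_top k) = form_top (\det A * k).
Proof.
rewrite pull_form_top_factor; congr (form_top (_ * _)).
have := pull_form_top_factor A 1; rewrite mulr1 -{1}bigwedge_dx pull_form_bigwedge.
under eq_bigr => i _ do rewrite pull_form_dx.
have distr : bigwedge (fun i => \sum_j A j i *: dx j) =
    \sum_(f : {ffun 'I_n -> 'I_n}) bigwedge (fun i => A (f i) i *: dx (f i)).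
  exact: (bigA_distr_bigA (times := @wedge K n) (plus := form_add)
    (fun i j => A j i *: (dx j : ext_form K n))).
rewrite distr => /(congr1 (fun a : ext_form K n => a finset.setT)); rewrite sum_form_E form_topE eqxx => <-.
rewrite (bigID (fun f : {ffun 'I_n -> 'I_n} => injectiveb f)) /= addrC big1 ?add0r; last first.
  move=> f nf; rewrite bigwedgeZ bigwedge_dx_comp scale_formE form_topE eqxx.
  have [j jf] : exists j, j \notin codom f.
    apply/existsP; rewrite -negb_forall; apply: contra nf => /forallP sf.
    have /fintype.image_injP f_inj : #|[seq f x | x in 'I_n]| == #|'I_n|.
      rewrite eqn_leq leq_image_card /=.
      by apply/subset_leq_card/fintype.subsetP => j _; apply: sf.
    by apply/injectiveP => x y; apply: f_inj.
  rewrite (@top_factor_singular (evec j)) ?mulr0 //.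
    apply/rV0Pn; exists j; rewrite mxE !eqxx; exact: oner_neq0.
  rewrite -rowE; apply/rowP => i; rewrite !mxE; case: eqP => // ej.
  by rewrite ej codom_f in jf.
rewrite (reindex (@pval _)) /=; last first.
  pose in_Sn := insubd (1%g : 'S_n).
  by exists in_Sn => /= f Uf; first apply: val_inj; apply: insubdK.
rewrite -det_tr; apply: eq_big => [s|s _]; first by rewrite (valP s).
rewrite bigwedgeZ bigwedge_dx_comp scale_formE form_topE eqxx mulrC; congr (_ * _).
  rewrite -odd_permV -top_factor_perm; congr top_factor; apply/matrixP => j i.
  by rewrite !mxE pvalE (canF_eq (permKV s)).
by apply: eq_bigr => i _; rewrite mxE pvalE.
Qed.

End PullBackOfTopForms.

Section EuclideanStar.
Local Close Scope classical_set_scope.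
Local Open Scope set_scope.
Local Open Scope ring_scope.
Variables (K : numFieldType) (n : nat).
Implicit Types (A B C : 'M[K]_n) (a b c : ext_form K n) (k : K) (v : 'rV[K]_n).
Local Notation sgn := (@shuffle_sign K n).

(** The Hodge star of the standard Euclidean metric. *)
Definition euclid_star a : ext_form K n :=
  [ffun S : {set 'I_n} => sgn (~: S) S * a (~: S)].

Lemma euclid_starE a (S : {set 'I_n}) : euclid_star a S = sgn (~: S) S * a (~: S).
Proof. by rewrite ffunE. Qed.

Lemma euclid_star_is_linear : linear euclid_star.
Proof.
move=> k a b; apply/ffunP => S.
by rewrite add_formE scale_formE !euclid_starE add_formE scale_formE; ring.
Qed.
HB.instance Definition _ :=
  GRing.isLinear.Build K (ext_form K n) (ext_form K n) *:%R euclid_star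
    euclid_star_is_linear.

Lemma euclid_star_dx_wedge i a :
  euclid_star (dx i \w a) = int_prod (evec i) (euclid_star (parity a)).
Proof.
pose P a := euclid_star (dx i \w a) = int_prod (evec i) (euclid_star (parity a)).
suff Pm S : P (monomial K S).
  rewrite -/(P a) (form_monomial a); elim/big_rec: _ => [|S b _ Pb].
    by rewrite /P wedge0r !linear0.
  by rewrite /P wedgeDr wedgeZr !linearD !linearZ /= Pm Pb.
apply/ffunP => T; rewrite int_prod_evecE !euclid_starE parityE -monomial1 wedge_monomial.
rewrite disjoints1; have [iS|iS] := boolP (i \in S) => /=.
  rewrite zero_formE mulr0; case: ifP => // iT; rewrite monomialE.
  by case: eqP => [eS|_]; rewrite ?mulr0 //; rewrite -eS !inE eqxx in iS.
rewrite scale_formE !monomialE.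
have [iT|iT] := boolP (i \in T).
  case: eqP => [e|_]; rewrite ?mulr0 //.
  by have := finset.setU11 i S; rewrite -e !inE iT.
have eT : ~: T = i |: ~: (i |: T).
  by apply/setP => j; rewrite !inE; case: eqP => [->|]; rewrite ?iT.
have niT : i \notin ~: (i |: T) by rewrite !inE eqxx.
have -> : (~: T == i |: S) = (~: (i |: T) == S).
  rewrite eT; apply/eqP/eqP => [e|->//].
  by rewrite -(finset.setU1K niT) e finset.setU1K.
case: eqP => [eS|]; rewrite ?mulr0 // eS in niT eT *.
have d1 : [disjoint [set i] & S] by rewrite disjoints1.
have d2 : [disjoint [set i] & T] by rewrite disjoints1.
rewrite eT (shuffle_signUl K _ d1) (shuffle_signUr K _ d2) -(shuffle_sign1C K iS).
have := shuffle_sign_sqr K S [set i].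
set x := sgn S [set i]; set y := sgn [set i] T; set z := sgn [set i] S; set w := sgn S T.
move=> xx; transitivity (y * w * z * (x * x)); last by ring.
rewrite xx; ring.
Qed.

Lemma euclid_star_form0 k : euclid_star (form0 k) = form_top k.
Proof.
apply/ffunP => S; rewrite euclid_starE form0E form_topE -finset.setCT.
rewrite (inj_eq (@finset.setC_inj _)); case: eqP => [->|]; rewrite ?mulr0 //.
by rewrite finset.setCT shuffle_sign0l mul1r.
Qed.

Lemma parityK a : parity (parity a) = a.
Proof.
apply/ffunP => S; rewrite !parityE mulrA -exprD addnn.
by rewrite signr_double mul1r.
Qed.

Lemma parity_form0 k : parity (form0 k) = form0 k :> ext_form K n.
Proof. by rewrite (parity_degree (has_degree_form0 k)) scale1r. Qed.

Lemma parity_dx i : parity (dx i) = - dx i :> ext_form K n.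
Proof. by rewrite (parity_degree (has_degree_dx K i)) expr1 scaleN1r. Qed.

(** Covariance of the star: contracting with the rows of P is the transpose of
    wedging with the forms pulled back by P^T. *)
Lemma euclid_star_pull A a : A \in unitmx ->
  euclid_star (pull_form A^T a) = \det A *: pull_form (invmx A) (euclid_star a).
Proof.
move=> uA; pose P a := euclid_star (pull_form A^T a) =
  \det A *: pull_form (invmx A) (euclid_star a).
have Plin k c d : P c -> P d -> P (k *: c + d).
  move=> Pc Pd; rewrite /P (linearP (pull_form _)) /= (linearP euclid_star) /= Pc Pd.
  rewrite (linearP euclid_star) /= (linearP (pull_form _)) /= scalerDr !scalerA.
  by rewrite mulrC.
have P0 : P 0 by rewrite /P !linear0.
suff [] : P a /\ P (parity a) by [].
elim/form_gen_ind: a => [k a b [Pa Pa'] [Pb Pb']||i a [Pa Pa']].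
- by split; [exact: Plin | rewrite linearP; exact: Plin].
- rewrite parity_form0; split; rewrite /P pull_form0 euclid_star_form0 pull_form_top;
  by rewrite scale_form_top mulr1 det_inv divrr // -unitmxE.
have Pdx b : P (parity b) -> P (dx i \w b).
  move=> Pb; rewrite /P pull_form_wedge pull_form_dx wedge_suml linear_sum /=.
  rewrite euclid_star_dx_wedge -[evec i](mulmxK uA) -int_prod_pull_form -linearZ /=.
  rewrite -Pb int_prod_basis pull_form_parity; apply: eq_bigr => j _.
  by rewrite wedgeZl linearZ /= euclid_star_dx_wedge -rowE !mxE.
split; first exact: Pdx.
rewrite parity_wedge parity_dx wedgeNl -[- _]addr0 -scaleN1r; apply: Plin => //.
by apply: Pdx; rewrite parityK.
Qed.

End EuclideanStar.

(** * Computing with explicit forms *)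

Section ReflectedForms.
Local Close Scope classical_set_scope.
Local Open Scope set_scope.
Local Open Scope ring_scope.
Variable (n : nat).

(** Forms with integer coefficients as lists of monomials, an index set being
    given by its bits; identities between explicit forms are then decided by
    evaluation. *)
Definition bit_form := seq (int * bitseq).
Implicit Types (p q : bit_form) (b : bitseq) (t u : int * bitseq).

Definition set_of_bits b : {set 'I_n} := [set i : 'I_n | nth false b i].

Definition flip_count (f : nat -> bool) : bool :=
  foldr (fun i c => f i (+) c) false (iota 0 n).

Definition bits_sign b1 b2 : bool :=
  flip_count (fun i => nth false b1 i &&
    flip_count (fun j => nth false b2 j && (j < i)%N)).

Definition bits_disjoint b1 b2 : bool :=
  all (fun i => ~~ (nth false b1 i && nth false b2 i)) (iota 0 n).

Definition bits_or b1 b2 : bitseq :=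
  [seq nth false b1 i || nth false b2 i | i <- iota 0 n].

Definition bits_compl b : bitseq := [seq ~~ nth false b i | i <- iota 0 n].

Definition bits_of_seq (s : seq nat) : bitseq := [seq i \in s | i <- iota 0 n].

Definition bits_remove (i : nat) b : bitseq :=
  [seq (j != i) && nth false b j | j <- iota 0 n].

Definition signz (c : bool) : int := if c then -1 else 1.

Definition bit_wedge p q : bit_form :=
  [seq (t.1 * u.1 * signz (bits_sign t.2 u.2), bits_or t.2 u.2)
     | t <- p, u <- [seq u <- q | bits_disjoint t.2 u.2]].

Definition bit_contract (i : nat) p : bit_form :=
  [seq (t.1 * signz (bits_sign (bits_of_seq [:: i]) (bits_remove i t.2)),
        bits_remove i t.2) | t <- [seq t <- p | nth false t.2 i]].

Definition bit_star p : bit_form :=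
  [seq (t.1 * signz (bits_sign t.2 (bits_compl t.2)), bits_compl t.2) | t <- p].

Definition bit_scale (z : int) p : bit_form := [seq (z * t.1, t.2) | t <- p].

Fixpoint all_bits (m : nat) : seq bitseq :=
  if m is m'.+1 then [seq c :: b | c <- [:: false; true], b <- all_bits m'] else [:: [::]].

Definition bit_coef p b : int := foldr (fun t z => (if t.2 == b then t.1 else 0) + z) 0 p.

Definition bit_wf p : bool := all (fun t => size t.2 == n) p.

Definition bit_eq p q : bool :=
  [&& bit_wf p, bit_wf q & all (fun b => bit_coef p b == bit_coef q b) (all_bits n)].

Variable (K : numFieldType).

Definition bit_val p : ext_form K n :=
  \sum_(t <- p) (t.1%:~R : K) *: monomial K (set_of_bits t.2).

Lemma bit_val_cat p q : bit_val (p ++ q) = bit_val p + bit_val q.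
Proof. by rewrite /bit_val big_cat. Qed.

Lemma flip_countE f : (-1) ^+ flip_count f = \prod_(i < n) (-1) ^+ f i :> K.
Proof.
rewrite /flip_count -(big_mkord xpredT (fun i => (-1) ^+ f i)) /index_iota subn0.
elim: (iota 0 n) => [|i s IH]; first by rewrite big_nil expr0.
by rewrite big_cons /= signr_addb IH.
Qed.

Lemma signzE c : (signz c)%:~R = (-1) ^+ c :> K.
Proof. by case: c; rewrite ?expr1 ?expr0. Qed.

Lemma bits_signE b1 b2 :
  (signz (bits_sign b1 b2))%:~R = shuffle_sign K (set_of_bits b1) (set_of_bits b2).
Proof.
rewrite signzE flip_countE shuffle_sign_prod [RHS]big_mkcond; apply: eq_bigr => i _ /=.
rewrite inE; case: (nth false b1 i) => //=; rewrite flip_countE.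
rewrite [RHS]big_mkcond; apply: eq_bigr => j _ /=; rewrite inE.
by case: (nth false b2 j) => //=; case: (j < i)%N; rewrite ?expr1 ?expr0.
Qed.

Lemma bits_disjointE b1 b2 :
  bits_disjoint b1 b2 = [disjoint set_of_bits b1 & set_of_bits b2].
Proof.
apply/allP/pred0P => [h i|h i].
  rewrite /= !inE; have := h i; rewrite mem_iota leq0n add0n ltn_ord => /(_ isT).
  exact: negbTE.
rewrite mem_iota /= add0n => ltin; have := h (Ordinal ltin).
by rewrite /= !inE => /negbT.
Qed.

Lemma nth_map_iota (f : nat -> bool) (i : 'I_n) : nth false (map f (iota 0 n)) i = f i.
Proof. by rewrite (nth_map 0%N) ?size_iota // nth_iota. Qed.

Lemma bits_orE b1 b2 : set_of_bits (bits_or b1 b2) = set_of_bits b1 :|: set_of_bits b2.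
Proof. by apply/setP => i; rewrite !inE nth_map_iota. Qed.

Lemma bits_complE b : set_of_bits (bits_compl b) = ~: set_of_bits b.
Proof. by apply/setP => i; rewrite !inE nth_map_iota. Qed.

Lemma bits_of_seqE s : set_of_bits (bits_of_seq s) = [set i : 'I_n | val i \in s].
Proof. by apply/setP => i; rewrite !inE nth_map_iota. Qed.

Lemma bits_removeE (i : 'I_n) b : set_of_bits (bits_remove i b) = set_of_bits b :\ i.
Proof. by apply/setP => j; rewrite !inE nth_map_iota. Qed.

Lemma bit_val_wedge p q : bit_val (bit_wedge p q) = bit_val p \w bit_val q.
Proof.
rewrite /bit_val wedge_suml big_allpairs_dep; apply: eq_bigr => t _.
rewrite wedgeZl wedge_sumr big_filter big_mkcond scaler_sumr; apply: eq_bigr => u _ /=.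
rewrite wedgeZr wedge_monomial -bits_disjointE; case: ifP => _; last by rewrite !scaler0.
by rewrite bits_orE -bits_signE !scalerA !intrM.
Qed.

Lemma int_prod_monomial (i : 'I_n) S : int_prod (evec i) (monomial K S) =
  if i \in S then shuffle_sign K [set i] (S :\ i) *: monomial K (S :\ i) else 0.
Proof.
apply/ffunP => T; rewrite int_prod_evecE monomialE.
have [iS|iS] := boolP (i \in S); last first.
  rewrite zero_formE; case: ifP => // iT; case: eqP => [e|]; rewrite ?mulr0 //.
  by rewrite -e !inE eqxx in iS.
rewrite scale_formE monomialE; have [iT|iT] := ifPn.
  by case: eqP => [e|]; rewrite ?mulr0 //; rewrite e !inE eqxx in iT.
have -> : (i |: T == S) = (T == S :\ i).
  apply/eqP/eqP => [<-|->]; first by rewrite finset.setU1K.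
  by rewrite finset.setD1K.
by case: eqP => [->//|_]; rewrite !mulr0.
Qed.

Lemma bit_val_contract (i : 'I_n) p :
  bit_val (bit_contract i p) = int_prod (evec i) (bit_val p).
Proof.
rewrite /bit_val linear_sum big_map big_filter big_mkcond; apply: eq_bigr => t _ /=.
rewrite linearZ /= int_prod_monomial inE; case: ifP => _; last by rewrite scaler0.
rewrite intrM bits_signE bits_removeE bits_of_seqE scalerA.
by congr ((_ * shuffle_sign _ _ _) *: _); apply/setP => j; rewrite !inE.
Qed.

Lemma bit_val_star p : bit_val (bit_star p) = euclid_star (bit_val p).
Proof.
rewrite /bit_val linear_sum big_map; apply: eq_bigr => t _ /=.
rewrite linearZ /= intrM bits_signE bits_complE -scalerA; congr (_ *: _).
apply/ffunP => S; rewrite scale_formE euclid_starE !monomialE -[in RHS](finset.setCK (set_of_bits _)).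
rewrite (inj_eq (@finset.setC_inj _)); case: eqP => [->|_]; rewrite ?mulr0 //.
by rewrite !finset.setCK.
Qed.

Lemma bit_val_scale z p : bit_val (bit_scale z p) = z%:~R *: bit_val p.
Proof.
by rewrite /bit_val big_map scaler_sumr; apply: eq_bigr => t _; rewrite scalerA intrM.
Qed.

Lemma mem_all_bits m b : (b \in all_bits m) = (size b == m).
Proof.
elim: m b => [|m IH] b; first by case: b => //= c b.
apply/allpairsP/idP => [[[c b'] /= [_ b'm ->]]|].
  by rewrite /= eqSS -IH.
case: b => // c b; rewrite /= eqSS => sb; exists (c, b) => /=.
by rewrite IH sb; case: c.
Qed.

Lemma bit_eqP p q : bit_eq p q -> bit_val p = bit_val q.
Proof.
case/and3P => wp wq /allP epq; apply/ffunP => S.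
pose b := bits_of_seq [seq val i | i <- enum S].
have eS : S = set_of_bits b.
  apply/setP => i; rewrite bits_of_seqE inE mem_map ?mem_enum //; exact: val_inj.
have sb : size b = n by rewrite size_map size_iota.
have valE r : bit_wf r -> bit_val r S = (bit_coef r b)%:~R.
  rewrite eS => wr; rewrite /bit_val sum_form_E.
  elim: r wr => [|t r IH] /=; first by rewrite big_nil.
  case/andP => /eqP st wr; rewrite big_cons IH // intrD; congr (_ + _).
  rewrite scale_formE monomialE.
  have -> : (set_of_bits b == set_of_bits t.2) = (t.2 == b).
    apply/eqP/eqP => [e|->//]; apply: (@eq_from_nth _ false); rewrite st ?sb // => i ltin.
    by have := (congr1 (fun A : {set 'I_n} => Ordinal ltin \in A) e); rewrite !inE /= => ->.
  by case: eqP; rewrite ?mulr1 ?mulr0.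
by rewrite !valE //; congr (_%:~R); apply/eqP/epq; rewrite mem_all_bits sb.
Qed.

Lemma bit_val_dx (i : 'I_n) : bit_val [:: (1, bits_of_seq [:: val i])] = dx i.
Proof.
rewrite /bit_val big_seq1 scale1r -monomial1 bits_of_seqE.
by congr monomial; apply/setP => j; rewrite !inE.
Qed.

Lemma bit_val_nil : bit_val [::] = 0.
Proof. exact: big_nil. Qed.

Lemma has_degree_bit_val k p : all (fun t => count id t.2 == k) p -> bit_wf p ->
  has_degree k (bit_val p).
Proof.
move=> /allP dp /allP wp; rewrite /bit_val big_seq_cond; apply: has_degree_sum.
move=> t /andP[tp _]; apply: has_degreeZ => S kS; rewrite monomialE; case: eqP => // eS.
case/negP: kS; rewrite eS -(eqP (dp _ tp)) -sum1_card -sum1_count.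
rewrite (big_nth false) (eqP (wp _ tp)) big_mkord; apply/eqP.
by apply: eq_bigl => i; rewrite inE.
Qed.

End ReflectedForms.

(** * The standard SU(3)- and G2-structures *)

Section StandardForms.
Local Close Scope classical_set_scope.
Local Open Scope set_scope.
Local Open Scope ring_scope.

Local Notation bits s := (bits_of_seq 7 s%N).
Local Notation mono z s := ((z%R : int), bits s).

Definition std_w_bits : bit_form :=
  [:: mono 1 [:: 1; 2]; mono 1 [:: 3; 4]; mono 1 [:: 5; 6]].
Definition std_re_bits : bit_form :=
  [:: mono 1 [:: 1; 3; 5]; mono (-1) [:: 1; 4; 6];
      mono (-1) [:: 2; 3; 6]; mono (-1) [:: 2; 4; 5]].
Definition std_im_bits : bit_form :=
  [:: mono 1 [:: 1; 3; 6]; mono 1 [:: 1; 4; 5];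
      mono 1 [:: 2; 3; 5]; mono (-1) [:: 2; 4; 6]].
Definition std_e_bits : bit_form := [:: mono 1 [:: 0]].
Definition std_phi_bits : bit_form := std_re_bits ++ bit_wedge 7 std_e_bits std_w_bits.
Definition std_vol_bits : bit_form := [:: mono 1 [:: 1; 2; 3; 4; 5; 6]].

Variable K : numFieldType.
Implicit Types (X Y : 'rV[K]_7) (a b m : ext_form K 7).

Local Notation bval p := (bit_val 7 K p).

(** With z1 = x1 + i x2, z2 = x3 + i x4, z3 = x5 + i x6, these are the Kaehler
    form and the real and imaginary parts of dz1 dz2 dz3; the coordinate x0 is
    the Reeb direction. *)
Definition std_w := bval std_w_bits.
Definition std_re := bval std_re_bits.
Definition std_im := bval std_im_bits.
Definition std_e : ext_form K 7 := dx ord0.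
Definition std_phi := std_re + std_e \w std_w.
Definition std_vol6 := bval std_vol_bits.

Lemma std_eE : std_e = bval std_e_bits.
Proof. by rewrite -[RHS]/(bval [:: mono 1 [:: val (ord0 : 'I_7)]]) bit_val_dx. Qed.

Lemma std_phiE : std_phi = bval std_phi_bits.
Proof. by rewrite bit_val_cat bit_val_wedge -std_eE. Qed.

Lemma std_w_re : std_w \w std_re = 0.
Proof. by rewrite -bit_val_wedge -(bit_val_nil 7 K); apply: bit_eqP; vm_compute. Qed.

Lemma std_w_im : std_w \w std_im = 0.
Proof. by rewrite -bit_val_wedge -(bit_val_nil 7 K); apply: bit_eqP; vm_compute. Qed.

Lemma std_w3 : std_w \w std_w \w std_w = 6 *: std_vol6.
Proof.
rewrite -!bit_val_wedge -[6]/((6 : int)%:~R) -bit_val_scale.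
by apply: bit_eqP; vm_compute.
Qed.

Lemma std_re_im : std_re \w std_im = 4 *: std_vol6.
Proof.
rewrite -!bit_val_wedge -[4]/((4 : int)%:~R) -bit_val_scale.
by apply: bit_eqP; vm_compute.
Qed.

Lemma std_e_vol6 : std_e \w std_vol6 = form_top 1.
Proof.
rewrite std_eE -bit_val_wedge -monomialT.
transitivity (bval [:: (1, bits (iota 0 7))]); first by apply: bit_eqP; vm_compute.
rewrite /bit_val big_seq1 scale1r bits_of_seqE; congr monomial.
by apply/setP => i; rewrite finset.in_set mem_iota ltn_ord finset.in_setT.
Qed.

Lemma std_star_re : euclid_star std_re = - (std_e \w std_im).
Proof.
rewrite std_eE -bit_val_wedge -bit_val_star -scaleN1r -[-1]/((-1 : int)%:~R) -bit_val_scale.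
by apply: bit_eqP; vm_compute.
Qed.

Lemma std_star_e_im : euclid_star (std_e \w std_im) = - std_re.
Proof.
rewrite std_eE -bit_val_wedge -bit_val_star -scaleN1r -[-1]/((-1 : int)%:~R) -bit_val_scale.
by apply: bit_eqP; vm_compute.
Qed.

Lemma std_star_w2 : euclid_star (std_w \w std_w) = 2 *: (std_e \w std_w).
Proof.
rewrite std_eE -!bit_val_wedge -bit_val_star -[2]/((2 : int)%:~R) -bit_val_scale.
by apply: bit_eqP; vm_compute.
Qed.

Lemma std_star_e_w : euclid_star (std_e \w std_w) = 2^-1 *: (std_w \w std_w).
Proof.
apply: (scalerI (a := 2)); first by rewrite pnatr_eq0.
rewrite scalerA divff ?pnatr_eq0 // scale1r.
rewrite std_eE -!bit_val_wedge -bit_val_star -[2]/((2 : int)%:~R) -bit_val_scale.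
by apply: bit_eqP; vm_compute.
Qed.

(** By bilinearity this is a finite computation on basis vectors. *)
Lemma std_phi_metric X Y :
  int_prod X std_phi \w int_prod Y std_phi \w std_phi = form_top (6 * (X *m Y^T) 0 0).
Proof.
have std_ij (i j : 'I_7) : int_prod (evec i) std_phi \w int_prod (evec j) std_phi \w std_phi =
    form_top (if i == j then 6 else 0).
  have /allP/(_ (val i)) : all (fun i => all (fun j =>
      bit_eq 7 (bit_wedge 7 (bit_contract 7 i std_phi_bits)
                 (bit_wedge 7 (bit_contract 7 j std_phi_bits) std_phi_bits))
        (if i == j then [:: (6, bits (iota 0 7))] else [::])) (iota 0 7)) (iota 0 7).
    by vm_compute.
  rewrite mem_iota ltn_ord => /(_ isT) /allP/(_ (val j)).
  rewrite mem_iota ltn_ord => /(_ isT) /bit_eqP -/(_ K).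
  rewrite !bit_val_wedge !bit_val_contract -std_phiE => ->.
  rewrite (inj_eq val_inj); case: ifP => _.
    rewrite /bit_val big_seq1 -[6 in RHS]mulr1 -scale_form_top -monomialT; congr (_ *: monomial _ _).
    by apply/setP => l; rewrite bits_of_seqE finset.in_set mem_iota ltn_ord finset.in_setT.
  by rewrite bit_val_nil; apply/ffunP => S; rewrite form_topE zero_formE; case: ifP.
rewrite int_prod_basis [int_prod Y _]int_prod_basis wedge_suml.
under eq_bigr => i _ do rewrite wedgeZl wedge_suml wedge_sumr.
under eq_bigr => i _ do under eq_bigr => j _ do rewrite wedgeZl wedgeZr std_ij.
have top0 : form_top 0 = 0 :> ext_form K 7.
  by apply/ffunP => S; rewrite form_topE zero_formE; case: ifP.
under eq_bigr => i _.
  rewrite (bigD1 i) //= eqxx big1 ?addr0; last first.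
    by move=> j /negPf ji; rewrite eq_sym ji top0 scaler0.
  rewrite !scale_form_top; over.
rewrite mxE mulr_sumr; apply/ffunP => S; rewrite sum_form_E form_topE.
under eq_bigr => i _ do rewrite form_topE.
case: ifP => _; last by rewrite big1.
by apply: eq_bigr => i _; rewrite mxE; ring.
Qed.

Definition covec X : ext_form K 7 := \sum_i X 0 i *: dx i.

Lemma std_contract_w_im X : X 0 0 = 0 ->
  int_prod X std_w \w std_im = covec X \w std_re.
Proof.
move=> X0; rewrite int_prod_basis /covec !wedge_suml; apply: eq_bigr => i _.
rewrite !wedgeZl; have [->|i0] := eqVneq i 0; first by rewrite X0 !scale0r.
congr (_ *: _); rewrite -(bit_val_dx K i) -bit_val_contract -!bit_val_wedge.
have /allP/(_ (val i)) : all (fun i => bit_eq 7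
   (bit_wedge 7 (bit_contract 7 i std_w_bits) std_im_bits)
   (bit_wedge 7 [:: (1, bits [:: i])] std_re_bits)) (iota 1 6).
  by vm_compute.
rewrite mem_iota (ltn_ord i) andbT lt0n => /(_ i0); exact: bit_eqP.
Qed.

Lemma covecE m : has_degree 1 m -> m = covec (\row_i m [set i]).
Proof.
move=> dm; apply: form_eq_contract => [|i].
  rewrite dm ?cards0 // sum_form_E big1 // => j _.
  by rewrite scale_formE (has_degree_dx K j) ?mulr0 // cards0.
rewrite linear_sum (bigD1 i) //= linearZ /= int_prod_dx !mxE !eqxx big1 ?addr0.
  rewrite scale_form0 mulr1; apply/ffunP => S; rewrite form0E int_prod_evecE.
  have [->|S0] := eqVneq S finset.set0; first by rewrite inE finset.setU0 shuffle_sign0r mul1r.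
  case: ifPn => // iS; rewrite dm ?mulr0 // cardsU1 iS.
  by rewrite -cards_eq0 in S0; case: #|S| S0.
by move=> j /negPf ji; rewrite linearZ /= int_prod_dx !mxE eqxx /= ji raddf0 scaler0.
Qed.

(** The entry t_i lists the indices of a monomial with dx_i /\ p /\ t_i equal to
    s_i times the volume of C^3, while dx_j /\ p /\ t_i = 0 for the other j;
    the entries of index 0 are fillers. *)
Definition dual_to (p : bit_form) (t : seq (seq nat)) (s : seq int) : bool :=
  all (fun i => (nth 0 s i != 0) && all (fun j => bit_eq 7
    (bit_wedge 7 (bit_wedge 7 [:: mono 1 [:: j]] p) [:: mono 1 (nth [::] t i)])
    (if i == j then [:: (nth 0 s i, bits [:: 1; 2; 3; 4; 5; 6])] else [::]))
    (iota 1 6)) (iota 1 6).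

(** Wedging with a form is injective on horizontal one-forms if that form has
    dual monomials, complementary to one horizontal coordinate each. *)
Lemma std_wedge_inj p t s X : dual_to p t s -> X 0 0 = 0 ->
  covec X \w bval p = 0 -> X = 0.
Proof.
move=> /allP dual X0 Xp; apply/rowP => i; rewrite [RHS]mxE.
have [->|i0] := eqVneq i 0; first exact: X0.
have := dual (val i); rewrite mem_iota (ltn_ord i) andbT lt0n => /(_ i0) /andP[si /allP ti].
have := congr1 (fun a => a \w bval [:: mono 1 (nth [::] t i)]) Xp.
rewrite wedge0l /covec !wedge_suml => sum0.
have tij (j : 'I_7) : ((X 0 j *: dx j) \w bval p) \w bval [:: mono 1 (nth [::] t i)] =
    if i == j then (X 0 i * (nth 0 s i)%:~R) *: std_vol6 else 0.
  have [->|j0] := eqVneq j 0.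
    by rewrite X0 scale0r !wedge0l (negPf i0).
  have := ti (val j); rewrite mem_iota (ltn_ord j) andbT lt0n => /(_ j0) /bit_eqP -/(_ K).
  rewrite !bit_val_wedge bit_val_dx => e; rewrite !wedgeZl e (inj_eq val_inj).
  case: eqP => [->|_]; last by rewrite bit_val_nil scaler0.
  by rewrite /std_vol6 /bit_val !big_seq1 !scalerA /= mulr1.
move: sum0; rewrite (bigD1 i) //= tij eqxx big1 ?addr0; last first.
  by move=> j /negPf ji; rewrite tij eq_sym ji.
move=> e; have := congr1 (fun a => std_e \w a) e.
rewrite wedgeZr std_e_vol6 wedge0r scale_form_top mulr1.
move/ffunP/(_ finset.setT); rewrite form_topE eqxx zero_formE => /eqP.
by rewrite mulf_eq0 intr_eq0 (negPf si) orbF => /eqP.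
Qed.

Lemma std_im_inj X : X 0 0 = 0 -> covec X \w std_im = 0 -> X = 0.
Proof.
apply: (@std_wedge_inj _ [:: [::]; [:: 4; 6]; [:: 4; 5]; [:: 2; 6]; [:: 2; 5];
  [:: 2; 4]; [:: 2; 3]]%N [:: 0; -1; -1; 1; 1; -1; -1]).
by vm_compute.
Qed.

Lemma std_w2_inj X : X 0 0 = 0 -> covec X \w std_w \w std_w = 0 -> X = 0.
Proof.
rewrite -bit_val_wedge.
apply: (@std_wedge_inj _ [:: [::]; [:: 2]; [:: 1]; [:: 4]; [:: 3]; [:: 6]; [:: 5]]%N
  [:: 0; 2; -2; 2; -2; 2; -2]).
by vm_compute.
Qed.

End StandardForms.

(** * The metric and the star of a G2-form *)

Section G2Frames.
Variable R : realType.
Implicit Types (G P : 'M[R]_7) (phi a b : ext_form R 7) (m : R).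

Lemma posdef_unitmx n (G : 'M[R]_n.+1) : posdef G -> G \in unitmx.
Proof.
case=> _ pG; rewrite unitmxE unitfE; apply/det0P => -[v v0 vG].
by have := pG v v0; rewrite /bil vG mul0mx mxE ltxx.
Qed.

Lemma bil_evec n (G : 'M[R]_n.+1) i j : bil G (evec i) (evec j) = G i j.
Proof. by rewrite /bil -rowE trmx_delta -colE !mxE. Qed.

Lemma form_top_inj n : injective (@form_top R n).
Proof.
by move=> x y /ffunP/(_ finset.setT); rewrite !ffunE eqxx.
Qed.

(** The form determines m G; taking determinants in dimension 7, with
    det G = m^2, it determines m^9 and hence m. *)
Lemma g2_data_unique phi G m G' m' :
  g2_data phi G m -> g2_data phi G' m' -> G = G' /\ m = m'.
Proof.
case=> pG mG hG [pG' mG' hG'].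
have uG := posdef_unitmx pG; have uG' := posdef_unitmx pG'.
have m0 : m != 0.
  by apply: contraTneq uG => m0; rewrite unitmxE unitfE -mG m0 expr0n eqxx.
have eG : m *: G = m' *: G'.
  apply/matrixP => i j; rewrite !mxE.
  have := hG (evec i) (evec j); rewrite hG' => /form_top_inj; rewrite !bil_evec => e.
  have six : (6 : R) != 0 by rewrite pnatr_eq0.
  apply: (mulfI six); transitivity (6 * G i j * m); first by ring.
  by rewrite -e; ring.
have : m ^+ 9 = m' ^+ 9.
  have := congr1 determinant eG; rewrite !detZ -mG -mG' => e9.
  by rewrite (exprD m 7 2) (exprD m' 7 2).
move=> e9; have em : m = m'.
  have : `|m| = `|m'|.
    by apply: (pexpIrn (isT : (0 < 9)%N)); rewrite ?nnegrE // -!normrX e9.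
  move/eqP; rewrite eqr_norm2 => /orP[/eqP //|/eqP em].
  move: e9; rewrite em exprNn -signr_odd expr1 mulN1r => /eqP.
  rewrite eq_sym -addr_eq0 -mulr2n mulrn_eq0 /= expf_eq0 /= => /eqP m'0.
  by rewrite em m'0 oppr0 eqxx in m0.
by split=> //; apply: (scalerI m0); rewrite eG em.
Qed.

Lemma g2_pairE phi G m : g2_data phi G m -> g2_pair phi = (G, m).
Proof.
move=> hG; rewrite /g2_pair; case: xgetP => [[G' m'] _ /=|/(_ (G, m))]; last by [].
by move=> hG'; have [-> ->] := g2_data_unique hG hG'.
Qed.

Lemma g2_data_frame P phi : P \in unitmx -> pull_form P phi = std_phi R ->
  g2_data phi (invmx P *m (invmx P)^T) (\det (invmx P)).
Proof.
move=> uP ePphi; have uQ : invmx P \in unitmx by rewrite unitmx_inv.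
have ephi : phi = pull_form (invmx P) (std_phi R).
  by rewrite -ePphi pull_form_comp mulVmx // pull_form1.
split=> [||X Y].
- split=> [|v v0]; first by rewrite trmx_mul trmxK.
  rewrite /bil mulmxA -mulmxA -trmx_mul mxE.
  have [i vi] : exists i, (v *m invmx P) 0 i != 0.
    apply/rV0Pn; apply: contra_neq v0 => vQ.
    by rewrite -[v](mulmxK uQ) vQ mul0mx.
  rewrite (bigD1 i) //= ltr_wpDr //.
    by apply: sumr_ge0 => j _; rewrite [(_^T) _ _]mxE -expr2 sqr_ge0.
  by rewrite [(_^T) _ _]mxE -expr2 exprn_even_gt0.
- by rewrite det_mulmx det_tr expr2.
- rewrite ephi !int_prod_pull_form -!pull_form_wedge std_phi_metric pull_form_top.
  congr form_top; rewrite mulrC /bil; congr (_ * _ * _).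
  by rewrite trmx_mul !mulmxA.
Qed.

(** The star of phi is the Euclidean star transported by a frame in which phi
    is standard, by the covariance of the latter. *)
Lemma hodge_frame P phi b : P \in unitmx -> pull_form P phi = std_phi R ->
  hodge phi b = pull_form (invmx P) (euclid_star (pull_form P b)).
Proof.
move=> uP ePphi; have gd := g2_pairE (g2_data_frame uP ePphi).
have uP' : \det P != 0 by rewrite -unitfE -unitmxE.
have -> : hodge phi b = g2_vol phi *: euclid_star (pull_form (invmx (g2_metric phi)) b).
  apply/ffunP => S; rewrite scale_formE euclid_starE pull_formE ffunE /=; ring.
rewrite /g2_vol /g2_metric gd /=.
have -> : invmx (invmx P *m (invmx P)^T) = P^T *m P.
  have uA : invmx P *m (invmx P)^T \in unitmx.
    by rewrite unitmx_mul unitmx_tr unitmx_inv uP.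
  rewrite -[RHS](mulKmx uA) (_ : _ *m (P^T *m P) = 1%:M) ?mulmx1 //.
  rewrite trmx_inv mulmxA -[_ *m P^T]mulmxA mulVmx ?unitmx_tr // mulmx1.
  by rewrite mulVmx.
rewrite -pull_form_comp euclid_star_pull // scalerA det_inv mulVf // scale1r.
by [].
Qed.

End G2Frames.

Lemma euclid_star_form_top (K : numFieldType) n (k : K) :
  euclid_star (form_top k : ext_form K n) = form0 k.
Proof.
apply/ffunP => S; rewrite euclid_starE form0E form_topE.
have [->|S0] := eqVneq S finset.set0; first by rewrite finset.setC0 eqxx shuffle_sign0r mul1r.
case: eqP => [e|]; rewrite ?mulr0 //.
by rewrite -(finset.setCK S) e finset.setCT eqxx in S0.
Qed.

Section CoordinateCovectors.
Variable (K : numFieldType).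
Implicit Types (X Y : 'rV[K]_7) (a b m : ext_form K 7).

Lemma covec_is_linear : linear (@covec K).
Proof.
move=> k X Y; rewrite /covec scaler_sumr -big_split; apply: eq_bigr => i _.
by rewrite !mxE scalerDl scalerA.
Qed.
HB.instance Definition _ :=
  GRing.isLinear.Build K 'rV[K]_7 (ext_form K 7) *:%R (@covec K) covec_is_linear.

Lemma pull_form_covec (P : 'M[K]_7) X : pull_form P (covec X) = covec (X *m P^T).
Proof.
rewrite /covec linear_sum /=; under eq_bigr => i _ do rewrite linearZ /= pull_form_dx scaler_sumr.
rewrite exchange_big; apply: eq_bigr => j _.
rewrite mxE scaler_suml; apply: eq_bigr => i _.
by rewrite scalerA mxE.
Qed.

Lemma euclid_star_covec_wedge X a :
  euclid_star (covec X \w a) = int_prod X (euclid_star (parity a)).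
Proof.
rewrite /covec wedge_suml linear_sum int_prod_basis; apply: eq_bigr => i _.
by rewrite wedgeZl linearZ /= euclid_star_dx_wedge.
Qed.

Lemma int_prod_covec X Y : int_prod Y (covec X) = form0 ((Y *m X^T) 0 0).
Proof.
rewrite linear_sum mxE raddf_sum; apply: eq_bigr => i _.
by rewrite linearZ /= int_prod_dx scale_form0 mxE mulrC.
Qed.

Lemma has_degree_covec X : has_degree 1 (covec X).
Proof. by apply: has_degree_sum => i _; apply/has_degreeZ/has_degree_dx. Qed.

Lemma has_degree_std_w : has_degree 2 (std_w K).
Proof. by apply: has_degree_bit_val; vm_compute. Qed.
Lemma has_degree_std_re : has_degree 3 (std_re K).
Proof. by apply: has_degree_bit_val; vm_compute. Qed.
Lemma has_degree_std_im : has_degree 3 (std_im K).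
Proof. by apply: has_degree_bit_val; vm_compute. Qed.

Lemma int_prod_std_w : int_prod (evec 0) (std_w K) = 0.
Proof.
rewrite -(bit_val_contract K 0) -(bit_val_nil 7 K); apply: bit_eqP; by vm_compute.
Qed.
Lemma int_prod_std_re : int_prod (evec 0) (std_re K) = 0.
Proof.
rewrite -(bit_val_contract K 0) -(bit_val_nil 7 K); apply: bit_eqP; by vm_compute.
Qed.
Lemma int_prod_std_im : int_prod (evec 0) (std_im K) = 0.
Proof.
rewrite -(bit_val_contract K 0) -(bit_val_nil 7 K); apply: bit_eqP; by vm_compute.
Qed.

Lemma wedge_odd_sqr n k (a : ext_form K n) : odd k -> has_degree k a -> a \w a = 0.
Proof.
move=> ok da; have := wedgeC da da; rewrite -signr_odd oddM ok expr1 scaleN1r => e.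
have : 2 *: (a \w a) = 0 by rewrite scaler_nat mulr2n {1}e addNr.
by move/eqP; rewrite scaler_eq0 pnatr_eq0 /= => /eqP.
Qed.

End CoordinateCovectors.

(** * Real and imaginary parts of forms *)

Section ComplexForms.
Variables (R : realType) (n : nat).
Implicit Types (a b : ext_form R n) (U : ext_form R[i] n).

Lemma map_form_wedge (K K' : comNzRingType) (f : {rmorphism K -> K'})
    (x y : ext_form K n) : map_form f (x \w y) = map_form f x \w map_form f y.
Proof.
apply/ffunP => S; rewrite !ffunE rmorph_sum; apply: eq_bigr => A _.
rewrite !ffunE !rmorphM; congr (_ * _ * _).
by rewrite /shuffle_sign rmorphXn rmorphN1.
Qed.

Lemma map_form_int_prod (K K' : comNzRingType) (f : {rmorphism K -> K'})
    (v : 'rV[K]_n) (x : ext_form K n) :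
  map_form f (int_prod v x) = int_prod (map_mx f v) (map_form f x).
Proof.
apply/ffunP => S; rewrite !ffunE rmorph_sum; apply: eq_bigr => i _.
rewrite !ffunE !rmorphM mxE; congr (_ * _ * _).
by rewrite /shuffle_sign rmorphXn rmorphN1.
Qed.

Lemma map_form_eval (K K' : comNzRingType) (f : {rmorphism K -> K'})
    (vs : seq 'rV[K]_n) (x : ext_form K n) :
  eval_form (map_form f x) [seq map_mx f v | v <- vs] = f (eval_form x vs).
Proof.
rewrite /eval_form; elim: vs x => [|v vs IH] x /=; first by rewrite ffunE.
by rewrite -map_form_int_prod IH.
Qed.

Lemma map_form_pull (K K' : comNzRingType) (f : {rmorphism K -> K'}) m
    (B : 'M[K]_(m, n)) (a : ext_form K n) :
  map_form f (pull_form B a) = pull_form (map_mx f B) (map_form f a).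
Proof.
apply/ffunP => S; rewrite !ffunE -map_form_eval -map_comp.
by congr eval_form; apply: eq_map => i /=; rewrite map_row.
Qed.

Lemma cplx_formZ k a : cplx_form (k *: a) = k%:C *: cplx_form a.
Proof.
apply/ffunP => S; rewrite scale_formE ffunE scale_formE [in RHS]ffunE.
by rewrite rmorphM.
Qed.

Lemma cplx_form0 : cplx_form (0 : ext_form R n) = 0.
Proof. by apply/ffunP => S; rewrite !ffunE. Qed.

Lemma cplx_formN a : cplx_form (- a) = - cplx_form a.
Proof. by rewrite -scaleN1r cplx_formZ rmorphN1 scaleN1r. Qed.

Lemma cplx_form_wedge a b : cplx_form (a \w b) = cplx_form a \w cplx_form b.
Proof. exact: (map_form_wedge (@real_complex R)). Qed.

Lemma cplx_form_inj : injective (@cplx_form R n).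
Proof. by move=> a b /ffunP ab; apply/ffunP => S; have := ab S; rewrite !ffunE => -[]. Qed.

Lemma complex_form_split U : U = cplx_form (Re_form U) + 'i *: cplx_form (Im_form U).
Proof.
apply/ffunP => S; rewrite add_formE scale_formE !ffunE; case: (U S) => x y; simpc.
by [].
Qed.

Lemma conj_form_split U : conj_form U = cplx_form (Re_form U) - 'i *: cplx_form (Im_form U).
Proof.
apply/ffunP => S; rewrite add_formE opp_formE scale_formE !ffunE; case: (U S) => x y; simpc.
by [].
Qed.

Lemma Re_form_split a b : Re_form (cplx_form a + 'i *: cplx_form b) = a.
Proof. by apply/ffunP => S; rewrite !(ffunE, add_formE, scale_formE) /=; simpc. Qed.

Lemma Im_form_split a b : Im_form (cplx_form a + 'i *: cplx_form b) = b.
Proof. by apply/ffunP => S; rewrite !(ffunE, add_formE, scale_formE) /=; simpc. Qed.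

Lemma wedge_conj_form U k : odd k -> has_degree k (Re_form U) -> has_degree k (Im_form U) ->
  U \w conj_form U = (- 2 * 'i) *: cplx_form (Re_form U \w Im_form U).
Proof.
move=> ok dr di; rewrite {1}[U]complex_form_split conj_form_split cplx_form_wedge.
rewrite wedgeDl !wedgeBr !wedgeZl !wedgeZr -!cplx_form_wedge.
rewrite !(wedge_odd_sqr ok) // (wedgeC di dr) -signr_odd oddM ok expr1 scaleN1r.
rewrite cplx_form0 cplx_formN !scaler0 sub0r subr0 scalerN -opprD -scalerDl -scaleNr.
by congr (_ *: _); ring.
Qed.

End ComplexForms.

Lemma int_prod_wedge_sqr (K : numFieldType) n v (a : ext_form K n) :
  has_degree 2 a -> int_prod v (a \w a) = 2 *: (int_prod v a \w a).
Proof.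
move=> da; rewrite int_prod_wedge (parity_degree da) sqrrN expr1n scale1r.
rewrite (wedgeC da (has_degree_int_prod v da)) muln1 sqrrN expr1n scale1r.
by rewrite scaler_nat mulr2n.
Qed.

Lemma wedge_deg2C (K : numFieldType) n k (a b : ext_form K n) :
  has_degree 2 a -> has_degree k b -> b \w a = a \w b.
Proof. by move=> da db; rewrite (wedgeC db da) mulnC exprM sqrrN !expr1n scale1r. Qed.

(** * SU(3)-structures in an adapted frame *)

Section AdaptedFrames.
Variable R : realType.
Implicit Types (a b m : ext_form R 7) (X : 'rV[R]_7).

(** A frame P (with dual coordinates x0, ..., x6) in which an SU(3)-structure
    (w, re + i im) of norm h, transverse to xi, and a one-form e with e(xi) = 1
    take their standard form. *)
Definition adapted_frame (xi : 'rV[R]_7) (e w re im : ext_form R 7) (h : R)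
    (P : 'M[R]_7) :=
  [/\ P \in unitmx /\ 0 < h, row 0 P = h^-1 *: xi, pull_form P e = h^-1 *: std_e R
    & [/\ pull_form P w = std_w R, pull_form P re = h *: std_re R
        & pull_form P im = h *: std_im R]].

Variables (xi : 'rV[R]_7) (e w re im : ext_form R 7) (h : R) (P : 'M[R]_7).
Hypothesis AF : adapted_frame xi e w re im h P.

Let uP : P \in unitmx. Proof. by case: AF => -[]. Qed.
Let h_gt0 : 0 < h. Proof. by case: AF => -[]. Qed.
Let h0 : h != 0. Proof. exact: lt0r_neq0. Qed.
Let ePxi : row 0 P = h^-1 *: xi. Proof. by case: AF. Qed.
Let ePe : pull_form P e = h^-1 *: std_e R. Proof. by case: AF. Qed.
Let ePw : pull_form P w = std_w R. Proof. by case: AF => _ _ _ []. Qed.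
Let ePre : pull_form P re = h *: std_re R. Proof. by case: AF => _ _ _ []. Qed.
Let ePim : pull_form P im = h *: std_im R. Proof. by case: AF => _ _ _ []. Qed.

Local Notation phi := (h^-1 *: re + h *: (e \w w)).

Lemma frame_phi : pull_form P phi = std_phi R.
Proof.
rewrite linearD !linearZ /= pull_form_wedge ePre ePe ePw wedgeZl !scalerA.
by rewrite mulVf // mulfV // !scale1r.
Qed.

Lemma frame_det_neq0 : \det (invmx P) != 0.
Proof. by rewrite -unitfE -unitmxE unitmx_inv. Qed.

Lemma frame_pull_inv a b : pull_form P a = b -> pull_form (invmx P) b = a.
Proof. by move=> <-; rewrite pull_form_comp mulVmx // pull_form1. Qed.

Lemma frame_degree k a : has_degree k (pull_form P a) -> has_degree k a.
Proof. by move=> da; rewrite -(frame_pull_inv (erefl (pull_form P a))); apply: has_degree_pull_form. Qed.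

Lemma frame_degree_e : has_degree 1 e.
Proof. by apply: frame_degree; rewrite ePe; apply/has_degreeZ/has_degree_dx. Qed.
Lemma frame_degree_w : has_degree 2 w.
Proof. by apply: frame_degree; rewrite ePw; apply: has_degree_std_w. Qed.
Lemma frame_degree_re : has_degree 3 re.
Proof. by apply: frame_degree; rewrite ePre; apply/has_degreeZ/has_degree_std_re. Qed.
Lemma frame_degree_im : has_degree 3 im.
Proof. by apply: frame_degree; rewrite ePim; apply/has_degreeZ/has_degree_std_im. Qed.

Lemma frame_g2_positive : g2_positive phi.
Proof.
split; last by exists (invmx P *m (invmx P)^T), (\det (invmx P)); exact: (g2_data_frame uP frame_phi).
apply: has_degreeD; apply: has_degreeZ; first exact: frame_degree_re.
exact: (has_degree_wedge frame_degree_e frame_degree_w).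
Qed.

Lemma frame_w_re : w \w re = 0.
Proof.
by apply: (pull_form_inj uP); rewrite pull_form_wedge ePw ePre wedgeZr std_w_re scaler0 linear0.
Qed.

Lemma frame_w_im : w \w im = 0.
Proof.
by apply: (pull_form_inj uP); rewrite pull_form_wedge ePw ePim wedgeZr std_w_im scaler0 linear0.
Qed.

Lemma frame_w3 : w \w w \w w = (3 / 2 * h ^- 2) *: (re \w im).
Proof.
apply: (pull_form_inj uP); rewrite linearZ /= !pull_form_wedge ePw ePre ePim.
rewrite wedgeZl wedgeZr std_w3 std_re_im !scalerA; congr (_ *: _).
by field; rewrite h0.
Qed.

Lemma frame_e_re_im_neq0 : e \w re \w im != 0.
Proof.
apply/negP => /eqP/(congr1 (pull_form P)).
rewrite !pull_form_wedge ePe ePre ePim !wedgeZl !wedgeZr std_re_im wedgeZr std_e_vol6.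
rewrite linear0 !scalerA scale_form_top => /ffunP/(_ finset.setT).
rewrite form_topE eqxx zero_formE => /eqP; rewrite !mulf_eq0 invr_eq0 (negPf h0) pnatr_eq0.
by rewrite oner_eq0.
Qed.

Lemma frame_e_w3_top : h * (e \w w \w w \w w) finset.setT = 6 * \det (invmx P).
Proof.
have : pull_form P (e \w w \w w \w w) = form_top (6 * h^-1).
  rewrite !pull_form_wedge ePe ePw std_w3 wedgeZl wedgeZr std_e_vol6 !scale_form_top.
  by congr form_top; ring.
move/frame_pull_inv; rewrite pull_form_top => <-; rewrite form_topE eqxx.
by field; rewrite h0.
Qed.

(** With the volume factor eliminated by frame_e_w3_top, the metric is a rational
    function of h and of the coefficients of the forms. *)
Lemma frame_g2_metric i j :
  g2_metric phi i j = (int_prod (evec i) phi \w int_prod (evec j) phi \w phi) finset.setT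
     / (h * (e \w w \w w \w w) finset.setT).
Proof.
have gd := g2_data_frame uP frame_phi.
rewrite frame_e_w3_top /g2_metric (g2_pairE gd) /=; case: gd => _ _ ->.
rewrite form_topE eqxx bil_evec; field.
exact: frame_det_neq0.
Qed.

Lemma frame_g2_unitmx : g2_metric phi \in unitmx.
Proof.
by rewrite /g2_metric (g2_pairE (g2_data_frame uP frame_phi)) unitmx_mul unitmx_tr unitmx_inv uP.
Qed.

Let scalar_identity (K : numFieldType) (x y : K) :
  x / 8 * y * (- 2 * x) = - (x ^+ 2) * y / 4.
Proof. by field. Qed.

Let scalar_identity' (K : numFieldType) (z : K) : 6^-1 * (3 * 2^-1 * z) = z * 4^-1.
Proof. by field. Qed.

(** Uniqueness of the norm: the top form e /\ re /\ im does not vanish. *)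
Lemma frame_ups_norm (U : ext_form R[i] 7) : Re_form U = re -> Im_form U = im ->
  ups_norm w U = h.
Proof.
move=> eRe eIm; have ups s : 0 < s -> (3`!%:R)^-1 *: cplx_form (wedge3 w) =
    ('i / 8 * (s ^- 2)%:C) *: (U \w conj_form U) <-> s = h.
  move=> s_gt0; have s0 : s != 0 by exact: lt0r_neq0.
  rewrite (wedge_conj_form (k := 3)) ?eRe ?eIm //; [|exact: frame_degree_re|exact: frame_degree_im].
  rewrite /wedge3 frame_w3 scalerA cplx_formZ scalerA.
  have -> : 'i / 8 * (s ^- 2)%:C * (- 2 * 'i) = (s ^- 2 / 4)%:C :> R[i].
    have c4 : (4^-1)%:C = 4^-1 :> R[i] by rewrite fmorphV rmorph_nat.
    rewrite [RHS]rmorphM /= c4.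
    transitivity (- ('i ^+ 2) * (s ^- 2)%:C / 4 : R[i]); first exact: scalar_identity.
    by rewrite sqr_i opprK mul1r.
  have -> : 3`!%:R^-1 * (3 / 2 * h ^- 2)%:C = (h ^- 2 / 4)%:C :> R[i].
    have c2 : (2^-1)%:C = 2^-1 :> R[i] by rewrite fmorphV rmorph_nat.
    have c4 : (4^-1)%:C = 4^-1 :> R[i] by rewrite fmorphV rmorph_nat.
    rewrite [RHS]rmorphM /= [X in _ * X = _]rmorphM /= [X in _ * (X * _) = _]rmorphM /= c2 c4 rmorph_nat.
    rewrite -[(3`!)%:R]/(6 : R[i]); exact: scalar_identity'.
  rewrite -!cplx_formZ; split => [/cplx_form_inj|->//].
  move=> /(congr1 (fun a => e \w a)); rewrite !wedgeZr => /eqP.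
  rewrite -subr_eq0 -scalerBl scaler_eq0 (negPf frame_e_re_im_neq0) orbF -mulrBl mulf_eq0.
  rewrite invr_eq0 pnatr_eq0 orbF subr_eq0 => /eqP/invr_inj/eqP.
  by rewrite eqrXn2 ?ltW // => /eqP.
rewrite /ups_norm; case: xgetP => [s _ [s_gt0 /(ups s s_gt0)]//|/(_ h)].
by case; split=> //; apply/(ups h h_gt0).
Qed.

Lemma frame_int_prod_e : int_prod xi e = form0 1.
Proof.
apply: (pull_form_inj uP); rewrite pull_form0.
have exi : xi = h *: row 0 P by rewrite ePxi scalerA mulfV // scale1r.
rewrite exi int_prodZl linearZ /= -int_prod_pull_form_row ePe linearZ /= int_prod_dx.
by rewrite !scale_form0 mxE !eqxx mulr1 mulfV.
Qed.

Lemma frame_hodge b : hodge phi b = pull_form (invmx P) (euclid_star (pull_form P b)).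
Proof. exact: (hodge_frame _ uP frame_phi). Qed.

Lemma frame_pull_hodge b : pull_form P (hodge phi b) = euclid_star (pull_form P b).
Proof. by rewrite frame_hodge pull_form_comp mulmxV // pull_form1. Qed.

Lemma frame_star_phi : hodge phi phi = 2^-1 *: (w \w w) - e \w im.
Proof.
apply: (pull_form_inj uP); rewrite frame_pull_hodge frame_phi linearD /= std_star_re std_star_e_w.
rewrite linearB linearZ /= !pull_form_wedge ePw ePe ePim wedgeZl wedgeZr scalerA mulVf //.
by rewrite scale1r addrC.
Qed.

Lemma frame_star_psi : hodge phi (2^-1 *: (w \w w) - e \w im) = phi.
Proof.
apply: (pull_form_inj uP); rewrite frame_pull_hodge frame_phi linearB linearZ /=.
rewrite !pull_form_wedge ePw ePe ePim wedgeZl wedgeZr scalerA mulVf // scale1r.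
rewrite linearB linearZ /= std_star_w2 std_star_e_im scalerA mulVf ?pnatr_eq0 // scale1r.
by rewrite opprK addrC.
Qed.

Section Gradient.
Variable th : ext_form R 7.
Hypotheses (th1 : has_degree 1 th) (th_xi : int_prod xi th = 0).

Local Notation X := ((\row_i th (finset.set1 i)) *m invmx (g2_metric phi)).
Let Y := X *m invmx P.

Let pull_th : pull_form P th = covec Y.
Proof.
rewrite {1}(covecE th1) pull_form_covec /Y; congr covec.
rewrite /g2_metric (g2_pairE (g2_data_frame uP frame_phi)) /=.
have uA : invmx P *m (invmx P)^T \in unitmx.
  by rewrite unitmx_mul unitmx_tr unitmx_inv uP.
have -> : invmx (invmx P *m (invmx P)^T) = P^T *m P.
  rewrite -[RHS](mulKmx uA) (_ : _ *m (P^T *m P) = 1%:M) ?mulmx1 //.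
  rewrite trmx_inv mulmxA -[_ *m P^T]mulmxA mulVmx ?unitmx_tr // mulmx1.
  by rewrite mulVmx.
by rewrite mulmxA mulmxK.
Qed.

Let Y0 : Y 0 0 = 0.
Proof.
have : int_prod (evec 0) (pull_form P th) = 0.
  by rewrite int_prod_pull_form_row ePxi int_prodZl th_xi scaler0 linear0.
rewrite pull_th int_prod_covec => /ffunP/(_ finset.set0).
by rewrite form0E eqxx zero_formE -rowE !mxE.
Qed.

Let pull_X a : pull_form P (int_prod X a) = int_prod Y (pull_form P a).
Proof. by rewrite int_prod_pull_form /Y mulmxKV. Qed.

(** Both sides are linear in th, and the identity is checked on coordinate
    one-forms. *)
Lemma frame_grad_w_im : int_prod X w \w im = th \w re.
Proof.
apply: (pull_form_inj uP); rewrite !pull_form_wedge pull_X ePw ePim ePre pull_th !wedgeZr.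
by rewrite std_contract_w_im.
Qed.

Let pull_dphi :
  pull_form P (- (h^-1 *: (th \w re)) + h *: (th \w e \w w) + h *: (w \w w)) =
  - (covec Y \w std_re R) + covec Y \w std_e R \w std_w R + h *: (std_w R \w std_w R).
Proof.
rewrite !(linearD, linearN, linearZ) /= !pull_form_wedge pull_th ePre ePe ePw.
by rewrite !(wedgeZl, wedgeZr, scalerN) !scalerA mulVf // mulfV // !scale1r.
Qed.

(** The star of d phi: one-forms wedge in as their gradients contract out. *)
Lemma frame_star_dphi :
  hodge phi (- (h^-1 *: (th \w re)) + h *: (th \w e \w w) + h *: (w \w w)) =
  e \w int_prod X im - int_prod X w \w w + (2 * h ^+ 2) *: (e \w w).
Proof.
apply: (pull_form_inj uP); rewrite frame_pull_hodge !(linearD, linearN, linearZ) /=.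
rewrite !pull_form_wedge !pull_X pull_th ePre ePe ePw ePim.
rewrite !(wedgeZl, wedgeZr, linearZ) /= !scalerA mulVf // mulfV // !scale1r.
rewrite !euclid_star_covec_wedge (parity_degree (has_degree_std_re _)).
rewrite (parity_degree (has_degree_wedge (has_degree_dx R ord0) (has_degree_std_w _))).
rewrite !linearZ /= std_star_re std_star_e_w std_star_w2 !linearN linearZ /=.
rewrite !int_prod_wedge int_prod_dx Y0 raddf0 wedge0l add0r parity_dx wedgeNl.
have -> : int_prod Y (2^-1 *: (std_w R \w std_w R)) = int_prod Y (std_w R) \w std_w R.
  rewrite linearZ /= (int_prod_wedge_sqr _ (has_degree_std_w R)).
  by rewrite scalerA mulVf ?pnatr_eq0 // scale1r.
have -> : (-1) ^+ 3 = -1 :> R by rewrite !exprS expr0; ring.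
rewrite !scaleN1r !opprK scalerA; congr (_ + _ *: _).
by field; rewrite h0.
Qed.

(** All terms that contain th vanish for reasons of type or of degree, so that
    the torsion depends on h alone. *)
Lemma frame_tau0 :
  hodge phi (phi \w (- (h^-1 *: (th \w re)) + h *: (th \w e \w w) + h *: (w \w w)))
    finset.set0 = 6 * h.
Proof.
rewrite frame_hodge pull_form_coef0 pull_form_wedge frame_phi pull_dphi.
 have dY := has_degree_covec Y; have de := has_degree_dx R (ord0 : 'I_7).
have dre := has_degree_std_re R; have dw := has_degree_std_w R.
rewrite /std_phi wedgeDl !wedgeDr !wedgeNr !wedgeZr.
have re_re : std_re R \w covec Y \w std_re R = 0.
  rewrite -wedgeA (wedgeC dre dY) wedgeZl wedgeA (wedge_odd_sqr (k := 3)) // wedge0r.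
  by rewrite scaler0.
have re_w : std_re R \w std_w R = 0 by rewrite (wedge_deg2C dw dre) std_w_re.
have re_ew : std_re R \w covec Y \w std_e R \w std_w R = 0.
  rewrite -[covec Y \w _]wedgeA (wedge_deg2C dw (has_degree_wedge dY de)) -wedgeA.
  by rewrite re_w wedge0l.
have ew_re : (std_e R \w std_w R) \w covec Y \w std_re R = 0.
  by rewrite wedgeA -[std_w R \w _]wedgeA -(wedge_deg2C dw dY) wedgeA std_w_re !wedge0r.
have ew_ew : (std_e R \w std_w R) \w covec Y \w std_e R \w std_w R = 0.
  rewrite (wedgeC dY (has_degree_wedge de dw)) wedgeZr -wedgeA.
  by rewrite (wedge_odd_sqr (k := 3)) ?wedge0l ?scaler0 //; exact: has_degree_wedge de dw.
rewrite re_re re_ew -[std_re R \w _ \w _]wedgeA re_w wedge0l ew_re ew_ew.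
rewrite !(scaler0, oppr0, addr0, add0r) wedgeA std_w3 wedgeZr std_e_vol6 !scale_form_top.
rewrite euclid_star_form_top form0E eqxx; ring.
Qed.

End Gradient.

Let pull_horizontal m : has_degree 1 m -> int_prod xi m = 0 ->
  exists2 Z, pull_form P m = covec Z & Z 0 0 = 0.
Proof.
move=> m1 m_xi; have dm := has_degree_pull_form P m1.
exists (\row_i pull_form P m (finset.set1 i)); first exact: covecE.
have : int_prod (evec 0) (pull_form P m) = 0.
  by rewrite int_prod_pull_form_row ePxi int_prodZl m_xi scaler0 linear0.
rewrite {1}(covecE dm) int_prod_covec => /ffunP/(_ finset.set0).
by rewrite form0E eqxx zero_formE -rowE mxE [X in X = 0]mxE.
Qed.

(** In the frame, im and w^2 have monomials dual to the horizontal one-forms. *)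
Lemma frame_im_inj m : has_degree 1 m -> int_prod xi m = 0 -> m \w im = 0 -> m = 0.
Proof.
move=> m1 m_xi m_im; apply: (pull_form_inj uP); rewrite linear0.
have [Z eZ Z0] := pull_horizontal m1 m_xi; rewrite eZ (std_im_inj Z0) ?linear0 //.
apply: (scalerI h0); rewrite scaler0 -wedgeZr -ePim -eZ -pull_form_wedge m_im.
by rewrite linear0.
Qed.

Lemma frame_w2_inj m : has_degree 1 m -> int_prod xi m = 0 -> m \w w \w w = 0 -> m = 0.
Proof.
move=> m1 m_xi m_w; apply: (pull_form_inj uP); rewrite linear0.
have [Z eZ Z0] := pull_horizontal m1 m_xi; rewrite eZ (std_w2_inj Z0) ?linear0 //.
by rewrite -ePw -eZ -!pull_form_wedge m_w linear0.
Qed.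

End AdaptedFrames.

(** * Existence of adapted frames *)

Section FrameTools.
Local Close Scope classical_set_scope.
Local Open Scope set_scope.
Local Open Scope ring_scope.
Variable K : numFieldType.

Lemma int_prod_coef0 n v (m : ext_form K n) :
  int_prod v m finset.set0 = \sum_i v 0 i * m [set i].
Proof.
rewrite int_prodE; apply: eq_big => [i|i _]; first by rewrite inE.
by rewrite shuffle_sign0r mulr1 finset.setU0.
Qed.

Lemma common_zero n (ms : seq (ext_form K n)) : (size ms < n)%N ->
  exists2 v : 'rV[K]_n, v != 0 & forall m, m \in ms -> int_prod v m finset.set0 = 0.
Proof.
move=> lt_ms; pose A := \matrix_(i < n, j < size ms) (nth 0 ms j) [set i].
exists (nz_row (kermx A)).
  rewrite nz_row_eq0 -mxrank_eq0 mxrank_ker subn_eq0 -ltnNge.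
  exact: leq_ltn_trans (rank_leq_col A) lt_ms.
have /sub_kermxP vA := nz_row_sub (kermx A).
move=> m /(nthP 0)[j ltj <-]; have /rowP/(_ (Ordinal ltj)) := vA.
rewrite !mxE int_prod_coef0 => {2}<-; apply: eq_bigr => i _; by rewrite mxE.
Qed.

Lemma eq_form_deg2 n (a b : ext_form K n) : has_degree 2 a -> has_degree 2 b ->
  (forall i j, int_prod (evec j) (int_prod (evec i) a) finset.set0 =
               int_prod (evec j) (int_prod (evec i) b) finset.set0) -> a = b.
Proof.
move=> da db ab; apply: form_eq_contract => [|i]; first by rewrite da ?cards0 // db ?cards0.
have dai := has_degree_int_prod (evec i) da; have dbi := has_degree_int_prod (evec i) db.
apply: form_eq_contract => [|j]; first by rewrite dai ?cards0 // dbi ?cards0.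
have daij := has_degree_int_prod (evec j) dai; have dbij := has_degree_int_prod (evec j) dbi.
apply: form_eq_contract => [|k]; first exact: ab.
by rewrite (int_prod_degree0 _ daij) (int_prod_degree0 _ dbij).
Qed.

(** Adding multiples of the vector evec i0 to the frame does not change a form
    that this vector annihilates. *)
Lemma pull_form_shear n (L : 'M[K]_n) (i0 : 'I_n) (a : ext_form K n) (c : 'I_n -> K) :
  (forall i, row i L = (if i == i0 then 0 else evec i) + c i *: evec i0) ->
  int_prod (evec i0) a = 0 -> pull_form L a = a.
Proof.
move=> rowL a0; apply/ffunP => S; move: S a a0; apply: form_contract_ind => [|i S iS IH] a a0.
  by rewrite pull_form_coef0.
rewrite !(form_coef_int_prod _ iS) int_prod_pull_form_row rowL int_prodDl int_prodZl a0.
rewrite scaler0 addr0; case: eqP => [->|_]; first by rewrite a0 int_prod0l linear0.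
by congr (_ * _); apply: IH; rewrite int_prod_anticomm a0 linear0 oppr0.
Qed.

Lemma map_form_bit_val (K' : numFieldType) (f : {rmorphism K -> K'}) n p :
  map_form f (bit_val n K p) = bit_val n K' p.
Proof.
apply/ffunP => S; rewrite ffunE !sum_form_E rmorph_sum; apply: eq_bigr => t _.
rewrite !scale_formE !monomialE rmorphM rmorph_int.
by case: ifP; rewrite ?rmorph1 ?rmorph0.
Qed.

Local Notation bits s := (bits_of_seq 7 s%N).
Local Notation dxn i := (bit_val 7 K [:: (1%R : int, bits [:: i])]).

(** The standard volume form is dz1 /\ dz2 /\ dz3. *)
Lemma std_ups_decomposable (I : K) : I * I = -1 ->
  (dxn 1 + I *: dxn 2) \w (dxn 3 + I *: dxn 4) \w (dxn 5 + I *: dxn 6) =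
  std_re K + I *: std_im K.
Proof.
move=> II; have tE i j k : bit_eq 7 (bit_wedge 7 [:: (1%R, bits [:: i])]
    (bit_wedge 7 [:: (1%R, bits [:: j])] [:: (1%R, bits [:: k])])) [:: (1%R, bits [:: i; j; k])] ->
    dxn i \w dxn j \w dxn k = monomial K (set_of_bits 7 (bits [:: i; j; k])).
  move=> /bit_eqP -/(_ K); rewrite !bit_val_wedge => ->.
  by rewrite /bit_val big_seq1 scale1r.
have expand (a b c d e f : ext_form K 7) : (a + I *: b) \w (c + I *: d) \w (e + I *: f) =
    a \w c \w e - a \w d \w f - b \w c \w f - b \w d \w e +
    I *: (a \w c \w f + a \w d \w e + b \w c \w e - b \w d \w f).
  rewrite !(wedgeDl, wedgeDr, wedgeZl, wedgeZr) !scalerA II.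
  apply/ffunP => S; rewrite !(add_formE, scale_formE, opp_formE) !mulrDr !mulrA II.
  ring.
have gen (d : nat -> ext_form K 7) :
    (forall i j k, bit_eq 7 (bit_wedge 7 [:: (1%R, bits [:: i])]
      (bit_wedge 7 [:: (1%R, bits [:: j])] [:: (1%R, bits [:: k])])) [:: (1%R, bits [:: i; j; k])] ->
      d i \w d j \w d k = monomial K (set_of_bits 7 (bits [:: i; j; k]))) ->
    (d 1 + I *: d 2) \w (d 3 + I *: d 4) \w (d 5 + I *: d 6) = std_re K + I *: std_im K.
  move=> dE; pose L := [:: (1, 3, 5); (1, 4, 6); (2, 3, 6); (2, 4, 5);
    (1, 3, 6); (1, 4, 5); (2, 3, 5); (2, 4, 6)]%N.
  have /allP chk : all (fun t => bit_eq 7 (bit_wedge 7 [:: (1%R, bits [:: t.1.1])]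
      (bit_wedge 7 [:: (1%R, bits [:: t.1.2])] [:: (1%R, bits [:: t.2])]))
      [:: (1%R, bits [:: t.1.1; t.1.2; t.2])]) L by vm_compute.
  have {}dE i j k (ijk : (i, j, k) \in L) := dE i j k (chk (i, j, k) ijk).
  rewrite expand !dE //.
  rewrite /std_re /std_im /std_re_bits /std_im_bits /bit_val !big_cons !big_nil /=.
  by apply/ffunP => S; rewrite !(add_formE, opp_formE, scale_formE, zero_formE); ring.
exact: (gen (fun i => dxn i)).
Qed.

Lemma dx_mono123 : dxn 1 \w dxn 2 \w dxn 3 =
  monomial K [set i : 'I_7 | (0 < i < 4)%N].
Proof.
transitivity (bit_val 7 K [:: (1, bits [:: 1; 2; 3])]).
  by rewrite -!bit_val_wedge; apply: bit_eqP; vm_compute.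
rewrite /bit_val big_seq1 scale1r bits_of_seqE; congr monomial.
by apply/setP => i; rewrite !inE; case: i => -[|[|[|[|i]]]].
Qed.

(** The coordinates x of R x C^3 in terms of the coordinates t, z, zbar. *)
Definition real_from_complex (I : K) : 'M[K]_7 := \matrix_(i < 7, j < 7)
  (if (i == 0%N :> nat) then (j == 0%N :> nat)%:R else
   let k := i.-1./2 in
   if odd i then 2^-1 * ((j == k.+1 :> nat)%:R + (j == k + 4 :> nat)%N%:R)
   else I / 2 * ((j == k.+1 :> nat)%:R - (j == k + 4 :> nat)%N%:R)).

Lemma dxnE (i : nat) : (i < 7)%N -> dxn i = dx (inord i).
Proof. by move=> i7; rewrite -bit_val_dx /= inordK. Qed.

Lemma pull_real_from_complex I k : (k < 3)%N ->
  pull_form (real_from_complex I) (dxn k.+1) = 2^-1 *: (dxn k.*2.+1 + I *: dxn k.*2.+2).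
Proof.
move=> k3; rewrite !dxnE; try lia.
have d1 : has_degree 1 (pull_form (real_from_complex I) (dx (inord k.+1))).
  exact/has_degree_pull_form/has_degree_dx.
have d2 : has_degree 1 (2^-1 *: (dx (inord k.*2.+1) + I *: dx (inord k.*2.+2)) : ext_form K 7).
  by apply/has_degreeZ/has_degreeD; [|apply: has_degreeZ]; exact: has_degree_dx.
apply: form_eq_contract => [|i]; first by rewrite d1 ?cards0 // d2 ?cards0.
rewrite int_prod_pull_form_row int_prod_dx pull_form0 linearZ /= linearD linearZ /= !int_prod_dx.
rewrite !scale_form0 -raddfD scale_form0; congr form0.
have evecE m (j : 'I_7) : (m < 7)%N -> (evec j : 'rV[K]_7) 0 (inord m) = (m == j)%:R.
  by move=> m7; rewrite mxE eqxx -val_eqE /= inordK.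
rewrite 2!mxE !evecE; try lia.
rewrite inordK; try lia.
case: k k3 {d1 d2} => [|[|[|k]]] // _;
  case: i => -[|[|[|[|[|[|[|i]]]]]]] //= _;
  rewrite ?(mulr1n, mulr0n, addr0, add0r, subr0, oppr0, mulr0, mulr1) //;
  by rewrite mulrC.
Qed.

Lemma pull_monomial123 I : I * I = -1 ->
  pull_form (real_from_complex I) (monomial K [set i : 'I_7 | (0 < i < 4)%N]) =
  8^-1 *: (std_re K + I *: std_im K).
Proof.
move=> II; rewrite -(std_ups_decomposable II) -dx_mono123 !pull_form_wedge.
rewrite (pull_real_from_complex I (isT : (0 < 3)%N)) (pull_real_from_complex I (isT : (1 < 3)%N)).
rewrite (pull_real_from_complex I (isT : (2 < 3)%N)) -[0.*2.+1]/1%N -[0.*2.+2]/2%N.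
rewrite -[1.*2.+1]/3%N -[1.*2.+2]/4%N -[2.*2.+1]/5%N -[2.*2.+2]/6%N.
set a := _ + _; set b := _ + _; set c := _ + _.
rewrite !(wedgeZl, wedgeZr) !scalerA; congr (_ *: _); by field.
Qed.

Lemma pull_form_contract_scale n (A B : 'M[K]_n) k s v (a : ext_form K n) (S : {set 'I_n}) :
  pull_form A (int_prod v a) S = pull_form B (int_prod v a) S ->
  s * pull_form A (int_prod (k *: v) a) S = k * (s * pull_form B (int_prod v a) S).
Proof. by move=> <-; rewrite int_prodZl linearZ scale_formE mulrCA. Qed.

Lemma eval_form2 n (a : ext_form K n) u v u' v' k l :
  eval_form a [:: u + k *: u'; v + l *: v'] = eval_form a [:: u; v] +
    l * eval_form a [:: u; v'] + k * eval_form a [:: u'; v] + k * l * eval_form a [:: u'; v'].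
Proof.
rewrite !eval_form_cons !eval_form_nil !(int_prodDl, int_prodZl, linearD, linearZ) /=.
by rewrite !(add_formE, scale_formE); ring.
Qed.

End FrameTools.

Lemma half_sum_mx (K : numFieldType) n (I : K) (x y : 'rV[K]_n) :
  2^-1 *: (x - I *: y) + 2^-1 *: (x + I *: y) = x.
Proof. by apply/rowP => j; rewrite !mxE; field. Qed.

Lemma half_diff_mx (K : numFieldType) n (I : K) (x y : 'rV[K]_n) : I * I = -1 ->
  (I / 2) *: (x - I *: y) - (I / 2) *: (x + I *: y) = y.
Proof.
move=> II; apply/rowP => j; rewrite !mxE; transitivity (- (I * I) * y 0 j); first by field.
by rewrite II; ring.
Qed.

Lemma rotate_mx (K : numFieldType) n (I X Y : K) (a b : 'rV[K]_n) : I * I = -1 ->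
  (X *: a + Y *: b) - I *: (X *: b + Y *: - a) = (X + I * Y) *: (a - I *: b).
Proof.
move=> II; apply/rowP => j; rewrite !mxE.
transitivity ((X + I * Y) * a 0 j + (- (I * X) + - (I * I) * Y) * b 0 j); last by ring.
by rewrite II; ring.
Qed.

Section UnitaryFrame.
Local Close Scope classical_set_scope.
Local Open Scope set_scope.
Local Open Scope ring_scope.
Local Open Scope complex_scope.
Variable R : realType.
Variables (xi : 'rV[R]_7) (eta w : ext_form R 7) (U : ext_form R[i] 7) (Phi : 'M[R]_7).

Local Notation eval1 m v := (int_prod v m finset.set0).
Local Notation pair u v := (int_prod v (int_prod u w) finset.set0).
Local Notation cplx_mx A := (map_mx (fun x : R => x%:C) A).

Hypotheses (eta_xi : eval1 eta xi = 1).
Hypothesis Phi2 : forall v, v *m Phi *m Phi = - v + (eval1 eta v) *: xi.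
Hypotheses (w2 : has_degree 2 w) (w_xi : int_prod xi w = 0).
Hypotheses (U3 : has_degree 3 U).
Hypotheses (reU_xi : int_prod xi (Re_form U) = 0) (imU_xi : int_prod xi (Im_form U) = 0).

Let D10 (v : 'rV[R[i]]_7) :=
  eval_form (cplx_form eta) [:: v] = 0 /\ v *m cplx_mx Phi = 'i *: v.
Let D01 (v : 'rV[R[i]]_7) :=
  eval_form (cplx_form eta) [:: v] = 0 /\ v *m cplx_mx Phi = - 'i *: v.
Let type_pq (p q : nat) (a : ext_form R[i] 7) := forall us vs : seq 'rV[R[i]]_7,
  (forall u, u \in us -> D10 u) -> (forall v, v \in vs -> D01 v) ->
  (size us + size vs = p + q)%N -> size us <> p -> eval_form a (us ++ vs) = 0.

Hypothesis w_type : type_pq 1 1 (cplx_form w).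
Hypothesis U_type : type_pq 3 0 U.
Hypothesis w_pos : forall v, eval1 eta v = 0 -> v != 0 -> 0 < pair v (v *m Phi).

(* The components of type (1,0) and (0,1) of 2 v. *)
Let zvec (v : 'rV[R]_7) : 'rV[R[i]]_7 := cplx_mx v - 'i *: cplx_mx (v *m Phi).
Let zbar (v : 'rV[R]_7) : 'rV[R[i]]_7 := cplx_mx v + 'i *: cplx_mx (v *m Phi).

Lemma coef0D (m : ext_form R 7) u v : eval1 m (u + v) = eval1 m u + eval1 m v.
Proof. by rewrite int_prodDl add_formE. Qed.
Lemma coef0Z (m : ext_form R 7) k v : eval1 m (k *: v) = k * eval1 m v.
Proof. by rewrite int_prodZl scale_formE. Qed.

Lemma Phi_xi : xi *m Phi = 0.
Proof.
have x2 : xi *m Phi *m Phi = 0 by rewrite Phi2 eta_xi scale1r addNr.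
have [c e] : exists c, xi *m Phi = c *: xi.
  exists (eval1 eta (xi *m Phi)); have := Phi2 (xi *m Phi); rewrite x2 mul0mx.
  by move/esym/eqP; rewrite addrC subr_eq0 => /eqP.
move: x2; rewrite e -scalemxAl e scalerA => /eqP; rewrite scaler_eq0 mulf_eq0 orbb.
case/orP => [/eqP ->|/eqP x0]; first by rewrite scale0r.
by move: eta_xi; rewrite x0 int_prod0l zero_formE => /esym/eqP; rewrite oner_eq0.
Qed.

Let eta_Phi v : eval1 eta (v *m Phi) = 0.
Proof.
have := Phi2 (v *m Phi); rewrite (Phi2 v) mulmxDl mulNmx -scalemxAl Phi_xi scaler0 addr0.
move=> /(congr1 (fun u => eval1 eta (u + v *m Phi))); rewrite addNr int_prod0l zero_formE.
rewrite addrAC addNr add0r coef0Z eta_xi mulr1 => <- //.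
Qed.

Let Phi2D v : eval1 eta v = 0 -> v *m Phi *m Phi = - v.
Proof. by move=> v0; rewrite Phi2 v0 scale0r addr0. Qed.

Let cplx_coef0 (m : ext_form R 7) v : eval_form (cplx_form m) [:: cplx_mx v] = (eval1 m v)%:C.
Proof. exact: (map_form_eval (real_complex R) [:: v] m). Qed.

Let zvecD10 v : eval1 eta v = 0 -> D10 (zvec v).
Proof.
move=> v0; split.
  rewrite /zvec -scaleNr eval_form_cons int_prodDl int_prodZl eval_formD eval_formZ -!eval_form_cons.
  by rewrite !cplx_coef0 eta_Phi v0 mulr0 addr0.
rewrite /zvec mulmxBl -scalemxAl -!map_mxM /= Phi2D // scalerBr scalerA -expr2 sqr_i map_mxN.
by rewrite scaleN1r scalerN !opprK addrC.
Qed.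

Let zbarD01 v : eval1 eta v = 0 -> D01 (zbar v).
Proof.
move=> v0; split.
  rewrite /zbar eval_form_cons int_prodDl int_prodZl eval_formD eval_formZ -!eval_form_cons.
  by rewrite !cplx_coef0 eta_Phi v0 mulr0 addr0.
rewrite /zbar mulmxDl -scalemxAl -!map_mxM /= Phi2D // scalerDr scalerA mulNr -expr2 sqr_i map_mxN.
by rewrite opprK scale1r scalerN scaleNr addrC.
Qed.

Let pairDl u u' v : pair (u + u') v = pair u v + pair u' v.
Proof. by rewrite int_prodDl linearD add_formE. Qed.
Let pairZl k u v : pair (k *: u) v = k * pair u v.
Proof. by rewrite int_prodZl linearZ scale_formE. Qed.
Let pairC u v : pair u v = - pair v u.
Proof. by rewrite int_prod_anticomm opp_formE. Qed.
Let pair_xi v : pair xi v = 0.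
Proof. by rewrite w_xi linear0 zero_formE. Qed.

(* The real part of w(z u, z v) = 0, for z u and z v of type (1,0). *)
Let pair_Phi u v : eval1 eta u = 0 -> eval1 eta v = 0 -> pair (u *m Phi) (v *m Phi) = pair u v.
Proof.
move=> u0 v0; have := w_type (us := [:: zvec u; zvec v]) (vs := [::]).
have zz z : z \in [:: zvec u; zvec v] -> D10 z.
  by rewrite !inE => /orP[/eqP ->|/eqP ->]; apply: zvecD10.
move=> /(_ zz) e; have {e} : eval_form (cplx_form w) [:: zvec u; zvec v] = 0 by exact: e.
have cpair x y : eval_form (cplx_form w) [:: cplx_mx x; cplx_mx y] = (pair x y)%:C.
  exact: (map_form_eval (real_complex R) [:: x; y] w).
rewrite /zvec -!scaleNr eval_form2 !cpair.
move=> /eqP; rewrite eq_complex => /andP[/eqP re0 _]; move: re0; simpc => /=.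
move/eqP; rewrite subr_eq0 => /eqP ->.
by [].
Qed.

Let pair_Phil u v : eval1 eta u = 0 -> eval1 eta v = 0 -> pair (u *m Phi) v = - pair u (v *m Phi).
Proof.
move=> u0 v0; rewrite -(pair_Phi u0 (eta_Phi v)) Phi2D //.
by rewrite -(scaleN1r v) int_prodZl scale_formE mulN1r opprK.
Qed.

Let pairZr k u v : pair u (k *: v) = k * pair u v.
Proof. by rewrite int_prodZl scale_formE. Qed.
Let pairDr u v v' : pair u (v + v') = pair u v + pair u v'.
Proof. by rewrite int_prodDl add_formE. Qed.

(** Hermitian orthonormality, for the metric w(., Phi .), of three transverse
    vectors. *)
Definition unitary (a : nat -> 'rV[R]_7) := forall k l, (k < 3)%N -> (l < 3)%N ->
  [/\ eval1 eta (a k) = 0, pair (a k) (a l) = 0 & pair (a k) (a l *m Phi) = (k == l)%:R].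

Let normalize v : eval1 eta v = 0 -> v != 0 ->
  exists k, pair (k *: v) (k *: v *m Phi) = 1.
Proof.
move=> v0 vn; have p0 := w_pos v0 vn; exists (Num.sqrt (pair v (v *m Phi)))^-1.
rewrite -scalemxAl pairZl pairZr mulrA -expr2 exprVn sqr_sqrtr ?ltW // mulVf //.
exact: lt0r_neq0.
Qed.

(* Orthogonality to s and transversality are at most 5 linear conditions
   in dimension 7. *)
Let next_unitary (s : seq 'rV[R]_7) : (size s < 3)%N ->
  (forall u, u \in s -> eval1 eta u = 0) ->
  exists v, [/\ eval1 eta v = 0, pair v (v *m Phi) = 1 &
    forall u, u \in s -> pair u v = 0 /\ pair u (v *m Phi) = 0].
Proof.
move=> s3 seta; pose ms := eta :: [seq int_prod u w | u <- s] ++ [seq int_prod (u *m Phi) w | u <- s].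
have [|v vn vms] := @common_zero R 7 ms.
  by rewrite /= size_cat !size_map; move: (size s) s3 => [|[|[|]]].
have v0 : eval1 eta v = 0 by apply: vms; rewrite inE eqxx.
have [k k1] := normalize v0 vn; exists (k *: v); split=> //.
  by rewrite coef0Z v0 mulr0.
move=> u us; have uv : pair u v = 0.
  apply: vms; rewrite inE mem_cat; apply/orP; right; apply/orP; left.
  exact: (map_f (fun u => int_prod u w)).
have uPv : pair (u *m Phi) v = 0.
  apply: vms; rewrite inE mem_cat; apply/orP; right; apply/orP; right.
  exact: (map_f (fun u => int_prod (u *m Phi) w)).
rewrite pairZr uv mulr0 -scalemxAl pairZr; split=> //.
by move: uPv; rewrite pair_Phil ?(seta u us) // => /eqP; rewrite oppr_eq0 => /eqP ->; rewrite mulr0.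
Qed.

Let exists_unitary : exists a, unitary a.
Proof.
have [|//|a0 [e0 n0 _]] := @next_unitary [::]; first by [].
have [|u|a1 [e1 n1 o1]] := @next_unitary [:: a0]; [by []|by rewrite inE => /eqP ->|].
have [|u|a2 [e2 n2 o2]] := @next_unitary [:: a0; a1]; first by [].
  by rewrite !inE => /orP[/eqP ->|/eqP ->].
have [|o10 o10'] := o1 a0; first by rewrite inE.
have [|o20 o20'] := o2 a0; first by rewrite !inE eqxx.
have [|o21 o21'] := o2 a1; first by rewrite !inE eqxx orbT.
have alt u : pair u u = 0 by rewrite int_prod_sqr zero_formE.
have sym u v : eval1 eta u = 0 -> eval1 eta v = 0 -> pair u (v *m Phi) = 0 -> pair v (u *m Phi) = 0.
  by move=> u0 v0 uv; rewrite pairC pair_Phil // opprK.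
exists (fun k => nth 0 [:: a0; a1; a2] k) => -[|[|[|k]]] [|[|[|l]]] // _ _; split=> //=;
  by [rewrite pairC ?o10 ?o20 ?o21 oppr0 | apply: sym].
Qed.

(** A vector in the kernel of P annihilates w^3 in the frame, so it is a multiple of
    the Reeb direction, which P maps to a nonzero vector. *)
Lemma frame_unitmx (P : 'M[R]_7) k : pull_form P w = std_w R -> row 0 P = k *: xi ->
  k != 0 -> P \in unitmx.
Proof.
move=> ePw ePxi k0; rewrite unitmxE unitfE; apply/det0P => -[u u0 uP].
have uw : int_prod u (std_w R) = 0.
  by rewrite -ePw int_prod_pull_form uP int_prod0l linear0.
have vol0 : int_prod u (std_vol6 R) = 0.
  have := congr1 (int_prod u) (std_w3 R); rewrite linearZ !int_prod_wedge uw.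
  rewrite !(wedge0l, wedge0r, addr0) => /esym/eqP; rewrite scaler_eq0 pnatr_eq0 /=.
  by move/eqP.
have utop : int_prod u (form_top 1) = u 0 0 *: std_vol6 R.
  rewrite -std_e_vol6 int_prod_wedge vol0 wedge0r addr0 int_prod_dx.
  by rewrite wedge_form0l.
have e0top : int_prod (evec 0) (form_top 1) = std_vol6 R.
  have vol_e0 : int_prod (evec 0) (std_vol6 R) = 0.
    rewrite -(bit_val_contract R 0) -(bit_val_nil 7 R); apply: bit_eqP; by vm_compute.
  rewrite -std_e_vol6 int_prod_wedge vol_e0 wedge0r addr0 int_prod_dx mxE !eqxx.
  by rewrite wedge_form0l scale1r.
have ue0 : u = u 0 0 *: evec 0.
  apply/eqP; rewrite -subr_eq0; apply: contraT => n0.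
  have := int_prod_top_eq0 n0 (k := 1).
  rewrite -scaleNr int_prodDl int_prodZl utop e0top -scalerDl subrr scale0r.
  by move/(_ erefl)/eqP; rewrite oner_eq0.
move: uP; rewrite ue0 -scalemxAl -rowE ePxi scalerA => uxi.
have := congr1 (fun v => eval1 eta v) uxi; rewrite coef0Z eta_xi mulr1 int_prod0l zero_formE.
move/eqP; rewrite mulf_eq0 (negPf k0) orbF => /eqP u00.
by rewrite ue0 u00 scale0r eqxx in u0.
Qed.

Section FrameOfTriple.
Variable a : nat -> 'rV[R]_7.
Hypothesis ua : unitary a.

Let eta_a k : (k < 3)%N -> eval1 eta (a k) = 0.
Proof. by move=> k3; case: (ua k3 k3). Qed.
Let pair_a k l : (k < 3)%N -> (l < 3)%N -> pair (a k) (a l) = 0.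
Proof. by move=> k3 l3; case: (ua k3 l3). Qed.
Let pair_b k l : (k < 3)%N -> (l < 3)%N -> pair (a k) (a l *m Phi) = (k == l)%:R.
Proof. by move=> k3 l3; case: (ua k3 l3). Qed.

Definition triple_row (i : nat) : 'rV[R]_7 :=
  if i == 0%N then xi else if odd i then a i.-1./2 else a i.-1./2 *m Phi.
Definition triple_frame : 'M[R]_7 := \matrix_(i < 7) triple_row i.

Let half_lt3 (i : 'I_7) : (i.-1./2 < 3)%N.
Proof. by case: i => -[|[|[|[|[|[|[|i]]]]]]]. Qed.

Lemma triple_pull_w : pull_form triple_frame w = std_w R.
Proof.
apply: eq_form_deg2 => [||i j]; [exact: has_degree_pull_form|exact: has_degree_std_w|].
rewrite !int_prod_pull_form_row pull_form_coef0 !rowK.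
pose tab (i j : nat) : int := if (i == 0%N) || (j == 0%N) then 0 else
  if odd i == odd j then 0 else
  if i.-1./2 == j.-1./2 then (if odd i then 1 else -1) else 0.
have -> : int_prod (evec j) (int_prod (evec i) (std_w R)) finset.set0 = (tab i j)%:~R.
  have /allP/(_ (val i)) : all (fun i => all (fun j =>
      bit_eq 7 (bit_contract 7 j (bit_contract 7 i std_w_bits))
        (if tab i j == 0 then [::] else [:: (tab i j, bits_of_seq 7 [::])])) (iota 0 7)) (iota 0 7).
    by vm_compute.
  rewrite mem_iota ltn_ord => /(_ isT) /allP/(_ (val j)).
  rewrite mem_iota ltn_ord => /(_ isT) /bit_eqP -/(_ R).
  rewrite !bit_val_contract => ->; case: eqP => [->|_].
    by rewrite bit_val_nil zero_formE.
  rewrite /bit_val big_seq1 scale_formE monomialE bits_of_seqE.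
  by case: eqP => [_|[]]; rewrite ?mulr1 //; apply/setP => l; rewrite !inE.
rewrite /tab /triple_row; case: (eqVneq (i : nat) 0%N) => [_|i0] /=.
  by rewrite pair_xi.
case: (eqVneq (j : nat) 0%N) => [_|j0] /=; first by rewrite pairC pair_xi oppr0.
have hi := half_lt3 i; have hj := half_lt3 j.
case: (odd i); case: (odd j) => /=.
- exact: pair_a.
- by rewrite pair_b //; case: eqP.
- by rewrite pair_Phil ?eta_a // pair_b //; case: eqP => _; rewrite ?mulrN1z ?oppr0 ?mulr1n.
- by rewrite pair_Phi ?eta_a // pair_a.
Qed.

Lemma triple_unitmx : triple_frame \in unitmx.
Proof.
apply: (frame_unitmx triple_pull_w (k := 1)); last exact: oner_neq0.
by rewrite rowK scale1r.
Qed.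

Definition triple_zrow (i : nat) : 'rV[R[i]]_7 :=
  if i == 0%N then cplx_mx xi else if (i < 4)%N then zvec (a i.-1) else zbar (a (i - 4)).
Definition triple_zframe : 'M[R[i]]_7 := \matrix_(i < 7) triple_zrow i.

Local Notation real_from_z := (real_from_complex ('i : R[i])).

Lemma real_from_zE : real_from_z *m triple_zframe = cplx_mx triple_frame.
Proof.
have re_z v : 2^-1 *: zvec v + 2^-1 *: zbar v = cplx_mx v.
  exact: (half_sum_mx 'i (cplx_mx v) (cplx_mx (v *m Phi))).
have im_z v : ('i / 2) *: zvec v - ('i / 2) *: zbar v = cplx_mx (v *m Phi).
  have ii : 'i * 'i = -1 :> R[i] by rewrite -expr2 sqr_i.
  exact: (half_diff_mx (cplx_mx v) (cplx_mx (v *m Phi)) ii).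
have eq_inord (j : 'I_7) m : (m < 7)%N -> (j == inord m) = (j == m :> nat).
  by move=> m7; rewrite -val_eqE /= inordK.
have evecE m j : (m < 7)%N -> (evec (inord m) : 'rV[R[i]]_7) 0 j = (j == m :> nat)%:R.
  by move=> m7; rewrite mxE eqxx eq_inord.
have zrow m : (m < 7)%N -> evec (inord m) *m triple_zframe = triple_zrow m.
  by move=> m7; rewrite -rowE rowK inordK.
apply/row_matrixP => i; rewrite row_mul -map_row [row i triple_frame]rowK.
have k3 := half_lt3 i; set k := i.-1./2 in k3.
have k1 : (k.+1 < 7)%N by lia.
have k4 : (k + 4 < 7)%N by lia.
rewrite /triple_row; case: (eqVneq (i : nat) 0%N) => i0.
  have -> : row i real_from_z = evec (inord 0).
    by apply/rowP => j; rewrite evecE // 2!mxE i0 eqxx.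
  by rewrite zrow.
have z1 : triple_zrow k.+1 = zvec (a k) by rewrite /triple_zrow /= ltnS k3.
have z4 : triple_zrow (k + 4) = zbar (a k).
  by rewrite /triple_zrow addn_eq0 andbF ltnNge leq_addl /= addnK.
case: ifP => oi.
  have -> : row i real_from_z = 2^-1 *: (evec (inord k.+1) + evec (inord (k + 4))).
    apply/rowP => j; rewrite [RHS]mxE [X in _ * X]mxE !evecE // 2!mxE (negPf i0) oi.
    by [].
  by rewrite -scalemxAl mulmxDl !zrow // z1 z4 scalerDr re_z.
have -> : row i real_from_z = ('i / 2) *: (evec (inord k.+1) - evec (inord (k + 4))).
  apply/rowP => j; rewrite [RHS]mxE [X in _ * X]mxE [X in _ + X]mxE !evecE // 2!mxE (negPf i0) oi.
  by [].
by rewrite -scalemxAl mulmxBl !zrow // z1 z4 scalerBr im_z.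
Qed.

Let T123 : {set 'I_7} := [set i : 'I_7 | (0 < i < 4)%N].

Definition triple_coef : R[i] := pull_form triple_zframe U T123.

Let U_xi : int_prod (cplx_mx xi) U = 0.
Proof.
have ix (m : ext_form R 7) : int_prod (cplx_mx xi) (cplx_form m) = cplx_form (int_prod xi m).
  by rewrite /cplx_form (map_form_int_prod (real_complex R)).
rewrite [U]complex_form_split linearD linearZ /= !ix reU_xi imU_xi !cplx_form0.
by rewrite scaler0 addr0.
Qed.

(** On a complex frame adapted to the types, a (3,0)-form has a single
    coefficient. *)
Lemma triple_pull_U : pull_form triple_zframe U = triple_coef *: monomial _ T123.
Proof.
apply/ffunP => S; rewrite scale_formE monomialE.
case: eqP => [->|/eqP nS]; first by rewrite mulr1.
rewrite mulr0; have [S3|S3] := eqVneq #|S| 3; last exact: (has_degree_pull_form _ U3).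
have [S0|S0] := boolP (0 \in S).
  rewrite (form_coef_int_prod _ S0) int_prod_pull_form_row rowK /triple_zrow /= U_xi.
  by rewrite linear0 zero_formE mulr0.
pose p1 := [seq s <- take 4 (enum 'I_7) | s \in S].
pose p2 := [seq s <- drop 4 (enum 'I_7) | s \in S].
have eS : enum S = p1 ++ p2.
  rewrite -filter_cat cat_take_drop /enum_mem -filter_predI.
  by apply: eq_filter => s /=; rewrite andbT.
have lt1 s : s \in p1 -> (0 < s < 4)%N.
  rewrite mem_filter => /andP[sS /(map_f val)].
  rewrite map_take val_enum_ord take_iota mem_iota => /andP[_ s4].
  rewrite (_ : minn 4 7 = 4%N) // in s4; rewrite s4 andbT lt0n.
  by apply: contraNneq S0 => s0; rewrite (_ : 0 = s) //; apply: val_inj.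
have lt2 s : s \in p2 -> (4 <= s)%N.
  rewrite mem_filter => /andP[_ /(map_f val)].
  by rewrite map_drop val_enum_ord drop_iota mem_iota => /andP[].
rewrite pull_formE eS map_cat; apply: U_type.
- move=> u /mapP[s /lt1 /andP[s0 s4] ->]; rewrite rowK /triple_zrow s4.
  by rewrite gtn_eqF //; apply/zvecD10/eta_a; lia.
- move=> u /mapP[s /lt2 s4 ->]; rewrite rowK /triple_zrow ltnNge s4 /=.
  rewrite gtn_eqF; last by lia.
  by apply/zbarD01/eta_a; have := ltn_ord s; lia.
- by rewrite !size_map -size_cat -eS -cardE S3.
- rewrite size_map => p13; case/negP: nS.
  have p20 : p2 = [::].
    by apply/nilP; rewrite /nilp; move: S3; rewrite cardE eS size_cat p13; lia.
  have cT : #|T123| = 3%N.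
    rewrite -sum1_card big_mkcond !big_ord_recl big_ord0 !inE.
    by [].
  rewrite finset.eqEcard cT S3 leqnn andbT; apply/fintype.subsetP => s sS.
  by rewrite inE; apply: lt1; rewrite -[p1]cats0 -p20 -eS mem_enum.
Qed.

Lemma triple_pull_U_real : pull_form (cplx_mx triple_frame) U =
  (triple_coef / 8) *: (cplx_form (std_re R) + 'i *: cplx_form (std_im R)).
Proof.
have ii : 'i * 'i = -1 :> R[i] by rewrite -expr2 sqr_i.
have cre : cplx_form (std_re R) = std_re R[i].
  exact: (map_form_bit_val (real_complex R)).
have cim : cplx_form (std_im R) = std_im R[i].
  exact: (map_form_bit_val (real_complex R)).
rewrite cre cim -real_from_zE -pull_form_comp triple_pull_U.
by rewrite linearZ /= pull_monomial123 // scalerA.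
Qed.

Lemma triple_pull_ReIm : pull_form triple_frame (Re_form U) =
    Re_form (pull_form (cplx_mx triple_frame) U) /\
  pull_form triple_frame (Im_form U) = Im_form (pull_form (cplx_mx triple_frame) U).
Proof.
have pc (m : ext_form R 7) :
    pull_form (cplx_mx triple_frame) (cplx_form m) = cplx_form (pull_form triple_frame m).
  exact/esym/(map_form_pull (real_complex R)).
rewrite {2 4}[U]complex_form_split linearD linearZ /= !pc.
by rewrite Re_form_split Im_form_split.
Qed.

End FrameOfTriple.


(** Rotating the first vector of a unitary triple rotates the phase of U. *)
Let rotate (x y : R) (a : nat -> 'rV[R]_7) (k : nat) : 'rV[R]_7 :=
  if k == 0%N then x *: a 0%N + y *: (a 0%N *m Phi) else a k.

Let unitary_rotate x y a : x ^+ 2 + y ^+ 2 = 1 -> unitary a -> unitary (rotate x y a).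
Proof.
move=> xy ua; have eta_a k : (k < 3)%N -> eval1 eta (a k) = 0 by move=> k3; case: (ua k k k3 k3).
have pa k l : (k < 3)%N -> (l < 3)%N -> pair (a k) (a l) = 0.
  by move=> k3 l3; case: (ua k l k3 l3).
have pb k l : (k < 3)%N -> (l < 3)%N -> pair (a k) (a l *m Phi) = (k == l)%:R.
  by move=> k3 l3; case: (ua k l k3 l3).
have bb k l : (k < 3)%N -> (l < 3)%N -> pair (a k *m Phi) (a l *m Phi) = 0.
  by move=> k3 l3; rewrite pair_Phi ?eta_a // pa.
have ba k l : (k < 3)%N -> (l < 3)%N -> pair (a k *m Phi) (a l) = - (k == l)%:R.
  by move=> k3 l3; rewrite pairC pb // eq_sym.
have rPhi : (x *: a 0%N + y *: (a 0%N *m Phi)) *m Phi = x *: (a 0%N *m Phi) + (- y) *: a 0%N.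
  by rewrite mulmxDl -!scalemxAl Phi2D ?eta_a // scalerN scaleNr.
move=> k l k3 l3; rewrite /rotate; case: k k3 => [|k] k3; case: l l3 => [|l] l3 /=;
  rewrite ?rPhi; split;
  rewrite ?(coef0D, coef0Z, eta_Phi, eta_a, pairDl, pairDr, pairZl, pairZr, pa, pb, bb, ba) //;
  rewrite ?(mulr0, mulr1n, mulr0n, addr0, oppr0, add0r, mulr1) ?mulr0 ?addr0 //;
  by [ring | rewrite -[RHS]xy; ring].
Qed.

Let zvec_rotate x y a : eval1 eta (a 0%N) = 0 ->
  zvec (rotate x y a 0%N) = (x%:C + 'i * y%:C) *: zvec (a 0%N).
Proof.
move=> a0; rewrite /zvec /rotate /= mulmxDl -!scalemxAl Phi2D // !map_mxD !map_mxZ map_mxN.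
have ii : 'i * 'i = -1 :> R[i] by rewrite -expr2 sqr_i.
exact: (rotate_mx x%:C y%:C (cplx_mx (a 0%N)) (cplx_mx (a 0%N *m Phi)) ii).
Qed.

Let triple_coef_rotate x y a : eval1 eta (a 0%N) = 0 ->
  triple_coef (rotate x y a) = (x%:C + 'i * y%:C) * triple_coef a.
Proof.
move=> a0; rewrite /triple_coef; set T := [set i : 'I_7 | _].
have T1 : inord 1 \in T by rewrite inE inordK.
have row1 b : row (inord 1) (triple_zframe b) = zvec (b 0%N).
  by rewrite rowK /triple_zrow inordK.
have nT1 : inord 1 \notin T :\ inord 1 by rewrite finset.setD11.
have coefE b z : zvec (b 0%N) = z -> pull_form (triple_zframe b) U T =
    shuffle_sign _ [set inord 1] (T :\ inord 1) *
    pull_form (triple_zframe b) (int_prod z U) (T :\ inord 1).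
  by move=> <-; rewrite -row1 -(pull_form_coefU1 _ _ nT1) finset.setD1K.
apply: etrans (coefE _ _ (zvec_rotate x y a0)) _.
apply: etrans (congr1 (fun c => (x%:C + 'i * y%:C) * c) (esym (coefE a _ erefl))).
apply: pull_form_contract_scale.
apply: eq_pull_form_rows => i; rewrite !inE => /andP[i1 /andP[i0 i4]].
have rE b : row i (triple_zframe b) = zvec (b i.-1).
  by rewrite rowK /triple_zrow i4 gtn_eqF.
apply: etrans (rE _) (etrans _ (esym (rE _))).
have i10 : i.-1 != 0%N.
  by apply: contraNneq i1 => i10; apply/eqP/val_inj; rewrite /= inordK //; lia.
by rewrite /rotate (negPf i10).
Qed.

(** Transverse SU(3)-structures have adapted frames: a Hermitian orthonormal
    triple, its phase chosen so that U is positive on it, sheared along xi into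
    the kernel of e. *)
Lemma exists_adapted_frame e : has_degree 1 e -> int_prod xi e = form0 1 -> U != 0 ->
  exists h P, adapted_frame xi e w (Re_form U) (Im_form U) h P.
Proof.
move=> e1 e_xi U0.
have [a [ua [N N0 cN]]] : exists a, unitary a /\ exists2 N : R, 0 < N & triple_coef a = N%:C.
  have [a ua] := exists_unitary; have a0 : eval1 eta (a 0%N) = 0 by case: (ua 0%N 0%N).
  case ec : (triple_coef a) => [p q].
  have c0 : p ^+ 2 + q ^+ 2 != 0.
    rewrite paddr_eq0 ?sqr_ge0 // !sqrf_eq0; apply: contra_neqN U0 => /andP[/eqP p0 /eqP q0].
    have [eRe eIm] := triple_pull_ReIm a; have uP := triple_unitmx ua.
    move: eRe eIm; rewrite (triple_pull_U_real ua) ec p0 q0.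
    have -> : (0 +i* 0 : R[i]) = 0 by [].
    rewrite mul0r scale0r => eRe eIm; rewrite [U]complex_form_split.
    have -> : Re_form U = 0.
      by apply: (pull_form_inj uP); rewrite eRe linear0; apply/ffunP => S; rewrite !ffunE.
    have -> : Im_form U = 0.
      by apply: (pull_form_inj uP); rewrite eIm linear0; apply/ffunP => S; rewrite !ffunE.
    by rewrite !cplx_form0 scaler0 addr0.
  pose N := Num.sqrt (p ^+ 2 + q ^+ 2).
  have N0 : 0 < N by rewrite sqrtr_gt0 lt0r c0 addr_ge0 ?sqr_ge0.
  have N2 : N ^+ 2 = p ^+ 2 + q ^+ 2 by rewrite sqr_sqrtr // addr_ge0 ?sqr_ge0.
  have Nn : N != 0 by exact: lt0r_neq0.
  exists (rotate (p / N) (- q / N) a); split.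
    apply: unitary_rotate => //; rewrite !exprMn sqrrN -mulrDl -N2 exprVn mulfV //.
    by rewrite expf_neq0.
  exists N => //; rewrite triple_coef_rotate // ec; apply/eqP; rewrite eq_complex; simpc => /=.
  apply/andP; split; apply/eqP.
    transitivity ((p ^+ 2 + q ^+ 2) / N); first by field.
    by rewrite -N2; field.
  by field.
(* The vectors z_k are twice the (1,0)-parts of the a_k, whence 2^3. *)
pose h := N / 8; have h0 : 0 < h by rewrite divr_gt0.
have uP := triple_unitmx ua; set P0 := triple_frame a in uP.
have ePw : pull_form P0 w = std_w R by exact: triple_pull_w.
have h8 : N%:C / 8 = h%:C :> R[i].
  by rewrite /h rmorphM fmorphV rmorph_nat.
have [eRe eIm] := triple_pull_ReIm a; rewrite (triple_pull_U_real ua) cN h8 in eRe eIm.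
have {}eRe : pull_form P0 (Re_form U) = h *: std_re R.
  rewrite eRe scalerDr scalerA mulrC -scalerA -!cplx_formZ; exact: Re_form_split.
have {}eIm : pull_form P0 (Im_form U) = h *: std_im R.
  rewrite eIm scalerDr scalerA mulrC -scalerA -!cplx_formZ; exact: Im_form_split.
have row0 : row 0 P0 = xi by rewrite rowK.
(* The shear along xi moves the transverse vectors into the kernel of e and
   scales row 0 to xi / h. *)
pose c (i : 'I_7) : R := if i == 0 then h^-1 else - eval1 e (row i P0).
pose L : 'M[R]_7 := \matrix_(i < 7) ((if i == 0 then 0 else evec i) + c i *: evec 0).
have rowL i : row i L = (if i == 0 then 0 else evec i) + c i *: evec 0 by rewrite rowK.
have rowP i : row i (L *m P0) = (if i == 0 then 0 else row i P0) + c i *: xi.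
  rewrite row_mul rowL mulmxDl -scalemxAl -rowE row0; congr (_ + _).
  by case: ifP => _; rewrite ?mul0mx -?rowE.
have pullL b : int_prod (evec 0) b = 0 -> pull_form (L *m P0) (pull_form (invmx P0) b) = b.
  move=> b0; rewrite pull_form_comp mulmxK //; exact: pull_form_shear rowL b0.
have pullP b b' : pull_form P0 b = b' -> int_prod (evec 0) b' = 0 -> pull_form (L *m P0) b = b'.
  by move=> <- b0; rewrite -pull_form_comp; exact: pull_form_shear rowL b0.
have row0P : row 0 (L *m P0) = h^-1 *: xi by rewrite rowP /c !eqxx add0r.
have Pw : pull_form (L *m P0) w = std_w R by apply: pullP ePw (int_prod_std_w R).
exists h, (L *m P0); split=> //.
- split=> //; apply: (frame_unitmx Pw row0P); exact/invr_neq0/lt0r_neq0.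
- have de : has_degree 1 (pull_form (L *m P0) e) by exact: has_degree_pull_form.
  have dd : has_degree 1 (h^-1 *: std_e R) by apply/has_degreeZ/has_degree_dx.
  apply: form_eq_contract => [|i]; first by rewrite de ?cards0 // dd ?cards0.
  rewrite int_prod_pull_form_row linearZ /= int_prod_dx scale_form0 mxE eqxx /=.
  have deg0 v : int_prod v e = form0 (eval1 e v).
    apply/ffunP => S; rewrite form0E; case: eqP => [->//|/eqP S0].
    by rewrite (has_degree_int_prod v e1) // cards_eq0.
  rewrite deg0 pull_form0; congr form0; rewrite rowP coef0D coef0Z e_xi form0E eqxx mulr1 /c.
  rewrite eq_sym; case: eqP => [_|_]; first by rewrite int_prod0l zero_formE add0r mulr1.
  by rewrite addrN mulr0.
- split=> //.
    by apply: pullP eRe _; rewrite linearZ /= int_prod_std_re scaler0.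
  by apply: pullP eIm _; rewrite linearZ /= int_prod_std_im scaler0.
Qed.

End UnitaryFrame.

(** * Smooth functions *)

Local Notation iterD := Defs.iterD.

Section SmoothFunctions.
Variables (R : realType) (W : normedModType R).
Implicit Types (f g : W -> R) (U : set W) (u v x : W).

Lemma near_eq0_differentiable f x : (\near x, f x = 0) -> differentiable f x.
Proof.
move=> f0; have fx : f x = 0 by exact: (nbhs_singleton f0).
have e : f \o shift x = cst (f x) + (\0 : W -> R) +o_ 0 id.
  apply/eqaddoP => eps eps0; near=> y.
  have fyx : f (y + x) = 0.
    by near: y; have := f0; rewrite (near_shift 0 x) /= subr0.
  rewrite -[X in `|X|]/(f (y + x) - (f x + 0)) fyx fx addr0 subrr normr0.
  by rewrite mulr_ge0 // ltW.
have D0 : 'd f x = (\0 : W -> R) :> (W -> R).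
  by apply: diff_unique => //; exact: cst_continuous.
apply/diff_locallyP; rewrite D0; split=> //; exact: cst_continuous.
Unshelve. all: by end_near. Qed.

Lemma near_eq_differentiable f g x :
  (\near x, f x = g x) -> differentiable f x -> differentiable g x.
Proof.
move=> fg df; have -> : g = f + (fun y => g y - f y).
  by apply/funext => y; rewrite fctE addrCA subrr addr0.
apply: differentiableD => //; apply: near_eq0_differentiable.
by apply: filterS fg => y ->; rewrite subrr.
Qed.

(** Smoothness by orders: closure under algebraic operations goes by induction on k,
    since a derivative of a product or a quotient involves the functions
    themselves again. *)
Definition Ck_on k U f := forall vs x, (size vs <= k)%N -> U x ->
  differentiable (iterD vs f) x.

Lemma smooth_Ck U f : smooth_on U f <-> forall k, Ck_on k U f.
Proof.
split=> [sf k vs x _|sf vs x]; first exact: sf.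
exact: (sf (size vs)).
Qed.

Lemma iterD_rcons (vs : seq W) v f : iterD (rcons vs v) f = iterD vs (fun x => 'D_v f x).
Proof. by elim: vs => //= u vs ->. Qed.

Lemma eq_iterD U f g (vs : seq W) : open U -> (forall x, U x -> f x = g x) ->
  forall x, U x -> iterD vs f x = iterD vs g x.
Proof.
move=> oU fg; elim: vs => //= v vs IH x Ux; apply: near_eq_derive.
by near=> y; apply: IH; near: y; exact: open_nbhs_nbhs.
Unshelve. all: by end_near. Qed.

Lemma near_open U (P : W -> Prop) x : open U -> U x -> (forall y, U y -> P y) ->
  \forall y \near x, P y.
Proof. by move=> oU Ux UP; apply: filterS (open_nbhs_nbhs (conj oU Ux)). Qed.

Lemma eq_Ck k U f g : open U -> (forall x, U x -> f x = g x) -> Ck_on k U f -> Ck_on k U g.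
Proof.
move=> oU fg Cf vs x vk Ux; apply: near_eq_differentiable (Cf vs x vk Ux).
by apply: (near_open oU Ux) => y; exact: eq_iterD.
Qed.

Lemma CkS k U f : Ck_on k.+1 U f <->
  (forall x, U x -> differentiable f x) /\ forall v, Ck_on k U (fun x => 'D_v f x).
Proof.
split=> [Cf|[df Cf] vs x].
  split=> [x Ux|v vs x vk Ux]; first exact: (Cf [::]).
  by rewrite -iterD_rcons; apply: Cf; rewrite ?size_rcons.
case/lastP: vs => [|vs v] vk Ux; first exact: df.
by rewrite iterD_rcons; apply: Cf; rewrite // -ltnS -(size_rcons vs v).
Qed.

Lemma Ck_le k l U f : (k <= l)%N -> Ck_on l U f -> Ck_on k U f.
Proof. by move=> kl Cf vs x vk; apply: Cf; exact: leq_trans vk kl. Qed.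

Lemma Ck0 U f : Ck_on 0 U f <-> forall x, U x -> differentiable f x.
Proof. by split=> [Cf x|df [|//] x _]; [exact: (Cf [::])|exact: df]. Qed.

Lemma Ck_diff k U f x : Ck_on k U f -> U x -> differentiable f x.
Proof. by move=> Cf; exact: (Cf [::]). Qed.

Lemma Ck_cst k U (a : R) : Ck_on k U (fun=> a).
Proof.
elim: k a => [|k IH] a; first by apply/Ck0 => x _; exact: differentiable_cst.
apply/CkS; split=> [x _|v]; first exact: differentiable_cst.
have -> : (fun x => 'D_v (fun=> a) x) = fun=> 0.
  by apply/funext => x; rewrite derive_cst.
exact: IH.
Qed.

Lemma CkD k U f g : open U -> Ck_on k U f -> Ck_on k U g -> Ck_on k U (fun x => f x + g x).
Proof.
move=> oU; elim: k f g => [|k IH] f g.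
  by move=> /Ck0 df /Ck0 dg; apply/Ck0 => x Ux; apply: differentiableD; [exact: df|exact: dg].
move=> /CkS[df Cf] /CkS[dg Cg]; apply/CkS; split=> [x Ux|v].
  by apply: differentiableD; [exact: df|exact: dg].
apply: eq_Ck (IH _ _ (Cf v) (Cg v)) => // x Ux.
by rewrite -deriveD //; apply: diff_derivable; [exact: df|exact: dg].
Qed.

Lemma CkM k U f g : open U -> Ck_on k U f -> Ck_on k U g -> Ck_on k U (fun x => f x * g x).
Proof.
move=> oU; elim: k f g => [|k IH] f g.
  by move=> /Ck0 df /Ck0 dg; apply/Ck0 => x Ux; apply: differentiableM; [exact: df|exact: dg].
move=> Cf' Cg'; have [df Cf] := (CkS k U f).1 Cf'; have [dg Cg] := (CkS k U g).1 Cg'.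
apply/CkS; split=> [x Ux|v].
  by apply: differentiableM; [exact: df|exact: dg].
have Cfk := Ck_le (leqnSn k) Cf'; have Cgk := Ck_le (leqnSn k) Cg'.
apply: eq_Ck (CkD oU (IH _ _ Cfk (Cg v)) (IH _ _ Cgk (Cf v))) => // x Ux.
by rewrite [RHS]deriveM //; apply: diff_derivable; [exact: df|exact: dg].
Qed.

Lemma CkV k U f : open U -> (forall x, U x -> f x != 0) -> Ck_on k U f ->
  Ck_on k U (fun x => (f x)^-1).
Proof.
move=> oU f0; elim: k => [|k IH] Cf'.
  by apply/Ck0 => x Ux; apply: differentiableV; [exact: (Ck_diff Cf')|exact: f0].
have [df Cf] := (CkS k U f).1 Cf'; apply/CkS; split=> [x Ux|v].
  by apply: differentiableV; [exact: df|exact: f0].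
have Cfk := IH (Ck_le (leqnSn k) Cf').
have C2 := CkM oU (@Ck_cst k U (-1)) (CkM oU (CkM oU Cfk Cfk) (Cf v)).
apply: (eq_Ck (g := fun x => 'D_v (fun y => (f y)^-1) x) oU _ C2) => x Ux.
rewrite deriveV ?f0 //; last exact/diff_derivable/df.
by rewrite mulN1r -mulNr /GRing.scale /= expr2 invfM mulNr.
Qed.

Lemma differentiable_comp1 (phi : R -> R) f x d : is_derive (f x) (1 : R) phi d ->
  differentiable f x ->
  differentiable (fun y => phi (f y)) x /\ forall v, 'D_v (fun y => phi (f y)) x = d * 'D_v f x.
Proof.
move=> [dphi Dphi] df; have dphi' : differentiable phi (f x) by exact/derivable1_diffP.
have dc : differentiable (phi \o f) x by exact: differentiable_comp.
split=> // v; rewrite -[LHS]/('D_v (phi \o f) x) deriveE // diff_comp //= deriveE //.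
have -> : 'd f x v = 'd f x v *: (1 : R) by rewrite /GRing.scale /= mulr1.
have Ed : 'd phi (f x) (1 : R) = d by rewrite -deriveE.
by rewrite linearZ Ed /GRing.scale /= mulr1 mulrC.
Qed.

Lemma Ck_sqrt k U f : open U -> (forall x, U x -> 0 < f x) -> Ck_on k U f ->
  Ck_on k U (fun x => Num.sqrt (f x)).
Proof.
move=> oU f0; have Ds x : U x -> is_derive (f x) (1 : R) Num.sqrt (2 * Num.sqrt (f x))^-1.
  by move=> Ux; apply: is_derive1_sqrt; exact: f0.
elim: k => [|k IH] Cf'.
  by apply/Ck0 => x Ux; apply: (differentiable_comp1 (Ds x Ux) (Ck_diff Cf' Ux)).1.
have [df Cf] := (CkS k U f).1 Cf'; apply/CkS; split=> [x Ux|v].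
  exact: (differentiable_comp1 (Ds x Ux) (df x Ux)).1.
have Ck2 : Ck_on k U (fun x => 2 * Num.sqrt (f x)).
  by apply: CkM => //; [exact: Ck_cst | exact/IH/(Ck_le (leqnSn k))].
have Ck3 : Ck_on k U (fun x => (2 * Num.sqrt (f x))^-1).
  apply: CkV Ck2 => // x Ux; rewrite mulf_neq0 ?pnatr_eq0 // gt_eqF // sqrtr_gt0; exact: f0.
apply: eq_Ck (CkM oU Ck3 (Cf v)) => // x Ux.
by rewrite (differentiable_comp1 (Ds x Ux) (df x Ux)).2.
Qed.

Lemma Ck_ln k U f : open U -> (forall x, U x -> 0 < f x) -> Ck_on k U f ->
  Ck_on k U (fun x => ln (f x)).
Proof.
move=> oU f0; have Ds x : U x -> is_derive (f x) (1 : R) (@ln R) (f x)^-1.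
  by move=> Ux; apply: is_derive1_ln; exact: f0.
case: k => [|k] Cf'.
  by apply/Ck0 => x Ux; apply: (differentiable_comp1 (Ds x Ux) (Ck_diff Cf' Ux)).1.
have [df Cf] := (CkS k U f).1 Cf'; apply/CkS; split=> [x Ux|v].
  exact: (differentiable_comp1 (Ds x Ux) (df x Ux)).1.
have CV : Ck_on k U (fun x => (f x)^-1).
  apply: CkV (Ck_le (leqnSn k) Cf') => // x Ux; rewrite gt_eqF //; exact: f0.
apply: eq_Ck (CkM oU CV (Cf v)) => // x Ux.
by rewrite (differentiable_comp1 (Ds x Ux) (df x Ux)).2.
Qed.

Section Closure.
Variables (U : set W).
Hypothesis oU : open U.

Lemma smooth_diff f x : smooth_on U f -> U x -> differentiable f x.
Proof. by move=> sf; exact: (sf [::]). Qed.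
Lemma smooth_derivable f x v : smooth_on U f -> U x -> derivable f x v.
Proof. by move=> sf Ux; exact/diff_derivable/(smooth_diff sf). Qed.
Lemma eq_smooth f g : (forall x, U x -> f x = g x) -> smooth_on U f -> smooth_on U g.
Proof. by move=> fg /smooth_Ck sf; apply/smooth_Ck => k; exact: eq_Ck (sf k). Qed.
Lemma smooth_cst a : smooth_on U (fun=> a).
Proof. by apply/smooth_Ck => k; exact: Ck_cst. Qed.
Lemma smoothD f g : smooth_on U f -> smooth_on U g -> smooth_on U (fun x => f x + g x).
Proof. by move=> /smooth_Ck sf /smooth_Ck sg; apply/smooth_Ck => k; exact: CkD. Qed.
Lemma smoothM f g : smooth_on U f -> smooth_on U g -> smooth_on U (fun x => f x * g x).
Proof. by move=> /smooth_Ck sf /smooth_Ck sg; apply/smooth_Ck => k; exact: CkM. Qed.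
Lemma smoothN f : smooth_on U f -> smooth_on U (fun x => - f x).
Proof.
by move=> sf; apply: eq_smooth (smoothM (smooth_cst (-1)) sf) => x _; rewrite mulN1r.
Qed.
Lemma smoothV f : (forall x, U x -> f x != 0) -> smooth_on U f ->
  smooth_on U (fun x => (f x)^-1).
Proof. by move=> f0 /smooth_Ck sf; apply/smooth_Ck => k; exact: CkV. Qed.
Lemma smooth_sqrt f : (forall x, U x -> 0 < f x) -> smooth_on U f ->
  smooth_on U (fun x => Num.sqrt (f x)).
Proof. by move=> f0 /smooth_Ck sf; apply/smooth_Ck => k; exact: Ck_sqrt. Qed.
Lemma smooth_ln f : (forall x, U x -> 0 < f x) -> smooth_on U f ->
  smooth_on U (fun x => ln (f x)).
Proof. by move=> f0 /smooth_Ck sf; apply/smooth_Ck => k; exact: Ck_ln. Qed.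
Lemma smooth_derive f v : smooth_on U f -> smooth_on U (fun x => 'D_v f x).
Proof. by move=> /smooth_Ck sf; apply/smooth_Ck => k; have /CkS[_] := sf k.+1. Qed.
Lemma smooth_sum (I : Type) (r : seq I) (P : pred I) (F : I -> W -> R) :
  (forall i, P i -> smooth_on U (F i)) -> smooth_on U (fun x => \sum_(i <- r | P i) F i x).
Proof.
move=> sF; elim: r => [|i r IH].
  by apply: eq_smooth (smooth_cst 0) => x _; rewrite big_nil.
case Pi : (P i).
  by apply: eq_smooth (smoothD (sF i Pi) IH) => x _; rewrite big_cons Pi.
by apply: eq_smooth IH => x _; rewrite big_cons Pi.
Qed.
Lemma smooth_prod (I : Type) (r : seq I) (P : pred I) (F : I -> W -> R) :
  (forall i, P i -> smooth_on U (F i)) -> smooth_on U (fun x => \prod_(i <- r | P i) F i x).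
Proof.
move=> sF; elim: r => [|i r IH].
  by apply: eq_smooth (smooth_cst 1) => x _; rewrite big_nil.
case Pi : (P i).
  by apply: eq_smooth (smoothM (sF i Pi) IH) => x _; rewrite big_cons Pi.
by apply: eq_smooth IH => x _; rewrite big_cons Pi.
Qed.

End Closure.

Lemma mean_value (k dk : R -> R) (h : R) : 0 < h ->
    (forall t, 0 <= t <= h -> is_derive t (1 : R) k (dk t)) ->
  exists2 t, 0 <= t <= h & k h - k 0 = dk t * h.
Proof.
move=> h0 Dk; have [//|t||t] := @MVT R k dk 0 h.
- by rewrite in_itv /= => /andP[t0 th]; apply: Dk; rewrite !ltW.
- apply: derivable_within_continuous => t; rewrite in_itv /= => ht.
  by have [] := Dk t ht.
- by rewrite in_itv /= subr0 => /andP[t0 th] kh; exists t; rewrite ?ltW.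
Qed.

Lemma near_ball U (a b : W -> R) x (e : R) : open U -> U x ->
    {for x, continuous a} -> {for x, continuous b} -> 0 < e ->
  exists2 r, 0 < r & forall y, ball x r y -> [/\ U y, `|a x - a y| < e & `|b x - b y| < e].
Proof.
move=> oU Ux /cvgrPdist_lt ca /cvgrPdist_lt cb e0.
have : \forall y \near x, [/\ U y, `|a x - a y| < e & `|b x - b y| < e].
  by apply: filterS3 (open_nbhs_nbhs (conj oU Ux)) (ca _ e0) (cb _ e0) => y; split.
by move=> /nbhs_ballP[r /= r0 hr]; exists r.
Qed.

(** The second difference of f over a small parallelogram is a mixed second
    derivative at some point of the parallelogram, by the mean value theorem in
    each direction. *)
Lemma second_difference U f x u v (h : R) : smooth_on U f -> 0 < h ->
    (forall s t, 0 <= s <= h -> 0 <= t <= h -> U (x + s *: u + t *: v)) ->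
  exists s t, [/\ 0 <= s <= h, 0 <= t <= h &
    f (x + h *: u + h *: v) - f (x + h *: u) - (f (x + h *: v) - f x) =
    h ^+ 2 * 'D_v (fun y => 'D_u f y) (x + s *: u + t *: v)].
Proof.
move=> sf h0 hU.
have line (F : W -> R) (y w : W) (s : R) : differentiable F (y + s *: w) ->
    is_derive s (1 : R) (fun s : R => F (y + s *: w)) ('D_w F (y + s *: w)).
  move=> dF; pose l (s : R) : W := y + s *: w.
  have dl : is_diff s l (fun r => r *: w).
    rewrite (_ : (fun r => r *: w) = 0 + (fun r => r *: w)); last by rewrite add0r.
    exact: is_diffD.
  have dlF : differentiable F (l s) by [].
  have dc : differentiable (F \o l) s by apply: differentiable_comp => //; exact: ex_diff.
  apply: DeriveDef; first exact/derivable1_diffP.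
  have dl' : differentiable l s by exact: ex_diff.
  rewrite -[LHS]/('D_1 (F \o l) s) deriveE // diff_comp // [RHS]deriveE //=.
  by rewrite (_ : 'd l s 1 = w) // diff_val scale1r.
have diffU s t : 0 <= s <= h -> 0 <= t <= h -> differentiable f (x + s *: u + t *: v).
  by move=> hs ht; apply: (smooth_diff sf); exact: hU.
have h00 : 0 <= (0 : R) <= h by rewrite lexx ltW.
have hh : 0 <= h <= h by rewrite lexx ltW.
pose g (s : R) := f (x + h *: v + s *: u) - f (x + s *: u).
pose dg (s : R) := 'D_u f (x + h *: v + s *: u) - 'D_u f (x + s *: u).
have Dg s : 0 <= s <= h -> is_derive s (1 : R) g (dg s).
  move=> hs; apply: is_deriveB; apply: line.
    by rewrite addrAC; exact: diffU.
  by rewrite -[x + _]addr0 -(scale0r v); exact: diffU.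
have [s hs gh] := mean_value h0 Dg.
pose k (t : R) := 'D_u f (x + s *: u + t *: v).
pose dk (t : R) := 'D_v (fun y => 'D_u f y) (x + s *: u + t *: v).
have Dk t : 0 <= t <= h -> is_derive t (1 : R) k (dk t).
  move=> ht; apply: (line (fun y => 'D_u f y)).
  by have := sf [:: u] (x + s *: u + t *: v) (hU s t hs ht).
have [t ht kh] := mean_value h0 Dk.
exists s, t; split=> //.
have -> : f (x + h *: u + h *: v) - f (x + h *: u) - (f (x + h *: v) - f x) = g h - g 0.
  by rewrite /g !scale0r !addr0 [x + h *: v + _]addrAC.
rewrite gh; have -> : dg s = k h - k 0.
  by rewrite /dg /k scale0r addr0 [x + h *: v + _]addrAC.
by rewrite kh -[dk t]/('D_v _ _) expr2; ring.
Qed.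

(** The same second difference approximates both mixed derivatives, which are
    continuous. *)
Lemma derive_comm U f x u v : open U -> U x -> smooth_on U f ->
  'D_u (fun y => 'D_v f y) x = 'D_v (fun y => 'D_u f y) x.
Proof.
move=> oU Ux sf; apply/eqP; rewrite -subr_eq0 -normr_eq0; apply/eqP.
apply/le_anti; rewrite normr_ge0 andbT; apply/ler_addgt0Pr => e e0; rewrite add0r.
pose a := fun y => 'D_u (fun y => 'D_v f y) y; pose b := fun y => 'D_v (fun y => 'D_u f y) y.
have ca : {for x, continuous a}.
  by apply: differentiable_continuous; exact: (sf [:: u; v]).
have cb : {for x, continuous b}.
  by apply: differentiable_continuous; exact: (sf [:: v; u]).
have e2 : 0 < e / 2 by rewrite divr_gt0.
have [r r0 hr] := near_ball oU Ux ca cb e2.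
(* The parallelogram at x with sides h u and h v stays in the ball. *)
pose h := r / (2 * (`|u| + `|v| + 1)).
have uv0 : 0 < `|u| + `|v| + 1 by rewrite ltr_wpDl // addr_ge0.
have h0 : 0 < h by rewrite divr_gt0 // mulr_gt0.
have close s t : 0 <= s <= h -> 0 <= t <= h -> ball x r (x + s *: u + t *: v).
  move=> /andP[s0 sh] /andP[t0 th]; rewrite -ball_normE /= -addrA opprD addrA subrr sub0r normrN.
  apply: le_lt_trans (ler_normD _ _) _; rewrite !normrZ !ger0_norm //.
  apply: (@le_lt_trans _ _ (h * (`|u| + `|v| + 1))).
    rewrite !mulrDr mulr1 -addrA lerD ?ler_wpM2r // ler_wpDr ?ler_wpM2r //.
    exact: ltW.
  have -> : h * (`|u| + `|v| + 1) = r / 2.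
    by rewrite /h; field; rewrite gt_eqF.
  by rewrite ltr_pdivrMr // mulr_natr mulr2n ltrDl.
have [s [t [hs ht E1]]] := @second_difference U f x u v h sf h0
  (fun s t hs ht => let: And3 Uy _ _ := hr _ (close s t hs ht) in Uy).
have close' s' t' : 0 <= s' <= h -> 0 <= t' <= h -> ball x r (x + s' *: v + t' *: u).
  by move=> hs' ht'; rewrite addrAC; exact: close.
have [s' [t' [hs' ht' E2]]] := @second_difference U f x v u h sf h0
  (fun s t hs ht => let: And3 Uy _ _ := hr _ (close' s t hs ht) in Uy).
have eab : b (x + s *: u + t *: v) = a (x + s' *: v + t' *: u).
  have h2 : h ^+ 2 != 0 by rewrite expf_neq0 // gt_eqF.
  have swap (p q m l : R) : p - q - (m - l) = p - m - (q - l) by ring.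
  apply: (mulfI h2); apply: etrans (esym E1) (etrans _ E2).
  rewrite [x + h *: v + h *: u]addrAC; exact: swap.
have [_ _ B] := hr _ (close s t hs ht); have [_ A _] := hr _ (close' s' t' hs' ht').
rewrite -/(a x) -/(b x).
have -> : a x - b x = (a x - a (x + s' *: v + t' *: u)) - (b x - b (x + s *: u + t *: v)).
  by rewrite eab opprB addrA subrK.
apply: le_trans (ler_normB _ _) _; rewrite [e]splitr.
apply: lerD; [exact: ltW A|exact: ltW B].
Qed.

End SmoothFunctions.

(** * The exterior derivative *)

Section OneFormWedge.
Variables (K : numFieldType) (n : nat).

Lemma has_degree_monomial (S : {set 'I_n}) : has_degree #|S| (monomial K S : ext_form K n).
Proof. by move=> T nT; rewrite monomialE; case: eqP => // eT; rewrite eT eqxx in nT. Qed.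

Lemma wedge_deg1C (a b : ext_form K n) : has_degree 1 a -> a \w b = parity b \w a.
Proof.
move=> da; rewrite [b]form_monomial wedge_sumr linear_sum wedge_suml.
apply: eq_bigr => S _; rewrite wedgeZr linearZ wedgeZl; congr (_ *: _).
rewrite -[X in X \w a]/(parity _) (parity_degree (has_degree_monomial (S := S))) (wedgeC da (has_degree_monomial (S := S))).
by rewrite mul1n wedgeZl.
Qed.

End OneFormWedge.

Lemma derive_bigsum (R : realType) (W : normedModType R) (I : Type) (r : seq I) (P : pred I)
    (F : I -> W -> R) x v : (forall i, P i -> derivable (F i) x v) ->
  derivable (fun y => \sum_(i <- r | P i) F i y) x v /\
  'D_v (fun y => \sum_(i <- r | P i) F i y) x = \sum_(i <- r | P i) 'D_v (F i) x.
Proof.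
move=> dF; elim: r => [|i r [IH1 IH2]].
  have -> : (fun y => \sum_(i <- [::] | P i) F i y) = cst 0.
    by apply/funext => y; rewrite big_nil.
  by rewrite big_nil derive_cst; split=> //; exact: derivable_cst.
rewrite big_cons; case Pi : (P i); last first.
  have -> : (fun y => \sum_(j <- i :: r | P j) F j y) = fun y => \sum_(j <- r | P j) F j y.
    by apply/funext => y; rewrite big_cons Pi.
  by [].
have -> : (fun y => \sum_(j <- i :: r | P j) F j y) = F i + fun y => \sum_(j <- r | P j) F j y.
  by apply/funext => y; rewrite big_cons Pi.
split; first exact: derivableD (dF i Pi) IH1.
by rewrite (deriveD (dF i Pi) IH1) IH2.
Qed.

Section ExteriorDerivative.
Variables (R : realType) (n : nat).
Local Notation V := 'rV[R]_n.+1.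
Local Notation form := (ext_form R n.+1).
Implicit Types (F G : V -> form) (U : set V) (x : V) (h : V -> R).

Definition smooth_form U F := forall S, smooth_on U (fun y => F y S).

Definition partial_form (i : 'I_n.+1) F x : form :=
  [ffun S : {set 'I_n.+1} => 'D_(basis_vec R i) (fun y => F y S : R^o) x].

Lemma ext_dE F x : ext_d F x = \sum_i dx i \w partial_form i F x.
Proof. by []. Qed.

Lemma near_partial_form i F G x : (\near x, F x = G x) ->
  partial_form i F x = partial_form i G x.
Proof.
move=> FG; apply/ffunP => S; rewrite !ffunE; apply: near_eq_derive.
by apply: filterS FG => y ->.
Qed.

Section OnOpen.
Variable U : set V.
Hypothesis oU : open U.

Lemma eq_ext_d F G x : U x -> (forall y, U y -> F y = G y) -> ext_d F x = ext_d G x.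
Proof.
move=> Ux FG; rewrite !ext_dE; apply: eq_bigr => i _; congr wedge.
exact/near_partial_form/(near_open oU Ux).
Qed.

Lemma eq_smooth_form F G : (forall x, U x -> F x = G x) -> smooth_form U F -> smooth_form U G.
Proof. by move=> FG sF S; apply: (eq_smooth oU _ (sF S)) => x Ux; rewrite FG. Qed.

Lemma smooth_formD F G : smooth_form U F -> smooth_form U G ->
  smooth_form U (fun y => F y + G y).
Proof.
by move=> sF sG S; apply: (eq_smooth oU _ (smoothD oU (sF S) (sG S))) => x _; rewrite formE.
Qed.

Lemma smooth_formZ h F : smooth_on U h -> smooth_form U F ->
  smooth_form U (fun y => h y *: F y).
Proof.
by move=> sh sF S; apply: (eq_smooth oU _ (smoothM oU sh (sF S))) => x _; rewrite formE.
Qed.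

Lemma smooth_formN F : smooth_form U F -> smooth_form U (fun y => - F y).
Proof. by move=> sF S; apply: (eq_smooth oU _ (smoothN oU (sF S))) => x _; rewrite formE. Qed.

Lemma smooth_form_cst (a : form) : smooth_form U (fun=> a).
Proof. by move=> S; exact: smooth_cst. Qed.

Lemma smooth_form_sum (I : Type) (r : seq I) (P : pred I) (F : I -> V -> form) :
  (forall i, P i -> smooth_form U (F i)) -> smooth_form U (fun x => \sum_(i <- r | P i) F i x).
Proof.
move=> sF S; apply: (eq_smooth oU (f := fun x => \sum_(i <- r | P i) F i x S)).
  by move=> x _; rewrite sum_form_E.
by apply: (smooth_sum oU) => i Pi; exact: sF.
Qed.

Lemma smooth_form_wedge F G : smooth_form U F -> smooth_form U G ->
  smooth_form U (fun y => F y \w G y).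
Proof.
move=> sF sG S; pose t A y := shuffle_sign R A (S :\: A)%SET * F y A * G y (S :\: A)%SET.
apply: (eq_smooth oU (f := fun y => \sum_(A in powerset S) t A y)).
  by move=> y _; rewrite wedgeE.
apply: (smooth_sum oU) => A _; rewrite /t; apply: (smoothM oU) => //.
by apply: (smoothM oU) => //; exact: smooth_cst.
Qed.

Lemma smooth_form_int_prod (X : V -> V) F : smooth_vf U X -> smooth_form U F ->
  smooth_form U (fun y => int_prod (X y) (F y)).
Proof.
move=> sX sF S; pose t i y := X y 0 i * shuffle_sign R (finset.set1 i) S * F y (i |: S)%SET.
apply: (eq_smooth oU (f := fun y => \sum_(i | i \notin S) t i y)).
  by move=> y _; rewrite int_prodE.
apply: (smooth_sum oU) => A _; rewrite /t; apply: (smoothM oU) => //.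
by apply: (smoothM oU) => //; exact: smooth_cst.
Qed.

Lemma smooth_form0 h : smooth_on U h -> smooth_form U (fun y => form0 (h y)).
Proof.
move=> sh S; have [S0|S0] := eqVneq S finset.set0.
  by apply: (eq_smooth oU _ sh) => y _; rewrite form0E S0 eqxx.
apply: (eq_smooth oU (f := fun=> 0)); last exact: smooth_cst.
by move=> y _; rewrite form0E (negPf S0).
Qed.

Lemma smooth_partial_form i F : smooth_form U F -> smooth_form U (partial_form i F).
Proof.
by move=> sF S; apply: (eq_smooth oU _ (smooth_derive _ (sF S))) => y _; rewrite ffunE.
Qed.

Lemma smooth_ext_d F : smooth_form U F -> smooth_form U (ext_d F).
Proof.
move=> sF; apply: smooth_form_sum => i _; apply: smooth_form_wedge.
  exact: smooth_form_cst.
exact: smooth_partial_form.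
Qed.

Lemma smooth_fun_d h : smooth_on U h -> smooth_form U (fun_d h).
Proof. by move=> sh; apply: smooth_ext_d; exact: smooth_form0. Qed.

Lemma partial_formD i F G x : U x -> smooth_form U F -> smooth_form U G ->
  partial_form i (fun y => F y + G y) x = partial_form i F x + partial_form i G x.
Proof.
move=> Ux sF sG; apply/ffunP => S; rewrite formE !ffunE -deriveD.
- rewrite (_ : (fun y => (F y + G y) S) = (fun y => F y S) + (fun y => G y S)) //.
  by apply/funext => y; rewrite add_formE.
- exact: (smooth_derivable (sF S) Ux).
- exact: (smooth_derivable (sG S) Ux).
Qed.

Lemma ext_dD F G x : U x -> smooth_form U F -> smooth_form U G ->
  ext_d (fun y => F y + G y) x = ext_d F x + ext_d G x.
Proof.
move=> Ux sF sG; rewrite !ext_dE -big_split; apply: eq_bigr => i _.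
by rewrite partial_formD // wedgeDr.
Qed.

Lemma partial_form_wedge i F G x : U x -> smooth_form U F -> smooth_form U G ->
  partial_form i (fun y => F y \w G y) x =
  partial_form i F x \w G x + F x \w partial_form i G x.
Proof.
move=> Ux sF sG; apply/ffunP => S; rewrite formE !wedgeE ffunE.
pose c A := shuffle_sign R A (S :\: A)%SET.
have dF A : derivable (fun y => F y A : R) x (basis_vec R i) by exact: (smooth_derivable (sF A) Ux).
have dG A : derivable (fun y => G y A : R) x (basis_vec R i) by exact: (smooth_derivable (sG A) Ux).
pose t A : V -> R := c A *: ((fun y => F y A : R) * (fun y => G y (S :\: A)%SET : R)).
have dt A : derivable (t A) x (basis_vec R i) by apply: derivableZ; exact: derivableM.
have -> : (fun y => (F y \w G y) S : R^o) = fun y => \sum_(A in powerset S) t A y.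
  by apply/funext => y; rewrite wedgeE; apply: eq_bigr => A _; rewrite -mulrA.
rewrite (derive_bigsum _ (fun A _ => dt A)).2 -big_split; apply: eq_bigr => A _.
rewrite deriveZ ?deriveM //; last exact: derivableM.
rewrite !ffunE /GRing.scale /= -/(c A); ring.
Qed.

(** The product rule for each partial derivative; moving dx i past F costs the
    parity of F. *)
Lemma ext_d_wedge F G x : U x -> smooth_form U F -> smooth_form U G ->
  ext_d (fun y => F y \w G y) x = ext_d F x \w G x + parity (F x) \w ext_d G x.
Proof.
move=> Ux sF sG; rewrite !ext_dE wedge_suml wedge_sumr -big_split; apply: eq_bigr => i _ /=.
rewrite partial_form_wedge // wedgeDr wedgeA; congr (_ + _).
by rewrite -wedgeA (wedge_deg1C _ (@has_degree_dx R _ i)) wedgeA.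
Qed.

Lemma ext_d_cst (a : form) x : ext_d (fun=> a) x = 0.
Proof.
rewrite ext_dE big1 // => i _; rewrite (_ : partial_form _ _ _ = 0) ?wedge0r //.
by apply/ffunP => S; rewrite !ffunE derive_cst.
Qed.

Lemma fun_dE h x : fun_d h x = \sum_i 'D_(basis_vec R i) h x *: dx i.
Proof.
rewrite /fun_d ext_dE; apply: eq_bigr => i _; rewrite -wedge_form0r; congr wedge.
apply/ffunP => S; rewrite ffunE form0E; case: ifP => S0.
  by congr ('D_ _ _ _); apply/funext => y; rewrite form0E S0.
rewrite (_ : (fun y => _) = cst 0) ?derive_cst //.
by apply/funext => y; rewrite form0E S0.
Qed.

Lemma ext_dZ h F x : U x -> smooth_on U h -> smooth_form U F ->
  ext_d (fun y => h y *: F y) x = fun_d h x \w F x + h x *: ext_d F x.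
Proof.
move=> Ux sh sF; have := ext_d_wedge Ux (smooth_form0 sh) sF.
rewrite (parity_degree (has_degree_form0 (h x))) expr0 scale1r wedge_form0l => <-.
by congr (ext_d _ x); apply/funext => y; rewrite wedge_form0l.
Qed.

Lemma ext_dN F x : U x -> smooth_form U F -> ext_d (fun y => - F y) x = - ext_d F x.
Proof.
move=> Ux sF; have := ext_dZ Ux (@smooth_cst _ _ U (-1)) sF.
rewrite /fun_d ext_d_cst wedge0l add0r scaleN1r => <-.
by congr (ext_d _ x); apply/funext => y; rewrite scaleN1r.
Qed.

Lemma ext_dB F G x : U x -> smooth_form U F -> smooth_form U G ->
  ext_d (fun y => F y - G y) x = ext_d F x - ext_d G x.
Proof. by move=> Ux sF sG; rewrite ext_dD ?ext_dN //; exact: smooth_formN. Qed.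

Lemma has_degree_ext_d m F x : U x -> (forall y, U y -> has_degree m (F y)) ->
  has_degree m.+1 (ext_d F x).
Proof.
move=> Ux dF; apply: has_degree_sum => i _; apply: (@has_degree_wedge _ _ 1 m).
  exact: has_degree_dx.
move=> S nS; rewrite ffunE; rewrite (_ : 'D_ _ _ _ = 'D_(basis_vec R i) (cst (0 : R^o)) x).
  exact: derive_cst.
apply: near_eq_derive; apply: (near_open oU Ux) => y Uy; exact: dF.
Qed.

Lemma has_degree_fun_d h x : has_degree 1 (fun_d h x).
Proof. by rewrite fun_dE; apply: has_degree_sum => i _; exact/has_degreeZ/has_degree_dx. Qed.

(** A differential is closed, because second derivatives commute. *)
Lemma ext_d_fun_d h x : U x -> smooth_on U h -> ext_d (fun_d h) x = 0.
Proof.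
move=> Ux sh; pose D i := fun y => 'D_(basis_vec R i) h y.
have sD i : smooth_on U (D i) by exact: smooth_derive.
rewrite (_ : fun_d h = fun y => \sum_i D i y *: dx i); last first.
  by apply/funext => y; exact: fun_dE.
have ext_d_sum (r : seq 'I_n.+1) : ext_d (fun y => \sum_(i <- r) D i y *: dx i) x =
    \sum_(i <- r) ext_d (fun y => D i y *: dx i) x.
  elim: r => [|i r IH].
    rewrite big_nil (_ : (fun y => _) = fun=> 0) ?ext_d_cst //.
    by apply/funext => y; rewrite big_nil.
  rewrite big_cons -IH -ext_dD //.
  - by congr (ext_d _ x); apply/funext => y; rewrite big_cons.
  - exact/smooth_formZ/smooth_form_cst.
  - by apply: smooth_form_sum => j _; exact/smooth_formZ/smooth_form_cst.
rewrite ext_d_sum.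
have E i : ext_d (fun y => D i y *: dx i) x =
    \sum_j 'D_(basis_vec R j) (D i) x *: (dx j \w dx i).
  rewrite ext_dZ //; last exact: smooth_form_cst.
  rewrite ext_d_cst scaler0 addr0 fun_dE wedge_suml; apply: eq_bigr => j _.
  by rewrite wedgeZl.
rewrite (eq_bigr _ (fun i _ => E i)); set s := \sum_i _.
suff s_opp : s = - s.
  have : 2 *: s = 0 by rewrite scaler_nat mulr2n {1}s_opp addNr.
  by move/eqP; rewrite scaler_eq0 pnatr_eq0 /= => /eqP.
rewrite {1}/s exchange_big /= /s -sumrN; apply: eq_bigr => i _.
rewrite -sumrN; apply: eq_bigr => j _.
rewrite [dx i \w _](wedgeC (@has_degree_dx R _ i) (@has_degree_dx R _ j)).
have -> : 'D_(basis_vec R i) (D j) x = 'D_(basis_vec R j) (D i) x.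
  exact: (derive_comm (f := h) _ _ oU Ux sh).
by rewrite expr1 scaleN1r scalerN.
Qed.

End OnOpen.

End ExteriorDerivative.

(** * The coflow in a chart *)

Section SmoothMatrices.
Variables (R : realType) (W : normedModType R) (U : set W).
Hypothesis oU : open U.

Lemma smooth_det n (G : W -> 'M[R]_n) : (forall i j, smooth_on U (fun y => G y i j)) ->
  smooth_on U (fun y => \det (G y)).
Proof.
move=> sG; apply: (smooth_sum oU) => s _; apply: (smoothM oU); first exact: smooth_cst.
by apply: (smooth_prod oU) => i _; exact: sG.
Qed.

Lemma smooth_invmx n (G : W -> 'M[R]_n) : (forall i j, smooth_on U (fun y => G y i j)) ->
    (forall y, U y -> G y \in unitmx) ->
  forall i j, smooth_on U (fun y => invmx (G y) i j).
Proof.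
move=> sG uG i j; pose d y := \det (G y).
apply: (eq_smooth oU (f := fun y => (d y)^-1 * (\adj (G y)) i j)).
  by move=> y Uy; rewrite /invmx uG // [in RHS]mxE.
apply: (smoothM oU).
  apply: (smoothV oU) (smooth_det sG) => y Uy; rewrite -unitfE; exact: uG.
apply: (eq_smooth oU (f := fun y => (-1) ^+ (j + i) * \det (row' j (col' i (G y))))).
  by move=> y _; rewrite mxE.
apply: (smoothM oU); first exact: smooth_cst.
apply: smooth_det => k l; apply: (eq_smooth oU (f := fun y => G y (lift j k) (lift i l))) => //.
by move=> y _; rewrite !mxE.
Qed.

End SmoothMatrices.

Section DifferentialOfComposite.
Variables (R : realType) (n : nat).

Lemma fun_d_comp1 (p : R -> R) (f : 'rV[R]_n.+1 -> R) x d :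
  is_derive (f x) (1 : R) p d -> differentiable f x ->
  fun_d (fun y => p (f y)) x = d *: fun_d f x.
Proof.
move=> dp df; rewrite !fun_dE scaler_sumr; apply: eq_bigr => i _.
by rewrite (differentiable_comp1 dp df).2 scalerA.
Qed.

Lemma near_fun_d (f g : 'rV[R]_n.+1 -> R) x : (\near x, f x = g x) -> fun_d f x = fun_d g x.
Proof.
by move=> fg; rewrite !fun_dE; apply: eq_bigr => i _; rewrite (near_eq_derive _ fg).
Qed.

Lemma fun_d_cst (a : R) (x : 'rV[R]_n.+1) : fun_d (fun=> a) x = 0.
Proof. by rewrite fun_dE big1 // => i _; rewrite derive_cst scale0r. Qed.

End DifferentialOfComposite.

Lemma frame_horizontal (R : realType) (xi : 'rV[R]_7) (e w re im : ext_form R 7) h P b b0 :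
    adapted_frame xi e w re im h P -> pull_form P b = b0 -> int_prod (evec 0) b0 = 0 ->
  int_prod xi b = 0.
Proof.
move=> [[uP hgt0] ePxi _ _] <- b0xi; apply: (pull_form_inj uP).
have -> : xi = h *: row 0 P by rewrite ePxi scalerA mulfV ?scale1r // gt_eqF.
by rewrite int_prodZl linearZ /= -int_prod_pull_form_row b0xi scaler0 linear0.
Qed.

Lemma is_derive_quadratic (R : realType) (a b c s : R) :
  is_derive s (1 : R) (fun t : R => a + b * t + c * t ^+ 2) (b + 2 * c * s).
Proof.
have -> : (fun t : R => a + b * t + c * t ^+ 2) = cst a + b *: (id : R -> R) + c *: ((id : R -> R) * id).
  by apply/funext => t /=; rewrite expr2.
have di : is_derive s (1 : R) (id : R -> R) 1 by exact: is_derive_id.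
have D := is_deriveD (is_deriveD (is_derive_cst a s 1) (is_deriveZ b di)) (is_deriveZ c (is_deriveM di di)).
have E (x y : R) : x *: (y : R^o) = x * y by [].
have <- : 0 + b *: (1 : R^o) + c *: (s *: (1 : R^o) + s *: (1 : R^o)) = b + 2 * c * s by rewrite !E; ring.
exact: D.
Qed.

Lemma is_derive_inv (R : realType) (s : R) : s != 0 ->
  is_derive s (1 : R) (fun t : R => t^-1) (- s ^- 2).
Proof.
move=> s0; have di : is_derive s (1 : R) (id : R -> R) 1 by exact: is_derive_id.
by have := is_deriveV s0 di; rewrite /GRing.scale /= mulr1.
Qed.

Lemma hodge0 (R : realType) (p : ext_form R 7) : hodge p 0 = 0.
Proof. 
apply/ffunP => S; rewrite zero_formE ffunE /= (_ : eval_form _ _ = 0) ?mulr0 //.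
exact: eval_form0. Qed.

(** The data of the theorem at a fixed time, in a single chart. *)
Section ChartStructure.
Variables (R : realType) (U : set 'rV[R]_7) (xi : 'rV[R]_7 -> 'rV[R]_7).
Variables (e w re im : 'rV[R]_7 -> ext_form R 7) (h : 'rV[R]_7 -> R).
Hypothesis oU : open U.
Hypothesis AF : forall x, U x -> exists P, adapted_frame (xi x) (e x) (w x) (re x) (im x) (h x) P.
Hypotheses (se : smooth_form U e) (sw : smooth_form U w).
Hypotheses (sre : smooth_form U re) (sim : smooth_form U im).
Hypothesis de : forall x, U x -> ext_d e x = w x.
Hypotheses (dw : forall x, U x -> ext_d w x = 0) (dre : forall x, U x -> ext_d re x = 0).
Hypothesis dim : forall x, U x -> ext_d im x = 0.
Variable A : R.

Let phi x := (h x)^-1 *: re x + h x *: (e x \w w x).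
Let th := fun_d (fun x => ln (h x)).
Let X := gradient phi (fun x => ln (h x)).
Let ka x := int_prod (X x) (w x).
Let psi := hodge_field phi phi.

Lemma chart_h_gt0 x : U x -> 0 < h x.
Proof. by move=> Ux; have [P [[]]] := AF Ux. Qed.

Let h0 x : U x -> h x != 0. Proof. by move=> Ux; exact/lt0r_neq0/chart_h_gt0. Qed.

Let sw2 : smooth_form U (fun x => w x \w w x).
Proof. exact: smooth_form_wedge. Qed.

Let sw3 : smooth_form U (fun x => w x \w w x \w w x).
Proof. exact: smooth_form_wedge. Qed.

Let sew : smooth_form U (fun x => e x \w w x).
Proof. exact: smooth_form_wedge. Qed.

Let sreim : smooth_form U (fun x => re x \w im x).
Proof. exact: smooth_form_wedge. Qed.

Let w3E x : U x -> re x \w im x = (2 / 3 * h x ^+ 2) *: (w x \w w x \w w x).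
Proof.
move=> Ux; have [P F] := AF Ux; rewrite (frame_w3 F) scalerA -[LHS]scale1r; congr (_ *: _).
by field; rewrite h0.
Qed.

Let w3_neq0 x : U x -> (e x \w w x \w w x \w w x) finset.setT != 0.
Proof.
move=> Ux; have [P F] := AF Ux; apply: contraTneq isT => e0; have := frame_e_w3_top F.
move/eqP; rewrite e0 mulr0 eq_sym mulf_eq0 pnatr_eq0 /=.
by rewrite (negPf (frame_det_neq0 F)).
Qed.

(** By frame_w3 the square of h is a quotient of coefficients of top forms. *)
Lemma smooth_norm : smooth_on U h.
Proof.
pose q x := 3 / 2 * ((e x \w re x \w im x) finset.setT * ((e x \w w x \w w x \w w x) finset.setT)^-1).
have qE x : U x -> q x = h x ^+ 2.
  move=> Ux; rewrite /q w3E // wedgeZr scale_formE; field.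
  exact: w3_neq0.
apply: (eq_smooth oU (f := fun x => Num.sqrt (q x))).
  by move=> x Ux; rewrite qE // sqrtr_sqr ger0_norm // ltW // chart_h_gt0.
apply: (smooth_sqrt oU) => [x Ux|].
  by rewrite qE // exprn_gt0 // chart_h_gt0.
apply: (smoothM oU); first exact: smooth_cst.
apply: (smoothM oU); first exact: (smooth_form_wedge oU se sreim).
by apply: (smoothV oU) => //; exact: (smooth_form_wedge oU se sw3).
Qed.

Let sh := smooth_norm.
Let shV : smooth_on U (fun x => (h x)^-1).
Proof. exact: (smoothV oU h0 sh). Qed.
Let sln : smooth_on U (fun x => ln (h x)).
Proof. exact: (smooth_ln oU chart_h_gt0 sh). Qed.
Let sth : smooth_form U th.
Proof. exact: smooth_fun_d. Qed.
Let th1 x : has_degree 1 (th x). Proof. exact: has_degree_fun_d. Qed.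
Let dth x : U x -> ext_d th x = 0.
Proof. by move=> Ux; exact: ext_d_fun_d Ux sln. Qed.

Lemma smooth_g2_form : smooth_form U phi.
Proof. by apply: smooth_formD => //; exact: smooth_formZ. Qed.

Let dh x : U x -> fun_d h x = h x *: th x.
Proof.
move=> Ux; rewrite /th (fun_d_comp1 (is_derive1_ln (chart_h_gt0 Ux))); last exact: (smooth_diff sh).
by rewrite scalerA mulfV ?h0 // scale1r.
Qed.

Let dhp (p : R -> R) d x : U x -> is_derive (h x) (1 : R) p d ->
  fun_d (fun y => p (h y)) x = (d * h x) *: th x.
Proof.
by move=> Ux dp; rewrite (fun_d_comp1 dp) ?dh ?scalerA //; exact: (smooth_diff sh).
Qed.

Let dhq (a b c : R) x : U x ->
  fun_d (fun y => a + b * h y + c * h y ^+ 2) x = ((b + 2 * c * h x) * h x) *: th x.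
Proof. by move=> Ux; exact: dhp Ux (is_derive_quadratic a b c (h x)). Qed.

Let shq (a b c : R) : smooth_on U (fun y => a + b * h y + c * h y ^+ 2).
Proof.
apply: (smoothD oU).
  by apply: (smoothD oU); [exact: smooth_cst|apply: (smoothM oU) => //; exact: smooth_cst].
by apply: (smoothM oU); [exact: smooth_cst|exact: (smoothM oU)].
Qed.

Let dw2 x : U x -> ext_d (fun y => w y \w w y) x = 0.
Proof. by move=> Ux; rewrite (ext_d_wedge Ux) // dw // wedge0l wedge0r addr0. Qed.

Let dw3 x : U x -> ext_d (fun y => w y \w w y \w w y) x = 0.
Proof. by move=> Ux; rewrite (ext_d_wedge Ux) // dw // dw2 // wedge0l wedge0r addr0. Qed.

Lemma chart_w_xi x : U x -> int_prod (xi x) (w x) = 0.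
Proof.
move=> Ux; have [P F] := AF Ux; apply: (frame_horizontal F) (int_prod_std_w R).
by case: F => _ _ _ [].
Qed.

Let xi_w2 x : U x -> int_prod (xi x) (w x \w w x) = 0.
Proof. by move=> Ux; rewrite int_prod_wedge chart_w_xi // wedge0l wedge0r addr0. Qed.

Let xi_w3 x : U x -> int_prod (xi x) (w x \w w x \w w x) = 0.
Proof. by move=> Ux; rewrite int_prod_wedge chart_w_xi // xi_w2 // wedge0l wedge0r addr0. Qed.

(** The norm is a basic function, as its square compares the closed forms re im and w^3. *)
Lemma chart_th_xi x : U x -> int_prod (xi x) (th x) = 0.
Proof.
move=> Ux; have : ext_d (fun y => re y \w im y) x = 0.
  by rewrite (ext_d_wedge Ux) // dre // dim // wedge0l wedge0r addr0.
rewrite (eq_ext_d oU (G := fun y => (0 + 0 * h y + 2 / 3 * h y ^+ 2) *: (w y \w w y \w w y)) Ux).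
  rewrite (ext_dZ oU Ux (shq _ _ _) sw3) dw3 // scaler0 addr0 dhq // wedgeZl => /eqP.
  rewrite scaler_eq0 mulf_eq0 add0r !mulf_eq0 invr_eq0 !pnatr_eq0 (negPf (h0 Ux)) /=.
  move=> /eqP/(congr1 (int_prod (xi x))).
  rewrite int_prod_wedge xi_w3 // wedge0r addr0 linear0.
  have -> : int_prod (xi x) (th x) = form0 (int_prod (xi x) (th x) finset.set0).
    apply/ffunP => S; rewrite form0E; case: eqP => [->//|/eqP S0].
    by rewrite (has_degree_int_prod _ (@th1 x)) // cards_eq0.
  rewrite wedge_form0l => /eqP; rewrite scaler_eq0 => /orP[/eqP->|/eqP w30]; first exact: raddf0.
  by have /eqP[] := w3_neq0 Ux; rewrite w30 wedge0r zero_formE.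
by move=> y Uy; rewrite w3E //; congr (_ *: _); ring.
Qed.

Let dphi x : U x -> ext_d phi x =
  - ((h x)^-1 *: (th x \w re x)) + h x *: (th x \w e x \w w x) + h x *: (w x \w w x).
Proof.
move=> Ux; rewrite (ext_dD Ux (smooth_formZ oU shV sre) (smooth_formZ oU sh sew)).
rewrite (ext_dZ oU Ux shV sre) (ext_dZ oU Ux sh sew) dre // scaler0 addr0 dh //.
rewrite (dhp Ux (is_derive_inv (h0 Ux))) (ext_d_wedge Ux se sw) dw // de // wedge0r addr0.
rewrite !wedgeZl !addrA -scaleNr; congr (_ *: _ + _ + _); field; exact: h0.
Qed.

Lemma chart_psiE x : U x -> psi x = 2^-1 *: (w x \w w x) - e x \w im x.
Proof. by move=> Ux; have [P F] := AF Ux; exact: frame_star_phi F. Qed.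

Lemma chart_dpsi x : U x -> ext_d psi x = 0.
Proof.
move=> Ux; have sei := smooth_form_wedge oU se sim; have [P F] := AF Ux.
rewrite (eq_ext_d oU Ux chart_psiE) (ext_dB oU Ux) //; last first.
  by apply: smooth_formZ => //; exact: smooth_cst.
rewrite (ext_dZ oU Ux (@smooth_cst _ _ U 2^-1) sw2) dw2 // scaler0 addr0 fun_d_cst wedge0l sub0r.
by rewrite (ext_d_wedge Ux) // de // dim // wedge0r addr0 (frame_w_im F) oppr0.
Qed.

Let hodge_psi x : U x -> hodge_field phi psi x = phi x.
Proof.
by move=> Ux; have [P F] := AF Ux; rewrite /hodge_field chart_psiE //; exact: frame_star_psi F.
Qed.

Let tau0E x : U x -> tau0 phi x = 7^-1 * (6 * h x).
Proof.
move=> Ux; have [P F] := AF Ux; rewrite /tau0 dphi //; congr (_ * _).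
exact: (frame_tau0 F (@th1 x)).
Qed.

Let codiff_psi x : U x -> codiff phi 4 psi x =
  e x \w int_prod (X x) (im x) - ka x \w w x + (2 * h x ^+ 2) *: (e x \w w x).
Proof.
(* The sign of codiff on 4-forms is (-1) ^ (7 * 5 + 1), and 36 = 2 * 18. *)
move=> Ux; have [P F] := AF Ux; rewrite /codiff (signr_double _ 18) scale1r.
rewrite {1}/hodge_field (eq_ext_d oU Ux hodge_psi) dphi //.
exact: (frame_star_dphi F (@th1 x) (chart_th_xi Ux)).
Qed.

(** By frame_g2_metric the metric is rational in the coefficients of the forms. *)
Lemma smooth_g2_metric i j : smooth_on U (fun y => g2_metric (phi y) i j).
Proof.
have sphi := smooth_g2_form.
have sip k : smooth_form U (fun y => int_prod (evec k) (phi y)).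
  by apply: smooth_form_int_prod => // l; exact: smooth_cst.
pose a y := (int_prod (evec i) (phi y) \w int_prod (evec j) (phi y) \w phi y) finset.setT.
pose b y := h y * (e y \w w y \w w y \w w y) finset.setT.
apply: (eq_smooth oU (f := fun y => a y * (b y)^-1)).
  by move=> y Uy; have [P F] := AF Uy; rewrite (frame_g2_metric F).
apply: (smoothM oU).
  exact: (smooth_form_wedge oU (sip i) (smooth_form_wedge oU (sip j) sphi)).
apply: (smoothV oU) => [y Uy|]; first by rewrite mulf_neq0 ?h0 ?w3_neq0.
by apply: (smoothM oU) => //; exact: (smooth_form_wedge oU se sw3).
Qed.

Lemma smooth_gradient : smooth_vf U X.
Proof.
move=> k; pose t i y := th y [set i]%SET * invmx (g2_metric (phi y)) i k.
apply: (eq_smooth oU (f := fun y => \sum_i t i y)).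
  by move=> y _; rewrite /X /gradient mxE; apply: eq_bigr => i _; rewrite mxE.
apply: (smooth_sum oU) => i _; apply: (smoothM oU); first exact: sth.
apply: smooth_invmx => // [|y Uy]; first exact: smooth_g2_metric.
by have [P F] := AF Uy; exact: frame_g2_unitmx F.
Qed.

Let a x := int_prod (X x) (im x).

(** A potential of the right-hand side of the modified coflow, which is exact because psi is
    closed. *)
Let al x := e x \w a x - ka x \w w x + (2 * h x ^+ 2) *: (e x \w w x) + (A - 3 * h x) *: phi x.

Let sa : smooth_form U a. Proof. exact: (smooth_form_int_prod oU smooth_gradient sim). Qed.
Let ska : smooth_form U ka. Proof. exact: (smooth_form_int_prod oU smooth_gradient sw). Qed.

Let sp2 : smooth_on U (fun x => 2 * h x ^+ 2).
Proof. by apply: (eq_smooth oU _ (shq 0 0 2)) => x _; rewrite mul0r !add0r. Qed.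

Let sp1 : smooth_on U (fun x => A - 3 * h x).
Proof. by apply: (eq_smooth oU _ (shq A (-3) 0)) => x _; rewrite mul0r addr0 mulNr. Qed.

Let scod : smooth_form U (fun x => e x \w a x - ka x \w w x + (2 * h x ^+ 2) *: (e x \w w x)).
Proof.
apply: (smooth_formD oU); last exact: (smooth_formZ oU sp2 sew).
by apply: (smooth_formD oU); [|apply: (smooth_formN oU)]; exact: smooth_form_wedge.
Qed.

Definition coflow_rhs x :=
  laplacian phi 4 psi x + ext_d (fun y => (A - 7 / 2 * tau0 phi y) *: phi y) x.

Let rhsE x : U x -> coflow_rhs x = ext_d al x.
Proof.
move=> Ux; rewrite /coflow_rhs /laplacian (eq_ext_d oU Ux codiff_psi).
have -> : codiff phi 5 (ext_d psi) x = 0.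
  rewrite /codiff /hodge_field (eq_ext_d oU (G := fun=> 0) Ux) => [|y Uy].
    by rewrite ext_d_cst hodge0 scaler0.
  by rewrite chart_dpsi // hodge0.
rewrite addr0 (eq_ext_d oU (F := fun y => (A - 7 / 2 * tau0 phi y) *: phi y)
  (G := fun y => (A - 3 * h y) *: phi y) Ux) => [|y Uy].
  by rewrite -(ext_dD Ux scod (smooth_formZ oU sp1 smooth_g2_form)).
by rewrite tau0E //; congr (_ *: _); field.
Qed.

Let w_re x : U x -> w x \w re x = 0.
Proof. by move=> Ux; have [P F] := AF Ux; exact: frame_w_re F. Qed.

Let ka_im x : U x -> ka x \w im x = th x \w re x.
Proof.
by move=> Ux; have [P F] := AF Ux; exact: (frame_grad_w_im F (@th1 x) (chart_th_xi Ux)).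
Qed.

(** Contract w /\ im = 0 with X. *)
Lemma chart_a_w x : U x -> a x \w w x = - (th x \w re x).
Proof.
move=> Ux; have [P F] := AF Ux; have := congr1 (int_prod (X x)) (frame_w_im F).
have dka : has_degree 1 (ka x) by apply: has_degree_int_prod; exact: frame_degree_w F.
rewrite int_prod_wedge linear0 (parity_degree (frame_degree_w F)) expr2 mulrNN mulr1 scale1r.
rewrite -/(ka x) -/(a x) ka_im // => /eqP; rewrite addr_eq0 => /eqP ->.
rewrite opprK; apply: wedge_deg2C (frame_degree_w F) _.
exact: has_degree_int_prod (frame_degree_im F).
Qed.

Lemma chart_d_th_re x : U x -> ext_d (fun y => th y \w re y) x = 0.
Proof. by move=> Ux; rewrite (ext_d_wedge Ux) // dth // dre // wedge0l wedge0r addr0. Qed.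

(** Where th does not vanish, h = A / 2, so h is locally constant there and th
    vanishes after all. *)
Lemma chart_th_eq0 : (forall x, U x -> (A * h x - 2 * h x ^+ 2) *: th x = 0) ->
  forall x, U x -> th x = 0.
Proof.
move=> H x Ux; apply/eqP/negPn/negP => /eqP th0.
have [S thS] : exists S, th x S != 0.
  apply: contra_notP th0 => nS; apply/ffunP => S; rewrite zero_formE; apply/eqP/negPn/negP => tS.
  by apply: nS; exists S.
have cth : {for x, continuous (fun y => th y S)}.
  by apply: differentiable_continuous; exact: (smooth_diff (sth S)).
have Hh y : U y -> th y S != 0 -> h y = A / 2.
  move=> Uy tS; have /ffunP/(_ S) := H y Uy; rewrite scale_formE zero_formE => /eqP.
  rewrite mulf_eq0 (negPf tS) orbF.
  have -> : A * h y - 2 * h y ^+ 2 = 2 * h y * (A / 2 - h y) by field.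
  by rewrite !mulf_eq0 pnatr_eq0 (negPf (h0 Uy)) /= subr_eq0 => /eqP.
have : th x = 0.
  rewrite /th (near_fun_d (g := fun=> ln (A / 2))) ?fun_d_cst //.
  have nz : \forall y \near x, th y S != 0.
    have p0 : 0 < `|th x S| by rewrite normr_gt0.
    have [r r0 hr] := near_ball oU Ux cth cth p0.
    apply/nbhs_ballP; exists r => // y /hr[_ + _].
    by apply: contraTneq => ->; rewrite subr0 ltxx.
  by apply: filterS2 nz (open_nbhs_nbhs (conj oU Ux)) => y tS Uy; rewrite Hh.
exact: th0.
Qed.

(* Since ka /\ im = th /\ re is closed, d ka /\ im = 0; contraction with xi
   leaves a horizontal one-form that im annihilates. *)
Let dka_xi x : U x -> int_prod (xi x) (ext_d ka x) = 0.
Proof.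
move=> Ux; have [P F] := AF Ux; apply: (frame_im_inj F).
- apply: has_degree_int_prod; apply: (has_degree_ext_d oU Ux) => y Uy.
  by have [Q G] := AF Uy; apply: has_degree_int_prod; exact: frame_degree_w G.
- exact: int_prod_sqr.
have : ext_d ka x \w im x = 0.
  have := chart_d_th_re Ux; rewrite -(eq_ext_d oU Ux ka_im) (ext_d_wedge Ux) // dim //.
  by rewrite wedge0r addr0.
move/(congr1 (int_prod (xi x))); rewrite int_prod_wedge linear0.
rewrite (frame_horizontal (b := im x) F (b0 := h x *: std_im R)) ?wedge0r ?addr0 //.
  by case: F => _ _ _ [].
by rewrite linearZ /= int_prod_std_im scaler0.
Qed.

(** The wedge of the potential with w is
    - e /\ th /\ re - ka /\ w^2 + (A h - h^2) e /\ w^2; after differentiation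
    and contraction with xi, only the differential of the last coefficient,
    (A h - 2 h^2) th, survives. *)
Lemma coflow_th_eq0 : (forall x, U x -> int_prod (xi x) (coflow_rhs x \w w x) = 0) ->
  forall x, U x -> th x = 0.
Proof.
move=> H; apply: chart_th_eq0 => x Ux; have [P F] := AF Ux.
pose g y := 0 + A * h y + (-1) * h y ^+ 2.
have alw y : U y -> al y \w w y =
    - (e y \w th y \w re y) - ka y \w w y \w w y + g y *: (e y \w w y \w w y).
  move=> Uy; have rew : re y \w w y = 0.
    have [Q G] := AF Uy; rewrite -(w_re Uy); exact: wedge_deg2C (frame_degree_w G) (frame_degree_re G).
  rewrite /al /phi !wedgeDl wedgeNl !wedgeZl wedgeDl !wedgeZl !wedgeA rew scaler0 add0r.
  rewrite chart_a_w // wedgeNr -addrA; congr (_ + _).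
  rewrite !scalerA -scalerDl; congr (_ *: _); rewrite /g; ring.
have sthre : smooth_form U (fun y => th y \w re y) by exact: smooth_form_wedge.
have sethre : smooth_form U (fun y => e y \w th y \w re y) by exact: smooth_form_wedge.
have skaw : smooth_form U (fun y => ka y \w w y \w w y) by exact: smooth_form_wedge.
have sew2 : smooth_form U (fun y => e y \w w y \w w y) by exact: smooth_form_wedge.
have sal : smooth_form U al.
  by apply: (smooth_formD oU) => //; exact: (smooth_formZ oU sp1 smooth_g2_form).
have : int_prod (xi x) (ext_d (fun y => al y \w w y) x) = 0.
  by rewrite (ext_d_wedge Ux) // dw // wedge0r addr0 -rhsE // H.
have exi := frame_int_prod_e F; have e1 := frame_degree_e F.
rewrite (eq_ext_d oU Ux alw) (ext_dD Ux); first last.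
- by apply: (smooth_formZ oU) => //; exact: shq.
- by apply: (smooth_formD oU); exact: (smooth_formN oU).
rewrite (ext_dB oU Ux) //; last exact: (smooth_formN oU).
rewrite (ext_dN oU Ux) // (ext_d_wedge (F := e) Ux) // de // chart_d_th_re // wedge0r addr0.
rewrite (ext_d_wedge (F := ka) Ux) // dw2 // wedge0r addr0.
rewrite (ext_dZ oU Ux) //; last exact: shq.
rewrite (ext_d_wedge (F := e) Ux) // de // dw2 // wedge0r addr0 dhq // !linearD !linearN /=.
rewrite [w x \w th x \w re x](_ : _ = 0) ?linear0 ?oppr0 ?sub0r; last first.
  by rewrite -wedgeA -(wedge_deg2C (frame_degree_w F) (@th1 x)) wedgeA w_re // wedge0r.
rewrite [int_prod _ (ext_d ka x \w _)]int_prod_wedge dka_xi // xi_w2 // wedge0l wedge0r addr0.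
rewrite oppr0 add0r linearZ /= xi_w3 // scaler0 addr0 wedgeZl linearZ /= int_prod_wedge.
rewrite chart_th_xi // wedge0l add0r int_prod_wedge exi xi_w2 // wedge0r addr0 wedge_form0l.
rewrite scale1r (parity_degree (@th1 x)) expr1 scaleN1r wedgeNl scalerN => /eqP.
rewrite oppr_eq0 => /eqP gw.
have -> : A * h x - 2 * h x ^+ 2 = (A + 2 * -1 * h x) * h x by ring.
apply: (frame_w2_inj F).
- exact/has_degreeZ/th1.
- by rewrite linearZ /= chart_th_xi // scaler0.
- by rewrite wedgeZl.
Qed.

(** The Lie derivative contributes d((X _| im) /\ w) = - d(th /\ re) = 0. *)
Lemma lie_im_th_eq0 : (forall x, U x ->
    (lie_d X im x + ((A * h x) *: (th x \w w x) - (2 * h x ^+ 2) *: (th x \w w x))) \w w x = 0) ->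
  forall x, U x -> th x = 0.
Proof.
move=> H; apply: chart_th_eq0 => x Ux; have [P F] := AF Ux.
have saw : ext_d a x \w w x = 0.
  have sthre : smooth_form U (fun y => th y \w re y) by exact: smooth_form_wedge.
  have := ext_d_wedge Ux sa sw; rewrite dw // wedge0r addr0 => <-.
  by rewrite (eq_ext_d oU Ux chart_a_w) (ext_dN oU Ux) // chart_d_th_re // oppr0.
have := H x Ux; rewrite /lie_d -/(a) dim // linear0 addr0 wedgeDl saw add0r.
rewrite -scalerBl wedgeZl wedgeA => E; apply: (frame_w2_inj F).
- exact/has_degreeZ/th1.
- by rewrite linearZ /= chart_th_xi // scaler0.
- by rewrite wedgeZl.
Qed.

Lemma gradient_eq0 x : th x = 0 -> X x = 0.
Proof.
move=> H; rewrite /X /gradient (_ : \row_i _ = 0) ?mul0mx //.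
by apply/rowP => i; rewrite !mxE -/(th x) H zero_formE.
Qed.

Lemma coflow_rhs_th0 x : (forall y, U y -> th y = 0) -> U x ->
  coflow_rhs x = (A * h x - h x ^+ 2) *: (w x \w w x).
Proof.
move=> H Ux; have X0 y : U y -> X y = 0 by move=> Uy; exact/gradient_eq0/H.
have alE y : U y -> al y = (0 + 0 * h y + 2 * h y ^+ 2) *: (e y \w w y)
    + (A + (-3) * h y + 0 * h y ^+ 2) *: phi y.
  move=> Uy; rewrite /al /ka /a X0 // !int_prod0l wedge0l wedge0r subr0 add0r.
  by congr (_ *: _ + _ *: _); ring.
rewrite rhsE // (eq_ext_d oU Ux alE) (ext_dD Ux); first last.
- by apply: (smooth_formZ oU (shq _ _ _)); exact: smooth_g2_form.
- exact: (smooth_formZ oU (shq _ _ _)).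
rewrite (ext_dZ oU Ux (shq _ _ _) sew) (ext_dZ oU Ux (shq _ _ _) smooth_g2_form).
rewrite !dhq // H // !scaler0 !wedge0l !add0r (ext_d_wedge Ux) // de // dw // wedge0r addr0.
rewrite dphi // H // !wedge0l !scaler0 oppr0 !add0r scalerA -scalerDl; congr (_ *: _); ring.
Qed.

Lemma lie_d_eq0 F x : (forall y, U y -> X y = 0) -> U x -> lie_d X F x = 0.
Proof.
move=> X0 Ux; rewrite /lie_d X0 // int_prod0l addr0 (eq_ext_d oU (G := fun=> 0) Ux).
  exact: ext_d_cst.
by move=> y Uy; rewrite X0 // int_prod0l.
Qed.

(** Both conditions force th = 0, after which they agree: contraction with xi separates the
    component e /\ gim from the transverse ones. *)
Lemma chart_coflow_iff (F0 d0 beta gim ed : 'rV[R]_7 -> ext_form R 7) :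
    (forall x, U x -> int_prod (xi x) (beta x) = 0) ->
    (forall x, U x -> int_prod (xi x) (gim x) = 0) ->
    (forall x, U x -> int_prod (xi x) (ed x) = 0) ->
    (forall x, U x -> has_degree 1 (ed x)) ->
    (forall x, U x -> int_prod (xi x) (- lie_d X w x + beta x) = 0) ->
    (forall x, U x -> (lie_d X im x + gim x) \w w x = 0) ->
  (forall x, U x -> coflow_rhs x = (- lie_d X w x + beta x) \w w x -
     (ed x \w im x + e x \w (lie_d X im x + gim x))) <->
  (forall x, U x ->
     beta x \w w x = - (h x ^+ 2 *: (w x \w w x)) + (A * h x) *: (w x \w w x)
       - (A / h x) *: (th x \w re x) - lie_d X F0 x \w im x
       - int_prod (X x) (d0 x) \w im x + ed x \w im x /\
     gim x = - ((2 * h x ^+ 2) *: (th x \w w x)) + (A * h x) *: (th x \w w x)).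
Proof.
move=> xi_b xi_g xi_ed ed1 xi_wd im_w; split=> H.
  have th0 : forall x, U x -> th x = 0.
    apply: coflow_th_eq0 => x Ux; have [P F] := AF Ux; rewrite H //.
    have imw : im x \w w x = 0.
      by rewrite (wedge_deg2C (frame_degree_w F) (frame_degree_im F)) (frame_w_im F).
    move: (xi_wd _ Ux) (im_w _ Ux).
    move: (- lie_d X w x + _) (lie_d X im x + _) => wd idt xw iw; rewrite wedgeBl wedgeDl !wedgeA iw imw !wedge0r addr0 subr0.
    by rewrite int_prod_wedge xw xi_w2 // wedge0l wedge0r addr0.
  have X0 x (Ux : U x) : X x = 0 by exact/gradient_eq0/th0.
  move=> x Ux; have [P F] := AF Ux; have := H x Ux.
  rewrite coflow_rhs_th0 // !lie_d_eq0 // oppr0 !add0r => E.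
  have xi_im : int_prod (xi x) (im x) = 0.
    apply: (frame_horizontal F (b0 := h x *: std_im R)); first by case: F => _ _ _ [].
    by rewrite linearZ /= int_prod_std_im scaler0.
  have g0 : gim x = 0.
    have := congr1 (int_prod (xi x)) E.
    rewrite linearZ /= xi_w2 // scaler0 linearB linearD /= !int_prod_wedge xi_b // chart_w_xi //.
    rewrite xi_ed // xi_im xi_g // (frame_int_prod_e F) !wedge0r !wedge0l !addr0 sub0r add0r.
    by rewrite wedge_form0l scale1r => /esym/eqP; rewrite oppr_eq0 => /eqP.
  rewrite g0 th0 // !wedge0l !scaler0 oppr0 !addr0; split=> //.
  move: E; rewrite X0 // int_prod0l wedge0l !subr0 g0 wedge0r addr0 => /eqP.
  by rewrite eq_sym subr_eq => /eqP ->; rewrite scalerBl [- (_ *: _) + _]addrC ?addr0.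
have th0 : forall x, U x -> th x = 0.
  apply: lie_im_th_eq0 => x Ux; have := im_w x Ux; have [_ ->] := H x Ux.
  by rewrite [- _ + _]addrC.
have X0 x (Ux : U x) : X x = 0 by exact/gradient_eq0/th0.
move=> x Ux; have [Eb Eg] := H x Ux.
rewrite coflow_rhs_th0 // !lie_d_eq0 // oppr0 !add0r Eb Eg !lie_d_eq0 // X0 // th0 //.
rewrite int_prod0l !wedge0l !scaler0 oppr0 !addr0 wedge0r addr0 addrK.
by rewrite scalerBl addrC.
Qed.

End ChartStructure.

(** * Change of charts *)

Section Charts.
Variables (R : realType) (n : nat) (M : smooth_manifold R n).
Local Notation V := 'rV[R]_n.+1.
Implicit Types (c : chart M) (x : V) (f : point_of M -> R) (Phi : chartwise M 'M[R]_n.+1).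

(** On one-forms, part01 - part10 is i times the pull-back by Phi. *)
Lemma dc_opE Phi f c x :
  dc_op Phi f c x = - (2^-1 *: pull_form (Phi c x) (fun_d (fun_field f c) x)).
Proof.
rewrite /dc_op /part01 /part10; set df := fun_d _ x.
have <- : cplx_form (pull_form (Phi c x) df) = pull_form (cPhi Phi c x) (cplx_form df).
  exact: (map_form_pull (real_complex R)).
set p := pull_form _ _; apply/ffunP => S.
rewrite opp_formE scale_formE !(ffunE, scale_formE, add_formE, opp_formE).
rewrite -/(p S) [eval_form _ _](_ : _ = p S) ?ffunE //; move: (df S) (p S) => a b.
by simpc => /=; field.
Qed.

Lemma has_degree_dc_op Phi f c x : has_degree 1 (dc_op Phi f c x).
Proof.
rewrite dc_opE; apply/has_degreeN/has_degreeZ/has_degree_pull_form; exact: has_degree_fun_d.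
Qed.

Lemma smooth_dc_op Phi f c : (forall i j, smooth_on (img c) (fun y => Phi c y i j)) ->
  smooth_on (img c) (fun_field f c) -> smooth_form (img c) (dc_op Phi f c).
Proof.
move=> sP sf; have oU := @open_img _ _ _ c.
pose g i y := 'D_(basis_vec R i) (fun_field f c) y.
apply: (eq_smooth_form oU (F := fun y =>
    - (2^-1 *: \sum_i g i y *: (\sum_j Phi c y j i *: dx j)))).
  move=> y _; rewrite dc_opE fun_dE [pull_form _ _]linear_sum; congr (- (_ *: _)).
  by apply: eq_bigr => i _; rewrite linearZ /= pull_form_dx.
apply: (smooth_formN oU); apply: (smooth_formZ oU); first exact: smooth_cst.
apply: (smooth_form_sum oU) => i _; apply: (smooth_formZ oU); first exact: smooth_derive.
apply: (smooth_form_sum oU) => j _; apply: (smooth_formZ oU) => //.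
exact: smooth_form_cst.
Qed.

Lemma open_overlap (c c' : chart M) : open (overlap c c').
Proof.
rewrite openE => x [Ux dx]; rewrite /interior; apply: filterI.
  exact: (open_nbhs_nbhs (conj (@open_img _ _ _ c) Ux)).
apply: (param_continuous Ux); apply: open_nbhs_nbhs; split=> //; exact: open_dom.
Qed.

Lemma transition_img (c c' : chart M) x : overlap c c' x ->
  img c' (transition c c' x) /\ param c' (transition c c' x) = param c x.
Proof. by move=> [_ dx]; exact: coordP dx. Qed.

Lemma differentiable_transition (c c' : chart M) x : overlap c c' x ->
  differentiable (transition c c') x.
Proof.
move=> ox; have -> : transition c c' =
    \sum_(j < n.+1) (fun y => (transition c c' y 0 j) *: (delta_mx 0 j : V)).
  by apply/funext => y; rewrite fct_sumE [LHS]row_sum_delta.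
apply: differentiable_sum => j; apply: differentiableZl.
exact: (smooth_diff (@transition_smooth _ _ _ c c' j) ox).
Qed.

(** The chain rule; the derivative of the transition map acts on row vectors by jac. *)
Lemma fun_d_transition f (c c' : chart M) x : smooth_on (img c') (fun_field f c') ->
    overlap c c' x ->
  fun_d (fun_field f c) x = pull_form (jac c c' x) (fun_d (fun_field f c') (transition c c' x)).
Proof.
move=> sf ox; have [Ux' _] := transition_img ox.
have df := smooth_diff sf Ux'; have dt := differentiable_transition ox.
rewrite (near_fun_d (g := fun_field f c' \o transition c c')); last first.
  apply: (near_open (@open_overlap c c') ox) => y oy /=.
  by rewrite /fun_field (transition_img oy).2.
rewrite !fun_dE linear_sum.
under [RHS]eq_bigr do rewrite linearZ /= pull_form_dx scaler_sumr.
rewrite exchange_big; apply: eq_bigr => i _ /=.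
under eq_bigr do rewrite scalerA.
rewrite -scaler_suml; congr (_ *: _).
rewrite deriveE; last exact: differentiable_comp.
rewrite diff_comp //= -[X in 'd _ _ X]deriveE // deriveEjacobian // /basis_vec -rowE.
rewrite [row _ _]row_sum_delta linear_sum; apply: eq_bigr => j _.
by rewrite linearZ /= -deriveE // mxE mulrC.
Qed.


Lemma dc_op_transition Phi f (c c' : chart M) x :
    smooth_on (img c') (fun_field f c') -> overlap c c' x ->
    Phi c x *m jac c c' x = jac c c' x *m Phi c' (transition c c' x) ->
  dc_op Phi f c x = pull_form (jac c c' x) (dc_op Phi f c' (transition c c' x)).
Proof.
move=> sf ox eP; rewrite !dc_opE (fun_d_transition sf ox) [in RHS]linearN [in RHS]linearZ /=.
by rewrite !pull_form_comp eP.
Qed.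

End Charts.

(** By frame_w3 the norm is determined by w, re and im, and so is natural. *)
Lemma frame_norm_natural (R : realType) (J : 'M[R]_7) xi e w re im h P xi' e' w' re' im' h' P' :
    adapted_frame xi e w re im h P -> adapted_frame xi' e' w' re' im' h' P' ->
    w = pull_form J w' -> re = pull_form J re' -> im = pull_form J im' ->
  h = h'.
Proof.
move=> F F' ew ere eim; have [[_ h0] _ _ _] := F; have [[_ h0'] _ _ _] := F'.
have hn : h != 0 by exact: lt0r_neq0.
have hn' : h' != 0 by exact: lt0r_neq0.
have := frame_w3 F; rewrite ew ere eim -!pull_form_wedge (frame_w3 F') linearZ /=.
rewrite pull_form_wedge -ere -eim => /eqP; rewrite -subr_eq0 -scalerBl scaler_eq0.
have -> : re \w im == 0 = false.
  by apply/eqP => ri; have /eqP[] := frame_e_re_im_neq0 F; rewrite ri wedge0r.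
rewrite orbF subr_eq0 => /eqP /(mulfI _) E; apply/eqP.
rewrite -(eqrXn2 (n := 2)) // ?ltW //; apply/eqP/invr_inj; symmetry; apply: E.
by rewrite mulf_neq0 ?invr_eq0 ?pnatr_eq0.
Qed.

(** * Derivatives in time *)

Section TimeDerivatives.
Variables (R : realType) (J : set R).
Hypothesis iJ : is_interval J.
Hypothesis two : exists s s', [/\ J s, J s' & s != s'].

(** The derivative at t of a curve that matters on J only. *)
Definition curve_der (u : R -> R) (t l : R) :=
  (fun s => (u s - u t) / (s - t)) @ within J t^' --> l.

(** On an interval with two points, every point is a limit of other ones, so that
    derivatives within J are unique. *)
Lemma within_dnbhs_proper t : J t -> ProperFilter (within J t^').
Proof.
move=> Jt; have [s Js st] : exists2 s, J s & s != t.
  have [s [s' [Js Js' ss']]] := two; have [st|] := eqVneq s t; last by exists s.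
  by exists s' => //; rewrite -st eq_sym.
apply: Build_ProperFilter_ex => P [r /= r0 hr].
(* The point t + d (s - t) lies between t and s, and within r of t. *)
pose d := Num.min (2^-1) (r / (2 * `|s - t|)).
have st0 : 0 < `|s - t| by rewrite normr_gt0 subr_eq0.
have d0 : 0 < d by rewrite lt_min invr_gt0 ltr0n /= divr_gt0 // mulr_gt0.
have d1 : d <= 2^-1 by rewrite ge_min lexx.
have dr : d * `|s - t| < r.
  apply: (@le_lt_trans _ _ (r / 2)); last by rewrite ltr_pdivrMr // mulr_natr mulr2n ltrDl.
  have -> : r / 2 = r / (2 * `|s - t|) * `|s - t| by field; rewrite gt_eqF.
  by rewrite ler_pM2r // ge_min lexx orbT.
have dn1 : d < 1 by apply: le_lt_trans d1 _; rewrite invf_lt1 ?ltr1n.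
exists (t + d * (s - t)); apply: hr.
- by rewrite /ball_ /= opprD addNKr normrN normrM (gtr0_norm d0).
- by rewrite -subr_eq0 addrAC subrr add0r mulf_neq0 ?subr_eq0 // gt_eqF.
- have [/ltW sle|/ltW sle] := orP (lt_total st).
    apply: (iJ Js Jt); apply/andP; split; nra.
  apply: (iJ Jt Js); apply/andP; split; nra.
Qed.

Lemma curve_der_unique u t l l' : J t -> curve_der u t l -> curve_der u t l' -> l = l'.
Proof. 
move=> Jt; have PF := within_dnbhs_proper Jt; exact: (@cvg_unique _ (@Rhausdorff R)). Qed.

Lemma near_within_dnbhs t (P : R -> Prop) : (forall s, J s -> s != t -> P s) ->
  \forall s \near within J t^', P s.
Proof.
move=> H; have A : nbhs t (fun s => s != t -> J s -> P s) by apply: filterE => s st Js; exact: H.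
exact: A.
Qed.

Lemma eq_curve_der u v t l : J t -> (forall s, J s -> u s = v s) ->
  curve_der u t l -> curve_der v t l.
Proof.
move=> Jt uv; apply: cvg_trans; apply: near_eq_cvg.
by apply: near_within_dnbhs => s Js _; rewrite !uv.
Qed.

Lemma curve_der_cst a t : curve_der (fun=> a) t 0.
Proof.
rewrite /curve_der (_ : (fun s => _) = fun=> 0); first exact: cvg_cst.
by apply/funext => s; rewrite subrr mul0r.
Qed.

Lemma curve_derD u v t l m : curve_der u t l -> curve_der v t m ->
  curve_der (fun s => u s + v s) t (l + m).
Proof.
move=> du dv; rewrite /curve_der.
have -> : (fun s => (u s + v s - (u t + v t)) / (s - t)) =
    (fun s => (u s - u t) / (s - t)) + (fun s => (v s - v t) / (s - t)).
  by apply/funext => s /=; rewrite fctE -mulrDl; congr (_ / _); ring.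
exact: cvgD.
Qed.

Lemma curve_der_cvg u t l : curve_der u t l -> u s @[s --> within J t^'] --> u t.
Proof.
move=> du; have id_cvg : s @[s --> within J t^'] --> t.
  by move=> P nP; apply: filterS nP => s Ps _ _.
have : ((u s - u t) / (s - t)) * (s - t) + u t @[s --> within J t^'] --> l * (t - t) + u t.
  by apply: cvgD; [apply: cvgM => //; apply: cvgB => //|]; exact: cvg_cst.
rewrite subrr mulr0 add0r; apply: cvg_trans; apply: near_eq_cvg.
by apply: near_within_dnbhs => s _ st; rewrite divfK ?subrK // subr_eq0.
Qed.

Lemma curve_derM u v t l m : curve_der u t l -> curve_der v t m ->
  curve_der (fun s => u s * v s) t (l * v t + u t * m).
Proof.
move=> du dv; rewrite /curve_der.
have -> : (fun s => (u s * v s - u t * v t) / (s - t)) =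
    (fun s => (u s - u t) / (s - t)) * v + (cst (u t)) * (fun s => (v s - v t) / (s - t)).
  apply/funext => s.
  rewrite -[RHS]/((u s - u t) / (s - t) * v s + u t * ((v s - v t) / (s - t))); ring.
apply: cvgD; apply: cvgM => //; [exact: curve_der_cvg dv | exact: cvg_cst].
Qed.

Section CurvesOfForms.
Variable n : nat.
Local Notation form := (ext_form R n).
Implicit Types (a b : R -> form).

Definition form_der a t (l : form) := forall S, curve_der (fun s => a s S) t (l S).

Lemma form_der_unique a t (l l' : form) : J t -> form_der a t l -> form_der a t l' -> l = l'.
Proof. by move=> Jt dl dl'; apply/ffunP => S; exact: curve_der_unique Jt (dl S) (dl' S). Qed.

Lemma eq_form_der a b t (l : form) : J t -> (forall s, J s -> a s = b s) ->
  form_der a t l -> form_der b t l.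
Proof. by move=> Jt ab da S; apply: eq_curve_der Jt _ (da S) => s Js; rewrite ab. Qed.

Lemma form_der_cst (a : form) t : form_der (fun=> a) t 0.
Proof. by move=> S; rewrite zero_formE; exact: curve_der_cst. Qed.

Lemma form_derD a b t (l m : form) : form_der a t l -> form_der b t m ->
  form_der (fun s => a s + b s) t (l + m).
Proof.
move=> da db S; rewrite add_formE; have := curve_derD (da S) (db S).
by rewrite (_ : (fun s => a s S + b s S) = fun s => (a s + b s) S) //; apply/funext => s; rewrite add_formE.
Qed.

Lemma curve_der_sum (I : Type) (r : seq I) (P : pred I) (u : I -> R -> R) (l : I -> R) t :
  (forall i, P i -> curve_der (u i) t (l i)) ->
  curve_der (fun s => \sum_(i <- r | P i) u i s) t (\sum_(i <- r | P i) l i).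
Proof.
move=> du; elim: r => [|i r IH].
  rewrite big_nil (_ : (fun s => _) = fun=> 0); first exact: curve_der_cst.
  by apply/funext => s; rewrite big_nil.
rewrite big_cons; case Pi : (P i).
  rewrite (_ : (fun s => _) = fun s => u i s + \sum_(j <- r | P j) u j s).
    by apply: curve_derD => //; exact: du.
  by apply/funext => s; rewrite big_cons Pi.
rewrite (_ : (fun s => _) = fun s => \sum_(j <- r | P j) u j s) //.
by apply/funext => s; rewrite big_cons Pi.
Qed.

Lemma curve_derZ k u t l : curve_der u t l -> curve_der (fun s => k * u s) t (k * l).
Proof. by move=> du; have := curve_derM (curve_der_cst k t) du; rewrite mul0r add0r. Qed.

Lemma form_der_wedge a b t (l m : form) : form_der a t l -> form_der b t m ->
  form_der (fun s => a s \w b s) t (l \w b t + a t \w m).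
Proof.
move=> da db S; pose c A := shuffle_sign R A (S :\: A)%SET.
rewrite (_ : (fun s => _) = fun s => \sum_(A in powerset S) c A * (a s A * b s (S :\: A)%SET)); last first.
  by apply/funext => s; rewrite wedgeE; apply: eq_bigr => A _; rewrite mulrA.
rewrite add_formE !wedgeE -big_split /=.
under [X in curve_der _ _ X]eq_bigr do rewrite -!mulrA -mulrDr.
by apply: curve_der_sum => A _; apply: curve_derZ; exact: curve_derM.
Qed.

Lemma form_derZ k a t (l : form) : form_der a t l -> form_der (fun s => k *: a s) t (k *: l).
Proof.
move=> da S; rewrite scale_formE; have := curve_derZ (k := k) (da S).
by rewrite (_ : (fun s => k * a s S) = fun s => (k *: a s) S) //; apply/funext => s; rewrite scale_formE.
Qed.

Lemma form_derB a b t (l m : form) : form_der a t l -> form_der b t m ->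
  form_der (fun s => a s - b s) t (l - m).
Proof.
move=> da db; have := form_derD da (form_derZ (k := -1) db).
by rewrite scaleN1r; congr (form_der _ t _); apply/funext => s; rewrite scaleN1r.
Qed.

Lemma form_der_int_prod (v : 'rV[R]_n) a t (l : form) : form_der a t l ->
  form_der (fun s => int_prod v (a s)) t (int_prod v l).
Proof.
move=> da S; rewrite int_prodE.
rewrite (_ : (fun s => _) = fun s => \sum_(i | i \notin S)
   v 0 i * shuffle_sign R (finset.set1 i) S * a s (i |: S)%SET); last first.
  by apply/funext => s; rewrite int_prodE.
by apply: curve_der_sum => i _; exact: curve_derZ.
Qed.

Lemma form_der_eq0 a t (l : form) : J t -> (forall s, J s -> a s = 0) -> form_der a t l -> l = 0.
Proof.
move=> Jt a0 da; apply: (form_der_unique Jt da).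
by apply: (eq_form_der Jt _ (form_der_cst 0 t)) => s Js; rewrite a0.
Qed.

Lemma has_degree_form_der k a t (l : form) : J t -> (forall s, J s -> has_degree k (a s)) ->
  form_der a t l -> has_degree k l.
Proof.
move=> Jt ak da S Sk; apply: (curve_der_unique Jt (da S)).
by apply: (eq_curve_der Jt _ (curve_der_cst 0 t)) => s Js; rewrite ak.
Qed.

End CurvesOfForms.

(** On J the derivative of F s along v is that of a smooth extension G of F in
    the direction (0, v), and the latter is differentiable in time. *)
Lemma smooth_family_derive n (U : set 'rV[R]_n.+1) (F : R -> 'rV[R]_n.+1 -> R) t x v :
    open U -> smooth_family_on J U F -> J t -> U x ->
  exists l, curve_der (fun s => 'D_v (F s) x) t l.
Proof.
move=> oU sF Jt Ux; have [W [G [oW Wtx sG eG]]] := sF t x Jt Ux.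
pose DG := fun z : (R^o * 'rV[R]_n.+1)%type => 'D_(0, v) G z.
have dDG : differentiable DG (t, x) by exact: (sG [:: (0, v)]).
exists ('D_(1, 0) DG (t, x)).
have line s : 'D_v (fun y => G (s, y)) x = DG (s, x).
  have E : (fun k : R => k^-1 *: (((fun y => G (s, y)) \o shift x) (k *: v) - G (s, x))) =
      (fun k : R => k^-1 *: ((G \o shift (s, x)) (k *: (0, v)) - G (s, x))).
    apply/funext => k /=; congr (_ *: (G (_, _) - _)).
    by rewrite -[(_ *: _).1]/(k * 0) mulr0 add0r.
  by rewrite /DG /derive -E.
have slice s y : W (s, y) -> exists A B, [/\ nbhs s A, nbhs y B & forall s y, A s -> B y -> W (s, y)].
  move=> Wsy; have [[A B] /= [nA nB] AB] := open_nbhs_nbhs (conj oW Wsy).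
  by exists A, B; split=> // s' y' As By; apply: (AB (s', y')).
have DF s : J s -> W (s, x) -> 'D_v (F s) x = DG (s, x).
  move=> Js Wsx; rewrite -line; apply: near_eq_derive.
  have [A [B [nA nB AB]]] := slice s x Wsx.
  apply: filterS2 nB (open_nbhs_nbhs (conj oU Ux)) => y By Uy; rewrite eG //.
  by apply: AB => //; exact: nbhs_singleton nA.
have shift_cvg : s - t @[s --> within J t^'] --> (0 : R)^'.
  move=> P [r /= r0 hr]; exists r => // s st s_t Js; apply: hr; last by rewrite subr_eq0.
  by move: st; rewrite /ball_ /= sub0r opprB.
have dv : (fun k : R => k^-1 *: ((DG \o shift (t, x)) (k *: (1, 0)) - DG (t, x))) @ 0^' -->
    'D_(1, 0) DG (t, x) by exact: (@diff_derivable _ _ _ DG (t, x) (1, 0) dDG).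
have := cvg_comp _ _ shift_cvg dv.
apply: cvg_trans; apply: near_eq_cvg.
have [A [B [nA nB AB]]] := slice t x Wtx.
have Bx := nbhs_singleton nB.
have E s : A s -> J s -> s != t ->
    (s - t)^-1 *: ((DG \o shift (t, x)) ((s - t) *: (1, 0)) - DG (t, x)) =
    ('D_v (F s) x - 'D_v (F t) x) / (s - t).
  move=> As Js st; rewrite !DF //; last exact: AB.
  rewrite mulrC; congr (_ * (DG _ - _)) => /=; congr pair.
    by rewrite -[(_ *: _).1]/((s - t) * 1) mulr1 subrK.
  by rewrite -[(_ *: _).2]/((s - t) *: 0) scaler0 add0r.
have nA' : nbhs t (fun s => s != t -> J s -> A s) by apply: filterS nA => s As _ _.
apply: filterS nA => s As st Js; exact: E.
Qed.

End TimeDerivatives.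

(** * Transverse structures on a Sasakian manifold *)

Section TransverseStructures.
Variables (R : realType) (M : smooth_manifold R 6).
Variables (xi : chartwise M 'rV[R]_7) (eta : form_field M) (Phi g : chartwise M 'M[R]_7).
Hypothesis S : sasakian xi eta Phi g.
Implicit Types (c : chart M) (x : 'rV[R]_7) (w e : form_field M) (U : cform_field M).

Lemma sasakian_eta_xi c x : img c x -> int_prod (xi c x) (eta c x) finset.set0 = 1.
Proof. by case: S => _ + _ _ _; exact. Qed.

Lemma sasakian_Phi2 c x : img c x -> forall v,
  v *m Phi c x *m Phi c x = - v + (int_prod v (eta c x) finset.set0) *: xi c x.
Proof. by move=> Ux v; case: S => _ _ + _ _; exact. Qed.

Lemma transverse_frame w U c x (e : ext_form R 7) :
    transverse_kahler xi eta Phi w -> transverse_volume xi eta Phi U -> img c x ->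
    has_degree 1 e -> int_prod (xi c x) e = form0 1 ->
  exists h P, adapted_frame (xi c x) e (w c x) (Re_form (U c x)) (Im_form (U c x)) h P.
Proof.
move=> [[[dw _ _] bw] _ tw pw] [[[_ bre] [_ bim]] _ tU U0] Ux e1 e_xi.
apply: (exists_adapted_frame (eta := eta c x) (Phi := Phi c x)) => //.
- exact: sasakian_eta_xi.
- exact: sasakian_Phi2.
- exact: dw.
- by case: (bw c x Ux).
- by case: (tU c x Ux).
- by case: (bre c x Ux).
- by case: (bim c x Ux).
- by case: (tw c x Ux).
- by case: (tU c x Ux).
- move=> v v0 vn; exact: (pw c x v Ux v0 vn).
- exact: U0.
Qed.

Lemma su3_frame w U c x (e : ext_form R 7) :
    transverse_kahler xi eta Phi w -> transverse_volume xi eta Phi U -> img c x ->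
    has_degree 1 e -> int_prod (xi c x) e = form0 1 ->
  exists P, adapted_frame (xi c x) e (w c x) (Re_form (U c x)) (Im_form (U c x))
    (su3_norm w U c x) P.
Proof.
move=> tw tU Ux e1 e_xi; have [h [P F]] := transverse_frame tw tU Ux e1 e_xi.
by exists P; rewrite /su3_norm (frame_ups_norm F).
Qed.

Lemma g2_formE e w U c x : g2_form e w U c x =
  (su3_norm w U c x)^-1 *: Re_form (U c x) + su3_norm w U c x *: (e c x \w w c x).
Proof.
congr (_ + _); apply/ffunP => T; rewrite [LHS]ffunE scale_formE [RHS]scale_formE ffunE.
by case: (U c x T) => a b; simpc.
Qed.

Lemma contact_form_transverse (e : form_field M) c x : is_form 1 e -> img c x ->
  int_prod (xi c x) (e c x) = form0 (int_prod (xi c x) (e c x) finset.set0).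
Proof.
move=> [d1 _ _] Ux; apply/ffunP => T; rewrite form0E; case: eqP => [->//|/eqP T0].
by rewrite (has_degree_int_prod _ (d1 c x Ux)) // cards_eq0.
Qed.

Lemma is_form_dc_op (f : point_of M -> R) : basic_fun xi f -> is_form 1 (dc_op Phi f).
Proof.
move=> [[_ sf _] _]; have [[_ _ [sP tP] _] _ _ _ _] := S.
have {}sf c : smooth_on (img c) (fun_field f c).
  have := sf c finset.set0; apply: eq_smooth => [|y _]; last by rewrite form0E eqxx.
  exact: open_img.
split=> [c x _|c|c c' x ox]; first exact: has_degree_dc_op.
  exact: smooth_dc_op.
by apply: dc_op_transition => //; exact: tP.
Qed.

Lemma int_prod_dc_op (f : point_of M -> R) c x : img c x ->
  int_prod (xi c x) (dc_op Phi f c x) = 0.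
Proof.
move=> Ux; rewrite dc_opE linearN linearZ /= int_prod_pull_form.
by rewrite (Phi_xi (sasakian_eta_xi Ux) (sasakian_Phi2 Ux)) int_prod0l linear0 scaler0 oppr0.
Qed.

Lemma is_formD k (a b : form_field M) : is_form k a -> is_form k b ->
  is_form k (fun c x => a c x + b c x).
Proof.
move=> [da sa ta] [db sb tb]; split=> [c x Ux|c|c c' x ox].
- by apply: has_degreeD; [exact: da | exact: db].
- by apply: smooth_formD; [exact: open_img|exact: sa|exact: sb].
by rewrite (ta _ _ _ ox) (tb _ _ _ ox) linearD.
Qed.

Lemma is_form_g2_form e w U : is_form 1 e ->
    (forall c x, img c x -> int_prod (xi c x) (e c x) = form0 1) ->
    transverse_kahler xi eta Phi w -> transverse_volume xi eta Phi U ->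
  is_form 3 (g2_form e w U) /\ forall c x, img c x -> g2_positive (g2_form e w U c x).
Proof.
move=> [de se te] e_xi tw tU.
have F c x (Ux : img c x) := su3_frame tw tU Ux (de c x Ux) (e_xi c x Ux).
have [[[_ sw tw'] _] _ _ _] := tw; have [[[[_ sre tre] _] [[_ sim tim] _]] _ _ _] := tU.
have pos c x : img c x -> g2_positive (g2_form e w U c x).
  by move=> Ux; have [P G] := F c x Ux; rewrite g2_formE; exact: frame_g2_positive G.
split=> //; split=> [c x Ux|c|c c' x ox].
- by case: (pos c x Ux).
- have oU := @open_img _ _ _ c.
  apply: (eq_smooth_form oU _ (smooth_g2_form oU (F c) (se c) (sw c) (sre c) (sim c))).
  by move=> x _; rewrite g2_formE.
have [Ux' _] := transition_img ox; have [Ux _] := ox.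
have [P G] := F c x Ux; have [P' G'] := F c' _ Ux'.
rewrite !g2_formE (frame_norm_natural G G' (tw' _ _ _ ox) (tre _ _ _ ox) (tim _ _ _ ox)).
by rewrite linearD !linearZ /= pull_form_wedge (te _ _ _ ox) (tw' _ _ _ ox) (tre _ _ _ ox).
Qed.

End TransverseStructures.

Lemma form_der_time_d (R : realType) (M : smooth_manifold R 6) (J : set R) (a : R -> form_field M)
    t c x (l : ext_form R 7) : is_interval J -> (exists s s', [/\ J s, J s' & s != s']) -> J t ->
  form_der J (fun s => a s c x) t l -> form_der J (fun s => a s c x) t (time_d J a t c x).
Proof.
move=> iJ two Jt da S; have PF := within_dnbhs_proper iJ two Jt.
by rewrite ffunE (cvg_lim (@Rhausdorff R) (da S)); exact: da.
Qed.

Lemma form_der_dc_op (R : realType) (M : smooth_manifold R 6) (J : set R)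
    (Phi : chartwise M 'M[R]_7) (f : R -> point_of M -> R) t c x :
  smooth_family J (fun t c x => form0 (fun_field (f t) c x)) -> J t -> img c x ->
  exists l, form_der J (fun s => dc_op Phi (f s) c x) t l.
Proof.
move=> sf Jt Ux; have sF : smooth_family_on J (img c) (fun s y => fun_field (f s) c y).
  move=> t' x' Jt' Ux'; have [W [G [oW Wt sG eG]]] := sf c finset.set0 t' x' Jt' Ux'.
  by exists W, G; split=> // s y Js Uy Wy; rewrite eG // form0E eqxx.
have /choice[l dl] : forall i, exists l,
    curve_der J (fun s => 'D_(basis_vec R i) (fun_field (f s) c) x) t l.
  by move=> i; exact: smooth_family_derive (@open_img _ _ _ c) sF Jt Ux.
exists (- (2^-1 *: pull_form (Phi c x) (\sum_i l i *: dx i))).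
pose L := fun a : ext_form R 7 => - (2^-1 *: pull_form (Phi c x) a).
have LE (r : 'I_7 -> R) :
    - (2^-1 *: pull_form (Phi c x) (\sum_i r i *: dx i)) = \sum_i r i *: L (dx i).
  rewrite [pull_form _ _]linear_sum scaler_sumr -sumrN; apply: eq_bigr => i _ /=.
  by rewrite [pull_form _ (_ *: _)]linearZ /= /L scalerN !scalerA mulrC.
rewrite LE => S; rewrite sum_form_E.
rewrite (_ : (fun s => _) = fun s =>
    \sum_i L (dx i) S * 'D_(basis_vec R i) (fun_field (f s) c) x); last first.
  apply/funext => s; rewrite dc_opE fun_dE LE sum_form_E; apply: eq_bigr => i _.
  by rewrite scale_formE mulrC.
under eq_bigr do rewrite scale_formE mulrC.
by apply: curve_der_sum => i _; exact: curve_derZ.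
Qed.

Lemma Im_formD (R : realType) n (a b : ext_form R[i] n) : Im_form (a + b) = Im_form a + Im_form b.
Proof.
apply/ffunP => S; rewrite add_formE !ffunE; case: (a S) (b S) => p q [p' q'].
by simpc.
Qed.

Lemma cext_d_eq0 (R : realType) n (U : 'rV[R]_n.+1 -> ext_form R[i] n.+1) x : cext_d U x = 0 ->
  ext_d (fun y => Re_form (U y)) x = 0 /\ ext_d (fun y => Im_form (U y)) x = 0.
Proof.
move=> dU; have zRe : Re_form (0 : ext_form R[i] n.+1) = 0.
  by apply/ffunP => S; rewrite !ffunE.
have zIm : Im_form (0 : ext_form R[i] n.+1) = 0.
  by apply/ffunP => S; rewrite !ffunE.
split; first by rewrite -[LHS](Re_form_split _ (ext_d (fun y => Im_form (U y)) x)) [X in Re_form X]dU.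
by rewrite -[LHS](Im_form_split (ext_d (fun y => Re_form (U y)) x)) [X in Im_form X]dU.
Qed.

(** * The theorem *)

Section MainTheorem.
Variables (R : realType) (M : smooth_manifold R 6).
Variables (xi : chartwise M 'rV[R]_7) (eta : form_field M) (Phi g : chartwise M 'M[R]_7).
Variables (A : R) (J : set R) (w_ : R -> form_field M) (Ups_ : R -> cform_field M).
Variables (beta : R -> form_field M) (gamma : R -> cform_field M) (f : R -> point_of M -> R).
Hypothesis S : sasakian xi eta Phi g.
Hypotheses (iJ : is_interval J) (two : exists s s', [/\ J s, J s' & s != s']).
Hypothesis T : forall t, J t -> transverse_kahler xi eta Phi (w_ t) /\
  transverse_volume xi eta Phi (Ups_ t).
Hypothesis B : forall t, J t -> basic_form xi 2 (beta t) /\ basic_cform xi 3 (gamma t).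
Hypothesis bf : forall t, J t -> basic_fun xi (f t).
Hypothesis sf : smooth_family J (fun t c x => form0 (fun_field (f t) c x)).

Let dcf t := dc_op Phi (f t).
Let eta_ t : form_field M := fun c x => eta c x + dcf t c x.
Let h t := su3_norm (w_ t) (Ups_ t).
Let phi_ t := g2_form (eta_ t) (w_ t) (Ups_ t).
Let grad t := grad_log_norm (phi_ t) (w_ t) (Ups_ t).
Let dlog t c x := fun_d (log_norm (w_ t) (Ups_ t) c) x.

Hypothesis ew : forall t, J t -> forall c x, img c x ->
  w_ t c x = ext_d (eta c) x + ext_d (dcf t c) x.
Hypothesis dw_ : forall t, J t -> has_dt J w_ t (fun c x =>
     - lie_d (grad t c) (w_ t c) x + beta t c x).
Hypothesis dU_ : forall t, J t -> has_cdt J Ups_ t (fun c x =>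
     clie_d (grad t c) (Ups_ t c) x + gamma t c x).

Let is_form_eta_ t : J t -> is_form 1 (eta_ t).
Proof.
move=> Jt; apply: is_formD; last exact: is_form_dc_op S _ (bf Jt).
by case: S => -[].
Qed.

Let eta_xi t c x : img c x -> int_prod (xi c x) (eta_ t c x) = form0 1.
Proof.
move=> Ux; rewrite /eta_ linearD /= (int_prod_dc_op S) // addr0.
rewrite (contact_form_transverse xi _ Ux) ?(sasakian_eta_xi S Ux) //.
by case: S => -[].
Qed.

Let eta1 t c x : J t -> img c x -> has_degree 1 (eta_ t c x).
Proof. by move=> Jt; case: (is_form_eta_ Jt) => + _ _; exact. Qed.

Let frame s t c x : J s -> J t -> img c x -> exists h P, adapted_frame (xi c x) (eta_ t c x)
  (w_ t c x) (Re_form (Ups_ s c x)) (Im_form (Ups_ s c x)) h P.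
Proof.
move=> Js Jt Ux; apply: (transverse_frame S (T Jt).1 (T Js).2 Ux); first exact: eta1.
exact: eta_xi.
Qed.

Let frame_norm t c x : J t -> img c x -> exists P, adapted_frame (xi c x) (eta_ t c x)
  (w_ t c x) (Re_form (Ups_ t c x)) (Im_form (Ups_ t c x)) (h t c x) P.
Proof.
move=> Jt Ux; apply: (su3_frame S (T Jt).1 (T Jt).2 Ux); first exact: eta1.
exact: eta_xi.
Qed.

Let d_eta_ t c x : J t -> img c x -> ext_d (eta_ t c) x = w_ t c x.
Proof.
move=> Jt Ux; rewrite (ew Jt Ux) (ext_dD Ux) //.
  by case: S => -[_ [_ + _] _ _] _ _ _ _; exact.
by case: (is_form_dc_op S (bf Jt)) => _ + _; exact.
Qed.

Let phiE t c : phi_ t c = fun x =>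
  (h t c x)^-1 *: Re_form (Ups_ t c x) + h t c x *: (eta_ t c x \w w_ t c x).
Proof. by apply/funext => x; exact: g2_formE. Qed.

Let psiE t c x : J t -> img c x -> hodge_field (phi_ t c) (phi_ t c) x =
  2^-1 *: (w_ t c x \w w_ t c x) - eta_ t c x \w Im_form (Ups_ t c x).
Proof.
by move=> Jt Ux; have [P F] := frame_norm Jt Ux; rewrite phiE; exact: frame_star_phi F.
Qed.

Let ed t := time_d J dcf t.

Let eta_der t c x : J t -> img c x -> form_der J (fun s => eta_ s c x) t (ed t c x).
Proof.
move=> Jt Ux; have [l dl] := form_der_dc_op Phi sf Jt Ux.
have := form_derD (form_der_cst J (eta c x) t) (form_der_time_d (a := dcf) iJ two Jt dl).
by rewrite add0r.
Qed.

Let im_der t c x : J t -> img c x -> form_der J (fun s => Im_form (Ups_ s c x)) t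
  (lie_d (grad t c) (fun y => Im_form (Ups_ t c y)) x + Im_form (gamma t c x)).
Proof.
move=> Jt Ux; have [_ /(_ c x Ux)] := dU_ Jt.
by rewrite Im_formD /clie_d Im_form_split.
Qed.

Let w_der t c x : J t -> img c x -> form_der J (fun s => w_ s c x) t
  (- lie_d (grad t c) (w_ t c) x + beta t c x).
Proof. by move=> Jt Ux; exact: (dw_ Jt Ux). Qed.

Let psi_der t c x : J t -> img c x ->
  form_der J (fun s => hodge_field (phi_ s c) (phi_ s c) x) t
    ((- lie_d (grad t c) (w_ t c) x + beta t c x) \w w_ t c x -
     (ed t c x \w Im_form (Ups_ t c x) + eta_ t c x \w
       (lie_d (grad t c) (fun y => Im_form (Ups_ t c y)) x + Im_form (gamma t c x)))).
Proof.
move=> Jt Ux; have dwt := w_der Jt Ux.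
have := form_derB (form_derZ (k := 2^-1) (form_der_wedge dwt dwt))
  (form_der_wedge (eta_der Jt Ux) (im_der Jt Ux)).
move/(eq_form_der Jt (b := fun s => hodge_field (phi_ s c) (phi_ s c) x)).
have dw s : J s -> has_degree 2 (w_ s c x).
  by move=> Js; have [P F] := frame_norm Js Ux; exact: frame_degree_w F.
rewrite -(wedge_deg2C (dw t Jt) (has_degree_form_der iJ two Jt dw dwt)).
have half (b : ext_form R 7) : 2^-1 *: (b + b) = b.
  by apply/ffunP => S'; rewrite scale_formE add_formE; field.
by rewrite half; apply=> s Js; rewrite psiE.
Qed.

Let smooth_eta_ t c : J t -> smooth_form (img c) (eta_ t c).
Proof. by move=> Jt; case: (is_form_eta_ Jt) => _ + _; exact. Qed.

Let smooth_w_ t c : J t -> smooth_form (img c) (w_ t c).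
Proof. by move=> Jt; case: (T Jt) => -[[[_ + _] _] _ _ _] _; exact. Qed.

Let smooth_re t c : J t -> smooth_form (img c) (fun x => Re_form (Ups_ t c x)).
Proof. by move=> Jt; case: (T Jt) => _ [[[[_ + _] _] _] _ _ _]; exact. Qed.

Let smooth_im t c : J t -> smooth_form (img c) (fun x => Im_form (Ups_ t c x)).
Proof. by move=> Jt; case: (T Jt) => _ [[_ [[_ + _] _]] _ _ _]; exact. Qed.

Let dw0 t c x : J t -> img c x -> ext_d (w_ t c) x = 0.
Proof. by move=> Jt; case: (T Jt) => -[_ + _ _] _; exact. Qed.

Let dU0 t c x : J t -> img c x -> ext_d (fun y => Re_form (Ups_ t c y)) x = 0 /\
  ext_d (fun y => Im_form (Ups_ t c y)) x = 0.
Proof. by move=> Jt Ux; apply: cext_d_eq0; case: (T Jt) => _ [_ + _ _]; exact. Qed.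

Let xi_beta t c x : J t -> img c x -> int_prod (xi c x) (beta t c x) = 0.
Proof. by move=> Jt Ux; case: (B Jt) => -[_ /(_ c x Ux)[]]. Qed.

Let xi_gamma t c x : J t -> img c x -> int_prod (xi c x) (Im_form (gamma t c x)) = 0.
Proof. by move=> Jt Ux; case: (B Jt) => _ [_ [_ /(_ c x Ux)[]]]. Qed.

Let xi_ed t c x : J t -> img c x -> int_prod (xi c x) (ed t c x) = 0.
Proof.
move=> Jt Ux; have dx := form_der_int_prod (v := xi c x) (eta_der Jt Ux).
apply: (form_der_unique iJ two Jt dx).
apply: (eq_form_der Jt _ (form_der_cst J (form0 1) t)) => s _; exact/esym/eta_xi.
Qed.

Let ed1 t c x : J t -> img c x -> has_degree 1 (ed t c x).
Proof.
by move=> Jt Ux; apply: (has_degree_form_der iJ two Jt _ (eta_der Jt Ux)) => s Js; exact: eta1.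
Qed.

(** The form psi_t is explicit, so its time derivative follows from those of
    e_t, w_t and im_t by the product rule, and chart_coflow_iff applies. *)
Lemma modified_coflow_iff : modified_coflow A J phi_ <->
  forall t, J t -> forall c x, img c x ->
    wedge (beta t c x) (w_ t c x) =
      - (h t c x ^+ 2 *: wedge (w_ t c x) (w_ t c x))
      + (A * h t c x) *: wedge (w_ t c x) (w_ t c x)
      - (A / h t c x) *: wedge (dlog t c x) (Re_form (Ups_ t c x))
      - wedge (lie_d (grad t c) (dcf t c) x) (Im_form (Ups_ t c x))
      - wedge (int_prod (grad t c x) (ext_d (eta c) x)) (Im_form (Ups_ t c x))
      + wedge (time_d J dcf t c x) (Im_form (Ups_ t c x))
    /\
    Im_form (gamma t c x) =
      - ((2 * h t c x ^+ 2) *: wedge (dlog t c x) (w_ t c x))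
      + (A * h t c x) *: wedge (dlog t c x) (w_ t c x).
Proof.
have flowE : modified_coflow A J phi_ <-> forall t, J t -> forall c x, img c x ->
    coflow_rhs (eta_ t c) (w_ t c) (fun y => Re_form (Ups_ t c y)) (h t c) A x =
    (- lie_d (grad t c) (w_ t c) x + beta t c x) \w w_ t c x -
     (ed t c x \w Im_form (Ups_ t c x) + eta_ t c x \w
       (lie_d (grad t c) (fun y => Im_form (Ups_ t c y)) x + Im_form (gamma t c x))).
  split=> [[_ flow] t Jt c x Ux|H].
    apply: (form_der_unique iJ two Jt _ (psi_der Jt Ux)).
    by have := flow t Jt c x Ux; rewrite /= phiE.
  split=> [t Jt|psi t Jt c x Ux].
    by apply: (is_form_g2_form S (is_form_eta_ Jt)) => [c x Ux||]; [exact: eta_xi|case: (T Jt)..].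
  have E : laplacian (phi_ t c) 4 (hodge_field (phi_ t c) (phi_ t c)) x +
      ext_d (fun y => (A - 7 / 2 * tau0 (phi_ t c) y) *: phi_ t c y) x =
      coflow_rhs (eta_ t c) (w_ t c) (fun y => Re_form (Ups_ t c y)) (h t c) A x.
    by rewrite phiE.
  have D := psi_der Jt Ux; rewrite -(H t Jt c x Ux) in D.
  by move=> S'; rewrite E; exact: D S'.
rewrite flowE; clear flowE.
(* The equivalence in each chart; its hypotheses on derivatives are identities
   satisfied by the curves at all times. *)
have key t c (Jt : J t) := chart_coflow_iff (@open_img _ _ M c)
  (fun x (Ux : img c x) => frame_norm Jt Ux) (@smooth_eta_ t c Jt) (@smooth_w_ t c Jt)
  (@smooth_re t c Jt) (@smooth_im t c Jt) (fun x Ux => d_eta_ Jt Ux) (fun x Ux => dw0 Jt Ux)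
  (fun x Ux => (dU0 Jt Ux).1) (fun x Ux => (dU0 Jt Ux).2) A
  (dcf t c) (ext_d (eta c)) (beta := beta t c)
  (gim := fun x => Im_form (gamma t c x)) (ed := ed t c).
have gradE t c : grad t c = gradient (fun x =>
    (h t c x)^-1 *: Re_form (Ups_ t c x) + h t c x *: (eta_ t c x \w w_ t c x))
    (fun x => ln (h t c x)).
  by rewrite /grad /grad_log_norm phiE.
have {}key t c (Jt : J t) := key t c Jt (fun x Ux => xi_beta Jt Ux) (fun x Ux => xi_gamma Jt Ux)
  (fun x Ux => xi_ed Jt Ux) (fun x Ux => ed1 Jt Ux).
have xi_wd t c x : J t -> img c x ->
    int_prod (xi c x) (- lie_d (grad t c) (w_ t c) x + beta t c x) = 0.
  move=> Jt Ux; apply: (form_der_eq0 iJ two Jt _ (form_der_int_prod (v := xi c x) (w_der Jt Ux))).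
  by move=> s Js; case: (T Js) => -[[_ bw] _ _ _] _; case: (bw c x Ux).
have im_w t c x : J t -> img c x ->
    (lie_d (grad t c) (fun y => Im_form (Ups_ t c y)) x + Im_form (gamma t c x)) \w w_ t c x = 0.
  move=> Jt Ux; have := form_der_wedge (im_der Jt Ux) (form_der_cst J (w_ t c x) t).
  rewrite wedge0r addr0; apply: (form_der_eq0 iJ two Jt) => s Js.
  have [k [P F]] := frame Js Jt Ux.
  by rewrite (wedge_deg2C (frame_degree_w F) (frame_degree_im F)) (frame_w_im F).
split=> H t Jt c.
  have := key t c Jt; rewrite -gradE => -[x Ux|x Ux|+ _]; [exact: xi_wd|exact: im_w|].
  by apply=> x Ux; exact: H.
have := key t c Jt; rewrite -gradE => -[x Ux|x Ux|_ +]; [exact: xi_wd|exact: im_w|].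
by apply=> x Ux; exact: H.
Qed.

End MainTheorem.

Theorem theorem3p7 (R : realType) (M : smooth_manifold R 6)
    (xi : chartwise M 'rV[R]_7) (eta : form_field M) (Phi g : chartwise M 'M[R]_7)
    (Ups : cform_field M) (A : R)
    (J : set R)
    (w_ : R -> form_field M) (Ups_ : R -> cform_field M)
    (beta : R -> form_field M) (gamma : R -> cform_field M)
    (f : R -> point_of M -> R) :
  contact_calabi_yau xi eta Phi g Ups ->
  is_interval J -> J 0 -> (exists2 s, J s & s != 0) ->
  let dcf t := dc_op Phi (f t) in
  let eta_ t : form_field M := fun c x => eta c x + dcf t c x in
  let h t := su3_norm (w_ t) (Ups_ t) in
  let phi_ t := g2_form (eta_ t) (w_ t) (Ups_ t) in
  let grad t := grad_log_norm (phi_ t) (w_ t) (Ups_ t) in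
  let dlog t c x := fun_d (log_norm (w_ t) (Ups_ t) c) x in
  smooth_family J w_ -> smooth_cfamily J Ups_ ->
  (forall t, J t -> transverse_kahler xi eta Phi (w_ t) /\
                    transverse_volume xi eta Phi (Ups_ t)) ->
  (forall c x, img c x -> w_ 0 c x = ext_d (eta c) x /\ Ups_ 0 c x = Ups c x) ->
  (forall t, J t -> basic_form xi 2 (beta t) /\ basic_cform xi 3 (gamma t)) ->
  (forall t, J t -> has_dt J w_ t (fun c x =>
     - lie_d (grad t c) (w_ t c) x + beta t c x)) ->
  (forall t, J t -> has_cdt J Ups_ t (fun c x =>
     clie_d (grad t c) (Ups_ t c) x + gamma t c x)) ->
  (forall t, J t -> basic_fun xi (f t)) ->
  smooth_family J (fun t c x => form0 (fun_field (f t) c x)) ->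
  (forall t, J t -> forall c x, img c x ->
     w_ t c x = ext_d (eta c) x + ext_d (dcf t c) x) ->
  modified_coflow A J phi_ <->
  forall t, J t -> forall c x, img c x ->
    wedge (beta t c x) (w_ t c x) =
      - (h t c x ^+ 2 *: wedge (w_ t c x) (w_ t c x))
      + (A * h t c x) *: wedge (w_ t c x) (w_ t c x)
      - (A / h t c x) *: wedge (dlog t c x) (Re_form (Ups_ t c x))
      - wedge (lie_d (grad t c) (dcf t c) x) (Im_form (Ups_ t c x))
      - wedge (int_prod (grad t c x) (ext_d (eta c) x)) (Im_form (Ups_ t c x))
      + wedge (time_d J dcf t c x) (Im_form (Ups_ t c x))
    /\
    Im_form (gamma t c x) =
      - ((2 * h t c x ^+ 2) *: wedge (dlog t c x) (w_ t c x))
      + (A * h t c x) *: wedge (dlog t c x) (w_ t c x).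
Proof.
move=> [S _ _] iJ J0 [s Js s0] dcf eta_ h phi_ grad dlog _ _ T _ B dw dU bf sf ew.
have two : exists s s', [/\ J s, J s' & s != s'] by exists s, 0.
exact: (modified_coflow_iff A S iJ two T B bf sf ew dw dU).
Qed.
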